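(* Let $n$ be a positive integer. There exist continuous increasing functions $\epsilon_n$ and $C_n$ on $[0,\infty)$, depending only on $n$, with $\epsilon_n(0)=C_n(0)=0$, such that for every complete noncompact $n$-dimensional Alexandrov space $M$ with nonnegative curvature we have $$\epsilon_n(v_\infty(M))\le\mathrm{ob}_\infty(M)\le C_n(v_\infty(M)).$$ In particular, $v_\infty(M)=0$ if and only if $\mathrm{ob}_\infty(M)=0$.
   Context: Alexandrov spaces of curvature $\ge\kappa$ are taken in the sense of Burago–Gromov–Perelman and are assumed finite-dimensional. $|x,y|$ denotes distance. For $M$ complete noncompact $n$-dimensional of nonnegative curvature, the volume growth rate is $$v_\infty(M)=\lim_{R\to\infty}\frac{\mathcal H^n(B(p,R))}{R^n},$$ where $p\in M$ is any fixed point, $B(p,R)$ is the metric ball and $\mathcal H^n$ is the $n$-dimensional Hausdorff measure. For a point $p$, $\Sigma_p$ is the space of directions at $p$ with its angle metric $\angle$. For $p\ne q$, $\Uparrow_p^q\subset\Sigma_p$ is the set of all directions at $p$ of minimal geodesics from $p$ to $q$, and $\uparrow_p^q$ denotes an element of $\Uparrow_p^q$. For a set $A\subset \Sigma_p$, $\angle(A,\xi)$ is the distance in $\Sigma_p$ from $\xi$ to $A$. For complete noncompact $M$ and $p\ne q\in M$ define $$\mathrm{ob}_\infty(p,q)=\limsup_{x\to\infty}\max\{\angle(\Uparrow_p^q,\uparrow_p^x),\angle(\Uparrow_q^p,\uparrow_q^x)\}-\pi/2$$ (the limsup is as $x$ leaves every bounded set, over all choices of $\uparrow_p^x\in\Uparrow_p^x$,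 $\uparrow_q^x\in\Uparrow_q^x$), and the obtuse constant of $M$ from infinity $$\mathrm{ob}_\infty(M)=\liminf_{|p,q|\to0}\mathrm{ob}_\infty(p,q)\in[0,\pi/2],$$ the liminf being over pairs $p\ne q$ in $M$. *)

(* Defs.v *)
From mathcomp Require Import all_boot all_order all_algebra.
From mathcomp Require Import all_classical all_reals all_analysis.

Set Implicit Arguments.
Unset Strict Implicit.
Unset Printing Implicit Defensive.

Import Order.TTheory GRing.Theory Num.Theory.
Import numFieldNormedType.Exports.

Local Open Scope classical_set_scope.
Local Open Scope ring_scope.

(* The library's [completeType] is pointed, hence this unpointed version. *)
Definition complete_metric (R : realType) (M : metricType R) : Prop :=
  forall F : set_system M, ProperFilter F -> cauchy F -> exists l : M, F --> l.

(** * Hausdorff measure *)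

Section hausdorff.
Context {R : realType} {M : metricType R}.
Local Open Scope ereal_scope.

Definition diam (U : set M) : \bar R :=
  ereal_sup [set (mdist x y)%:E | x in U & y in U].

(* The case split makes the empty set free also for [s = 0]. *)
Definition diam_pow (s : R) (U : set M) : \bar R :=
  if U == set0 then 0 else poweR (diam U) s.

Definition hausdorff_content (s delta : R) (A : set M) : \bar R :=
  ereal_inf [set \sum_(0 <= i <oo) diam_pow s (U i) | U in
    [set U : nat -> set M | A `<=` \bigcup_i U i /\
                            forall i, diam (U i) <= delta%:E]].

Definition unnormalized_hausdorff (s : R) (A : set M) : \bar R :=
  ereal_sup [set hausdorff_content s delta A | delta in
    [set delta : R | (0 < delta)%R]].

Definition hausdorff_dim (A : set M) : \bar R :=
  ereal_inf [set s%:E | s in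
    [set s : R | (0 <= s)%R /\ unnormalized_hausdorff s A = 0]].

End hausdorff.

(* Volume of the Euclidean unit ball of dimension n, by the recursion
   omega_(n+2) = (2 pi / (n + 2)) omega_n. *)
Fixpoint unit_ball_volume (R : realType) (n : nat) : R :=
  match n with
  | 0 => 1
  | 1 => 2
  | m.+2 => 2 * pi / m.+2%:R * unit_ball_volume R m
  end.

(* Normalized to agree with Lebesgue measure on Euclidean n-space. *)
Definition hausdorff_measure (R : realType) (M : metricType R) (n : nat)
    (A : set M) : \bar R :=
  ((unit_ball_volume R n / 2 ^+ n)%:E * unnormalized_hausdorff n%:R A)%E.

Definition volume_growth_rate (R : realType) (M : metricType R) (n : nat)
    (p : M) : R :=
  fine (lim ((hausdorff_measure n (ball p r) * ((r ^+ n)^-1)%:E)%E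
               @[r --> +oo%R])).

(** * Alexandrov spaces of nonnegative curvature *)

Section alexandrov.
Context {R : realType}.
Implicit Type M : metricType R.

(* The angle at p of the Euclidean triangle with side lengths |p,x|, |p,y|,
   |x,y|; meaningful for x and y distinct from p. *)
Definition comparison_angle M (p x y : M) : R :=
  acos ((mdist p x ^+ 2 + mdist p y ^+ 2 - mdist x y ^+ 2)
          / (2 * mdist p x * mdist p y)).

(* Intrinsic metrics in the sense of Burago-Gromov-Perelman: chains of
   arbitrarily small steps and almost minimal total length. *)
Definition intrinsic M : Prop :=
  forall (x y : M) (delta : R), 0 < delta ->
  exists (k : nat) (z : nat -> M),
    [/\ z 0%N = x, z k = y,
        forall i, (i < k)%N -> mdist (z i) (z i.+1) < delta &
        \sum_(i < k) mdist (z i) (z i.+1) < mdist x y + delta].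

(* The Burago-Gromov-Perelman four-point condition, required locally. *)
Definition curvature_ge0 M : Prop :=
  forall x : M, exists2 U : set M, nbhs x U &
    forall a b c d : M, U a -> U b -> U c -> U d -> uniq [:: a; b; c; d] ->
      comparison_angle a b c + comparison_angle a b d + comparison_angle a c d
        <= 2 * pi.

(* Burago, Gromov and Perelman ask for local completeness only; all spaces
   considered here are complete. *)
Definition complete_alexandrov_ge0 M (n : nat) : Prop :=
  [/\ complete_metric M, intrinsic M, curvature_ge0 M &
      hausdorff_dim [set: M] = n%:R%:E].

End alexandrov.

(** * Spaces of directions and the obtuse constant from infinity *)

Section directions.
Context {R : realType} {M : metricType R}.
Implicit Types p q x : M.

(* Minimal geodesics from p to q, parametrized by arc length; the values of g
   outside [0, |p,q|] are irrelevant. *)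
Definition shortest_path p q : set (R -> M) :=
  [set g | [/\ g 0 = p, g (mdist p q) = q &
     {in `[0, mdist p q] &, forall s t, mdist (g s) (g t) = `|s - t|}]].

Definition shortest_paths_from p : set (R -> M) :=
  [set g | exists2 q, q != p & shortest_path p q g].

Definition path_angle p (g h : R -> M) : R :=
  lim (comparison_angle p (g st.1) (h st.2)
         @[st --> filter_prod (0 : R)^'+ (0 : R)^'+]).

(* The completion of the space of shortest paths issuing from p under
   [path_angle p]: a direction is represented by a Cauchy sequence of such
   paths, and representatives at [angle] 0 stand for the same direction. *)
Definition space_of_directions p : set (nat -> R -> M) :=
  [set u | (forall k, shortest_paths_from p (u k)) /\
     forall e : R, 0 < e -> exists N, forall j k, (N <= j)%N -> (N <= k)%N ->
       path_angle p (u j) (u k) < e].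

Definition angle p (u v : nat -> R -> M) : R :=
  lim (path_angle p (u k) (v k) @[k --> \oo]).

(* The set of directions at p of shortest paths from p to q; a path is sent
   into the completion as a constant sequence. *)
Definition directions_to p q : set (nat -> R -> M) :=
  space_of_directions p `&`
  [set u | exists2 g, shortest_path p q g & u = fun=> g].

Definition angle_to_set p (A : set (nat -> R -> M)) (xi : nat -> R -> M)
  : \bar R := ereal_inf [set (angle p a xi)%:E | a in A].

Definition at_infinity : set_system M :=
  [set A | exists (o : M) (r : R), ~` ball o r `<=` A].

Definition near_diagonal : set_system (M * M)%type :=
  [set A | exists2 e : R, 0 < e &
     forall p q, p != q -> mdist p q < e -> A (p, q)].

(* The inner supremum ranges over the choices of directions towards x. *)
Definition ob_infty_pair p q : \bar R :=
  (limf_esup (fun x : M =>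
      ereal_sup [set maxe (angle_to_set p (directions_to p q) xi)
                          (angle_to_set q (directions_to q p) eta)
                | xi in directions_to p x & eta in directions_to q x])
    at_infinity - (pi / 2)%:E)%E.

End directions.

Definition ob_infty (R : realType) (M : metricType R) : \bar R :=
  limf_einf (fun pq : M * M => ob_infty_pair pq.1 pq.2) near_diagonal.

Definition continuous_increasing_from0 (R : realType) (f : R -> R) : Prop :=
  [/\ {within `[0, +oo[, continuous f},
      {in `[0, +oo[ &, {homo f : x y / x < y}} & f 0 = 0].

(* Main.v *)
Require Import Defs.
From mathcomp Require Import all_boot all_order all_algebra.
From mathcomp Require Import all_classical all_reals all_analysis.
From mathcomp Require Import ring lra.
Import Order.TTheory GRing.Theory Num.Theory.
Import numFieldNormedType.Exports.

Set Implicit Arguments.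
Unset Strict Implicit.
Unset Printing Implicit Defensive.

Local Open Scope classical_set_scope.
Local Open Scope ring_scope.

(* No limit spaces are used. Toponogov's globalization makes the four-point
   condition global; contracting along shortest paths towards a point then
   shrinks no distance by more than the contraction factor, whence the
   monotonicity of the volume ratio. Packings are bounded because an excessively
   large one would allow to build a strainer with n + 1 pairs, around which the
   dimension is greater than n.

   If ob_infty M < eta, some pair p, q sees all far points x under angles at most
   pi / 2 + eta from both ends. Contracted towards p to a ball of radius eta |p,q|,
   the far points lie in a slab of relative width eta orthogonal to q, and sliding
   this slab towards q yields about 1 / eta disjoint copies of it. Hence the volume
   growth is at most proportional to eta.

   If eta < ob_infty M, consider a strainer with k < n pairs at scale lam. At an
   infinitesimal scale there is a pair q, y on which its k coordinates nearly
   agree, and a long shortest path from q making an angle > pi / 2 + eta with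
   qy. The latter bounds the share of the coordinates in the velocity of the path
   away from 1. So following the path for a length comparable to lam and then
   moving back, by means of the strainer, to the coordinates of q leads to a point w
   at distance comparable to lam from q, and q, w extend the strainer. Starting from
   the empty strainer on a ball of radius r, this ends with n pairs at a scale
   comparable to r, and bounds the volume of the ball below. *)

(** * Comparison products and the four-point condition *)

(** A circle has to be avoided: shortest paths exist only once balls are known to be totally
    bounded, this follows from the packing bound, and the packing bound needs strainers. Strainers
    are therefore developed with almost shortest paths and with a four-point condition that holds on
    a region [U] only. The same lemmas serve twice, first on small balls and later, after
    globalization, with [V] and [U] the whole space.

    Angles are avoided as far as possible. Comparison cosines are multiplied out to [ip], which is
    polynomial in squared distances and harmless for coinciding points, so most estimates become
    real arithmetic. The four-point condition bounds distances after a displacement from above only;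
    a lower bound has to come from the triangle inequality with a further point.

    The lower function of the theorem is linear, since the slab argument gives an explicit constant.
    The upper function is an abstract modulus made from the volume bound for each [eta]. *)

Section comparison_product.
Context {R : realType} {M : metricType R}.
Implicit Types x y z p w : M.
Local Notation d x y := (@mdist R M x y : R).

(* |z,x| |z,y| times the cosine of the comparison angle at z; it vanishes when
   x or y is z. *)
Definition ip z x y : R := (d z x ^+ 2 + d z y ^+ 2 - d x y ^+ 2) / 2.

Lemma ipC z x y : ip z x y = ip z y x.
Proof. by rewrite /ip (metric_sym x y) (addrC (d z x ^+ 2)). Qed.

Lemma ballP x (r : R) y : ball x r y <-> d x y < r.
Proof. by rewrite ballEmdist. Qed.

Lemma mdist_diff x y z : `|d x z - d y z| <= d x y.
Proof.
rewrite ler_norml; have := metric_triangle x y z.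
have := metric_triangle y x z; rewrite (metric_sym y x) => h1 h2; lra.
Qed.

Lemma ip_bounds z x y : `|ip z x y| <= d z x * d z y.
Proof.
rewrite ler_norml /ip; have := metric_triangle x z y; have := metric_triangle z x y.
have := metric_triangle z y x; rewrite (metric_sym y x) (metric_sym x z).
have := mdist_ge0 z x; have := mdist_ge0 z y; have := mdist_ge0 x y.
set a := d z x; set b := d z y; set c := d x y => h1 h2 h3 h4 h5 h6.
have := mulr_ge0 h1 h1; nra.
Qed.

Lemma ipxx z x : ip z x x = d z x ^+ 2.
Proof. by rewrite /ip mdistxx; field. Qed.

Lemma ip0l z y : ip z z y = 0.
Proof. by rewrite /ip mdistxx; field. Qed.

Lemma ip0r z y : ip z y z = 0.
Proof. by rewrite ipC ip0l. Qed.

Lemma sqr_mdist_ip z x y : d x y ^+ 2 = d z x ^+ 2 + d z y ^+ 2 - ip z x y *+ 2.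
Proof. by rewrite /ip; field. Qed.

(** First variation with error term: the quotient is the drop of the distance to [s] plus [(d z c ^+
    2 - (d z s - d c s) ^+ 2) / (2 * d z s)]. The correction is nonnegative by the triangle
    inequality and quadratic in [d z c]. *)
Lemma ip_drop z s c : 0 < d z s ->
  d z s - d c s <= ip z s c / d z s <= d z s - d c s + d z c ^+ 2 / (2 * d z s).
Proof.
move=> zs0; rewrite /ip (metric_sym s c).
have := mdist_diff z c s; rewrite ler_norml => /andP[h1 h2].
set A := d z s in zs0 h1 h2 *; set B := d c s in h1 h2 *; set C := d z c in h1 h2 *.
have -> : (A ^+ 2 + C ^+ 2 - B ^+ 2) / 2 / A = A - B + (C ^+ 2 - (A - B) ^+ 2) / (2 * A).
  by field; lra.
have h : 0 <= C ^+ 2 - (A - B) ^+ 2 by nra.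
apply/andP; split; first by rewrite lerDl divr_ge0//; lra.
rewrite lerD2l ler_pM2r ?invr_gt0; last lra.
by rewrite gerBl sqr_ge0.
Qed.

Lemma comparison_cos p x y : p != x -> p != y ->
  -1 <= ip p x y / (d p x * d p y) <= 1.
Proof.
rewrite -!mdist_gt0 => px py; have := ip_bounds p x y; rewrite ler_norml => h.
by rewrite ler_pdivlMr ?mulr_gt0// ler_pdivrMr ?mulr_gt0// mul1r mulN1r.
Qed.

Lemma comparison_angleE p x y : p != x -> p != y ->
  comparison_angle p x y = acos (ip p x y / (d p x * d p y)).
Proof.
rewrite -!mdist_gt0 => px py; rewrite /comparison_angle /ip; congr acos.
by field; rewrite ?gt_eqF//.
Qed.

End comparison_product.

Section acos_facts.
Context {R : realType}.
Implicit Types a b c : R.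

Lemma acos_le a b : -1 <= a <= 1 -> -1 <= b <= 1 -> (acos a <= acos b) = (b <= a).
Proof.
move=> ha hb.
have i c : -1 <= c <= 1 -> acos c \in `[0, pi].
  by move=> hc; rewrite in_itv/= acos_ge0// acos_lepi.
have h := ltr_cos (i _ hb) (i _ ha).
rewrite !acosK ?in_itv// in h.
by rewrite leNgt -h -leNgt.
Qed.

Lemma acos_lt a b : -1 <= a <= 1 -> -1 <= b <= 1 -> (acos a < acos b) = (b < a).
Proof. by move=> ha hb; rewrite ltNge acos_le// -ltNge. Qed.

(* If A + B <= pi both cosines nearly cancel; otherwise A + B <= 2 pi - C and
   sum-to-product bounds the left-hand side below by - 2 cos (C / 2). *)
Lemma acos_sum_le_2pi a b c :
  -1 <= a <= 1 -> -1 <= b <= 1 -> -1 <= c <= 1 ->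
  acos a + acos b + acos c <= 2 * pi ->
  0 <= a + b + Num.sqrt (2 * (1 + c)).
Proof.
move=> ha hb hc; move: (acos_def ha) (acos_def hb) (acos_def hc).
set A := acos a; set B := acos b; set C := acos c.
move=> [/andP[A0 Api] Aa] [/andP[B0 Bpi] Bb] [/andP[C0 Cpi] Cc] hs.
have pi0 := pi_gt0 R.
set S := (A + B) / 2; set D := (A - B) / 2.
have Ea : a = cos (S + D) by rewrite -Aa; congr cos; rewrite /S /D; field.
have Eb : b = cos (S - D) by rewrite -Bb; congr cos; rewrite /S /D; field.
have sumE : a + b = cos S * cos D *+ 2 by rewrite Ea Eb cosD cosB; ring.
have cosD0 : 0 <= cos D by apply: cos_ge0_pihalf; rewrite /D; lra.
have cosC : cos (C / 2) ^+ 2 *+ 2 = 1 + c.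
  rewrite -Cc; have -> : cos C = cos ((C / 2) *+ 2) by congr cos; field.
  by rewrite cos_mulr2n; ring.
have C2 : 0 <= cos (C / 2) by apply: cos_ge0_pihalf; lra.
have -> : Num.sqrt (2 * (1 + c)) = 2 * cos (C / 2).
  rewrite -cosC; have -> : 2 * (cos (C / 2) ^+ 2 *+ 2) = (2 * cos (C / 2)) ^+ 2 by ring.
  by rewrite sqrtr_sqr ger0_norm//; lra.
have [hS|hS] := lerP S (pi / 2).
  have : 0 <= cos S by apply: cos_ge0_pihalf; rewrite /S in hS *; lra.
  move=> h; rewrite sumE; nra.
have cosS : - cos (C / 2) <= cos S.
  have -> : - cos (C / 2) = cos (pi - C / 2).
    by rewrite -[pi - _]opprB opprB addrC cosDpi cosN.
  have [->//|ne] := eqVneq S (pi - C / 2).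
  have i1 : S \in `[0, pi] by rewrite in_itv/= /S; apply/andP; split; lra.
  have i2 : pi - C / 2 \in `[0, pi] by rewrite in_itv/=; apply/andP; split; lra.
  by apply/ltW; rewrite (ltr_cos i1 i2) lt_neqAle ne /=  /S; lra.
have D1 := cos_le1 D.
rewrite sumE; nra.
Qed.

End acos_facts.

Section four_points.
Context {R : realType} {M : metricType R}.
Implicit Types x y z p w : M.
Local Notation d x y := (@mdist R M x y : R).

(* The four-point condition at z, with the sum of angles replaced by the
   consequence used below: cos (xzp) + cos (yzp) >= - sqrt (2 (1 + cos (xzy))). *)
Definition fourpt (U : set M) : Prop := forall z x y p, U z -> U x -> U y -> U p ->
  0 <= d z y * ip z x p + d z x * ip z y p
       + d z p * Num.sqrt (2 * (d z x * d z y) * (d z x * d z y + ip z x y)).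

Lemma fourpt_ratio z x y p : z != x -> z != y -> z != p ->
  (0 <= d z y * ip z x p + d z x * ip z y p
       + d z p * Num.sqrt (2 * (d z x * d z y) * (d z x * d z y + ip z x y))) =
  (0 <= ip z x p / (d z x * d z p) + ip z y p / (d z y * d z p) +
    Num.sqrt (2 * (1 + ip z x y / (d z x * d z y)))).
Proof.
rewrite -!mdist_gt0 => zx zy zp; set a := d z x; set b := d z y; set c := d z p.
have -> : 2 * (a * b) * (a * b + ip z x y) = (a * b) ^+ 2 * (2 * (1 + ip z x y / (a * b))).
  by field; rewrite /a /b; apply/andP; split; rewrite gt_eqF.
rewrite sqrtrM ?sqr_ge0// sqrtr_sqr ger0_norm ?mulr_ge0 ?mdist_ge0//.
set T := Num.sqrt _.
have -> : b * ip z x p + a * ip z y p + c * (a * b * T) =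
  (a * b * c) * (ip z x p / (a * c) + ip z y p / (b * c) + T).
  by field; rewrite !gt_eqF.
by rewrite pmulr_rge0// !mulr_gt0.
Qed.

(** The curvature assumption speaks of distinct points only. In the multiplied-out form the
    degenerate cases are trivial or follow from [ip_bounds], so [fourpt] can be stated for all
    quadruples. *)
Lemma fourpt_degenerate z x y p :
  [|| z == x, z == y, z == p, x == y, x == p | y == p] ->
  0 <= d z y * ip z x p + d z x * ip z y p
       + d z p * Num.sqrt (2 * (d z x * d z y) * (d z x * d z y + ip z x y)).
Proof.
have S0 r : 0 <= Num.sqrt r :> R by exact: sqrtr_ge0.
have dg := @mdist_ge0 R M.
have sD u v : d u v * d u v + ip u v v = 2 * d u v ^+ 2 by rewrite ipxx; ring.
case/or4P => [/eqP e|/eqP e|/eqP e|].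
- by rewrite -e mdistxx !ip0l !(mul0r, mulr0, add0r) sqrtr0 mulr0.
- by rewrite -e mdistxx !ip0l !(mul0r, mulr0, add0r) sqrtr0 mulr0.
- by rewrite -e mdistxx !ip0r !(mul0r, mulr0, add0r).
case/or3P => /eqP ->.
- rewrite sD; have -> : 2 * (d z y * d z y) * (2 * d z y ^+ 2) = (2 * d z y ^+ 2) ^+ 2 by ring.
  rewrite sqrtr_sqr ger0_norm; last by rewrite mulr_ge0// sqr_ge0.
  have := ip_bounds z y p; rewrite ler_norml => /andP[h _].
  have := dg z y; have := dg z p; nra.
- rewrite ipxx addr_ge0 ?mulr_ge0//.
  have := ip_bounds z y p; rewrite ler_norml => /andP[h _].
  have := dg z y; have := dg z p; nra.
- rewrite ipxx addr_ge0 ?mulr_ge0//.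
  have := ip_bounds z x p; rewrite ler_norml => /andP[h _].
  have := dg z x; have := dg z p; nra.
Qed.

Lemma fourpt_of_curvature (U : set M) :
  (forall a b c e : M, U a -> U b -> U c -> U e -> uniq [:: a; b; c; e] ->
    comparison_angle a b c + comparison_angle a b e + comparison_angle a c e
      <= 2 * pi) -> fourpt U.
Proof.
move=> hU z x y p Uz Ux Uy Up.
have [|] := boolP [|| z == x, z == y, z == p, x == y, x == p | y == p].
  exact: fourpt_degenerate.
rewrite !negb_or => /and5P[zx zy zp xy /andP[xp yp]].
rewrite fourpt_ratio//.
have un : uniq [:: z; x; y; p] by rewrite /= !inE !negb_or zx zy zp xy xp yp.
have := hU _ _ _ _ Uz Ux Uy Up un; rewrite !comparison_angleE// => h.
apply: acos_sum_le_2pi; rewrite ?comparison_cos//.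
by rewrite addrC addrA.
Qed.

Lemma fourptS (U V : set M) : U `<=` V -> fourpt V -> fourpt U.
Proof. by move=> s h z x y p uz ux uy up; apply: h; exact: s. Qed.

End four_points.

(** * Almost shortest paths *)

Section intrinsic_paths.
Context {R : realType} {M : metricType R}.
Implicit Types x y z p w : M.
Local Notation d x y := (@mdist R M x y : R).

Lemma chain_length (z : nat -> M) (m n : nat) : (m <= n)%N ->
  d (z m) (z n) <= \sum_(m <= i < n) d (z i) (z i.+1).
Proof.
elim: n => [|n IH]; first by rewrite leqn0 => /eqP ->; rewrite mdistxx big_geq.
rewrite leq_eqVlt => /orP[/eqP ->|]; first by rewrite mdistxx big_geq.
rewrite ltnS => mn; rewrite big_nat_recr//=.
by apply: le_trans (metric_triangle _ (z n) _) _; rewrite lerD2r IH.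
Qed.

(* The path through a fine chain of almost minimal length, where time t is sent
   to the first point of the chain at distance at least t from the origin. *)
Lemma intrinsic_almost_path (iM : intrinsic M) x y (e : R) : 0 < e ->
  exists g : R -> M, [/\ g 0 = x, d (g (d x y)) y <= e &
    forall s t, 0 <= s -> s <= t -> t <= d x y ->
      t - s - e <= d (g s) (g t) <= t - s + e].
Proof.
move=> e0; set D := d x y; pose dl := e / 2.
have dl0 : 0 < dl by rewrite /dl; lra.
have [k [z [z0 zk step tot]]] := iM x y dl dl0.
pose i t := find (fun j => t <= d x (z j)) (iota 0 k.+1).
have ik t : t <= D -> (i t <= k)%N.
  move=> tD; have : has (fun j => t <= d x (z j)) (iota 0 k.+1).
    by apply/hasP; exists k; rewrite ?mem_iota ?add0n ?ltnSn// zk.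
  by rewrite has_find size_iota ltnS.
have i1 t : t <= D -> t <= d x (z (i t)).
  move=> tD; have : has (fun j => t <= d x (z j)) (iota 0 k.+1).
    by apply/hasP; exists k; rewrite ?mem_iota ?add0n ?ltnSn// zk.
  by move=> /(nth_find 0%N); rewrite nth_iota ?add0n// ltnS ik.
have i2 t : 0 <= t -> t <= D -> d x (z (i t)) <= t + dl.
  move=> t0 tD; case E: (i t) => [|j]; first by rewrite z0 mdistxx; lra.
  have jk : (j < k)%N by rewrite -E; exact: ik.
  have jf : (j < i t)%N by rewrite E.
  have /negbT : (fun j => t <= d x (z j)) (nth 0%N (iota 0 k.+1) j) = false.
    exact: (before_find 0%N jf).
  rewrite nth_iota ?add0n ?ltnS 1?ltnW// -ltNge => h.
  have := metric_triangle x (z j) (z j.+1); have := step _ jk; lra.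
have mono s t : s <= t -> (i s <= i t)%N.
  by move=> st; apply: sub_find => j /=; apply: le_trans.
have sumE m n : (m <= n)%N -> (n <= k)%N ->
    \sum_(0 <= j < m) d (z j) (z j.+1) + \sum_(m <= j < n) d (z j) (z j.+1) +
    \sum_(n <= j < k) d (z j) (z j.+1) < D + dl.
  move=> mn nk; rewrite -big_cat_nat//= -big_cat_nat//=.
  by rewrite big_mkord.
exists (fun t => z (i t)); split.
- have -> : i 0 = 0%N by rewrite /i /= mdist_ge0.
  by [].
- have := sumE (i D) (i D) (leqnn _) (ik _ (lexx _)).
  have := chain_length z (leq0n (i D)); have := chain_length z (ik _ (lexx D)).
  have := i1 _ (lexx D); rewrite zk z0 (big_geq (leqnn _)) /dl; lra.
move=> s t s0 st tD; have sD := le_trans st tD; have t0 := le_trans s0 st.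
have := sumE _ _ (mono _ _ st) (ik _ tD).
have := chain_length z (leq0n (i s)); have := chain_length z (mono _ _ st).
have := chain_length z (ik _ tD); rewrite zk z0.
have := i1 _ sD; have := i1 _ tD; have := i2 _ s0 sD; have := i2 _ t0 tD.
have := metric_triangle x (z (i s)) (z (i t)).
have := metric_triangle x (z (i t)) y; rewrite -/D /dl.
move=> h1 h2 h3 h4 h5 h6 h7 h8 h9 h10; apply/andP; split; lra.
Qed.

Local Ltac lr := clear -M; lra.

(** Stewart's theorem as an inequality with errors; [a], [b], [c], [P], [Q], [D] stand for the
    distances xz, zy, zp, xp, yp, xy. The radicand is [a * b * (a + b - D) * (a + b + D)], so an
    excess of order [s ^+ 2] in the lengths becomes an error of order [s]. *)
Lemma stewart_estimate (K D t a b c P Q s : R) :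
  0 <= s <= 1 -> 0 <= t <= D -> D <= K -> 0 <= a <= K -> 0 <= b <= K -> 0 <= c <= K ->
  0 <= P <= K -> 0 <= Q <= K -> D <= a + b ->
  t - K * s ^+ 2 <= a <= t + K * s ^+ 2 -> b <= D - t + K * s ^+ 2 ->
  0 <= b * ((a ^+ 2 + c ^+ 2 - P ^+ 2) / 2) + a * ((b ^+ 2 + c ^+ 2 - Q ^+ 2) / 2)
    + c * Num.sqrt (2 * (a * b) * (a * b + (a ^+ 2 + b ^+ 2 - D ^+ 2) / 2)) ->
  D * ((a ^+ 2 + P ^+ 2 - c ^+ 2) / 2) <=
  t * ((D ^+ 2 + P ^+ 2 - Q ^+ 2) / 2) + 8 * K ^+ 3 * s.
Proof.
move=> /andP[s0 s1] /andP[t0 tD] DK /andP[a0 aK] /andP[b0 bK] /andP[c0 cK].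
move=> /andP[P0 PK] /andP[Q0 QK] Dab /andP[at1 at2] bt.
set S := Num.sqrt _ => h.
have K0 : 0 <= K by lra.
set e := K * s ^+ 2 in at1 at2 bt.
have s20 : 0 <= s ^+ 2 by exact: sqr_ge0.
have s2s : s ^+ 2 <= s by rewrite expr2 ler_piMl.
have e0 : 0 <= e by rewrite mulr_ge0.
have eK : e <= K * s by rewrite ler_wpM2l.
have sqK v : 0 <= v -> v <= K -> v ^+ 2 <= K ^+ 2 by move=> *; rewrite lerXn2r// nnegrE.
have SK : S <= 3 * K ^+ 2 * s.
  have B0 : 0 <= 3 * K ^+ 2 * s by rewrite !mulr_ge0// sqr_ge0.
  rewrite -[leRHS]ger0_norm// -sqrtr_sqr; apply: ler_wsqrtr.
  have ab : a * b <= K ^+ 2 by rewrite expr2 ler_pM.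
  have ab0 : 0 <= a * b by rewrite mulr_ge0.
  have -> : 2 * (a * b) * (a * b + (a ^+ 2 + b ^+ 2 - D ^+ 2) / 2) =
            (a * b) * ((a + b - D) * (a + b + D)) by field.
  have h1 : (a + b - D) * (a + b + D) <= (2 * e) * (3 * K).
    by apply: ler_pM; move: Dab at2 bt aK bK DK a0 b0 t0 tD; lr.
  have h2 : 0 <= (a + b - D) * (a + b + D) by apply: mulr_ge0; lra.
  have h3 : (a * b) * ((a + b - D) * (a + b + D)) <= K ^+ 2 * ((2 * e) * (3 * K)).
    by apply: ler_pM.
  apply: (le_trans h3); rewrite /e.
  have -> : K ^+ 2 * (2 * (K * s ^+ 2) * (3 * K)) = 6 * (K ^+ 2 * s) ^+ 2 by ring.
  have -> : (3 * K ^+ 2 * s) ^+ 2 = 9 * (K ^+ 2 * s) ^+ 2 by ring.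
  by rewrite ler_wpM2r ?sqr_ge0//; lra.
have S0 : 0 <= S by exact: sqrtr_ge0.
have cS : c * S <= 3 * K ^+ 3 * s.
  have -> : 3 * K ^+ 3 * s = K * (3 * K ^+ 2 * s) by ring.
  exact: ler_pM.
have k2 : 0 <= K ^+ 2 by exact: sqr_ge0.
have eK2 : e * K ^+ 2 <= K ^+ 3 * s.
  have -> : K ^+ 3 * s = (K * s) * K ^+ 2 by ring.
  by rewrite ler_wpM2r.
have T1 : - (e * K ^+ 2) <= (b - (D - t)) * P ^+ 2.
  have := sqK _ P0 PK; have := sqr_ge0 P; have : - e <= b - (D - t) by lra.
  move: (b - _) (P ^+ 2) (K ^+ 2) => u v w; nra.
have T2 : - (e * K ^+ 2) <= (a - t) * Q ^+ 2.
  have := sqK _ Q0 QK; have := sqr_ge0 Q; have : - e <= a - t by lra.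
  move: (a - _) (Q ^+ 2) (K ^+ 2) => u v w; nra.
have T3 : (a + b - D) * c ^+ 2 <= 2 * (e * K ^+ 2).
  by rewrite mulrA; apply: ler_pM; rewrite ?sqr_ge0 ?sqK//; move: Dab at2 bt; lr.
have T4 : (a - t) * D ^+ 2 <= e * K ^+ 2.
  have := sqK D (le_trans t0 tD) DK; have := sqr_ge0 D; have : a - t <= e by lra.
  move: (a - _) (D ^+ 2) (K ^+ 2) => u v w; nra.
have T5 : (a + b - D) * (a * (D + b)) <= 4 * (e * K ^+ 2).
  have -> : 4 * (e * K ^+ 2) = (2 * e) * (K * (2 * K)) by ring.
  apply: ler_pM.
  - by move: Dab; lr.
  - exact: mulr_ge0 a0 (addr_ge0 (le_trans t0 tD) b0).
  - by move: at2 bt; lr.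
  - by apply: ler_pM => //; [exact: addr_ge0 (le_trans t0 tD) b0|move: DK bK; lr].
have E : t * ((D ^+ 2 + P ^+ 2 - Q ^+ 2) / 2) - D * ((a ^+ 2 + P ^+ 2 - c ^+ 2) / 2) =
  (b * ((a ^+ 2 + c ^+ 2 - P ^+ 2) / 2) + a * ((b ^+ 2 + c ^+ 2 - Q ^+ 2) / 2) + c * S)
  - c * S + ((b - (D - t)) * P ^+ 2 + (a - t) * Q ^+ 2 - (a + b - D) * c ^+ 2
  - (a - t) * D ^+ 2 - (a + b - D) * (a * (D + b))) / 2 by field.
have s2K : 0 <= K ^+ 3 * s by rewrite mulr_ge0// exprn_ge0.
by move: E h cS eK2 T1 T2 T3 T4 T5 s2K; lr.
Qed.

Lemma approx_point_between (iM : intrinsic M) (U : set M) x y (t e K : R) :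
  fourpt U -> U x -> U y -> (forall z, d x z <= 2 * d x y -> U z) ->
  0 <= t <= d x y -> 0 < e ->
  exists z, [/\ U z, t - e <= d x z <= t + e, d z y <= d x y - t + e &
    forall p, U p -> d x p <= K -> d x y * ip x z p <= t * ip x y p + e].
Proof.
move=> fU Ux Uy Uz tD e0; have D0 := mdist_ge0 x y.
have [Dz|Dn] := eqVneq (d x y) 0.
  exists x; have t0 : t = 0 by lra.
  rewrite t0 Dz mdistxx; split=> //; [lra|lra|].
  by move=> p _ _; rewrite !mul0r; lra.
have Dpos : 0 < d x y by rewrite lt_neqAle eq_sym Dn.
set D := d x y in tD D0 Dn Dpos *.
(* An upper bound for all six distances among [x], [y], [p] and the point to be found. *)
pose L := `|K| + 3 * D + 1.
have aK : K <= `|K| by exact: ler_norm.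
have K0 : 0 <= `|K| by exact: normr_ge0.
have L0 : 0 < L by rewrite /L; lra.
have L3 : 0 < 8 * L ^+ 3 by rewrite mulr_gt0// exprn_gt0.
have [s [s0 s1 Ls se]] : exists s : R, [/\ 0 < s, s <= 1, L * s ^+ 2 <= Num.min e D / 2 &
    8 * L ^+ 3 * s <= e].
  have m0 : 0 < Num.min e D / 2 by rewrite divr_gt0// lt_min e0.
  exists (Num.min 1 (Num.min (Num.min e D / 2 / L) (e / (8 * L ^+ 3)))).
  set s := Num.min _ _.
  have s0 : 0 < s by rewrite !lt_min ltr01 !divr_gt0//= lt_min e0.
  have s1 : s <= 1 by rewrite ge_min lexx.
  have s2 : s <= Num.min e D / 2 / L by rewrite !ge_min lexx !orbT.
  have s3 : s <= e / (8 * L ^+ 3) by rewrite !ge_min lexx !orbT.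
  split=> //.
    rewrite ler_pdivlMr// mulrC in s2; apply: le_trans s2; rewrite ler_pM2l//.
    by rewrite expr2 ler_piMl// ltW.
  by rewrite mulrC -ler_pdivlMr.
have Lse : L * s ^+ 2 <= e / 2.
  by apply: (le_trans Ls); rewrite ler_pM2r ?invr_gt0// ge_min lexx.
have LsD : L * s ^+ 2 <= D / 2.
  by apply: (le_trans Ls); rewrite ler_pM2r ?invr_gt0// ge_min lexx orbT.
have Ls0 : 0 < L * s ^+ 2 by rewrite mulr_gt0// exprn_gt0.
have Ls20 : 0 < L * s ^+ 2 / 2 by lra.
have [g [g0 gD gst]] := intrinsic_almost_path iM x y Ls20.
have /andP[t0 tD'] := tD.
have := gst 0 t (lexx _) t0 tD'; rewrite g0 => /andP[h1 h2].
have := gst t D t0 tD' (lexx _) => /andP[h3 h4].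
have h5 := metric_triangle (g t) (g D) y.
have h6 : d (g t) y <= D - t + L * s ^+ 2 by lra.
have Ug : U (g t) by apply: Uz; rewrite -/D; lra.
exists (g t); split=> //; [|by move: h6 Lse e0; lr|].
  by apply/andP; split; move: h1 h2 Lse Ls0 e0; lr.
move=> p Up pK; apply: le_trans (_ : t * ip x y p + 8 * L ^+ 3 * s <= _); last by lra.
have dp : d x p <= L by rewrite /L; lra.
have dy : d y p <= L by have := metric_triangle y x p; rewrite (metric_sym y x) -/D /L; lra.
have dg : d x (g t) <= L by rewrite /L; lra.
have dgy : d (g t) y <= L by rewrite /L; lra.
have dgp : d (g t) p <= L.
  by have := metric_triangle (g t) x p; rewrite (metric_sym (g t) x) /L; lra.
have DL : D <= L by rewrite /L; lra.
have h7 := metric_triangle x (g t) y.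
have := fU _ _ _ _ Ug Ux Uy Up; rewrite /ip (metric_sym (g t) x) -/D.
move=> h8; apply: stewart_estimate h8; rewrite ?mdist_ge0 ?(ltW s0)//.
by apply/andP; split; move: h1 h2 Ls0; lr.
Qed.

(** For a point exactly between [x] and [y] the radicand of the four-point condition vanishes and no
    error remains. *)
Lemma ip_between (U : set M) x y z p : fourpt U -> U x -> U y -> U z -> U p ->
  d x z + d z y = d x y -> d x y * ip x z p <= d x z * ip x y p.
Proof.
move=> fU Ux Uy Uz Up; have := fU _ _ _ _ Uz Ux Uy Up.
rewrite /ip (metric_sym z x); set a := d x z; set b := d z y => h E.
rewrite -E in h *; move: h.
have -> : a * b + (a ^+ 2 + b ^+ 2 - (a + b) ^+ 2) / 2 = 0 by field.
by rewrite mulr0 sqrtr0 mulr0 addr0; lra.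
Qed.

End intrinsic_paths.

(** * Strainers *)

Section strainers.
Context {R : realType} {M : metricType R}.
Implicit Types x y z p w : M.
Local Notation d x y := (@mdist R M x y : R).

(* A variant of the strainers of Burago, Gromov and Perelman, with cosines of
   comparison angles; the conditions are imposed on a whole ball of radius lam,
   which is also a lower bound for the distances to the points S i b. *)
Definition strained (V : set M) (k : nat) (kap lam : R) z (S : nat -> bool -> M) :=
  [/\ 0 < lam, ball z lam `<=` V, (forall i b, (i < k)%N -> V (S i b)) &
  forall w, ball z lam w ->
  [/\ forall i b, (i < k)%N -> lam <= d w (S i b),
      forall i b, (i < k)%N -> ip w (S i b) (S i (~~ b))
         <= - (1 - kap ^+ 2 / 2) * (d w (S i b) * d w (S i (~~ b))) &
      forall i j b c, (i < k)%N -> (j < k)%N -> i != j ->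
        ip w (S i b) (S j c) <= kap * (d w (S i b) * d w (S j c))]].

(** Two regions, because the four-point condition is at first local: strainers live in [V], and [U]
    leaves room for points constructed on almost shortest paths between points of [V]. *)
Variables (V U : set M).
Hypotheses (iM : intrinsic M) (fU : fourpt U).
Hypothesis VU : forall x y z, V x -> V y -> d x z <= 2 * d x y -> U z.

Lemma VsubU : V `<=` U.
Proof. by move=> x Vx; apply: (VU Vx Vx); rewrite mdistxx mulr0. Qed.

Variables (k : nat) (kap lam : R) (z : M) (S : nat -> bool -> M).
Hypothesis kap01 : 0 < kap <= 1.
Hypothesis st : strained V k kap lam z S.

Local Ltac clr := clear -iM fU VU kap01 st.
Local Ltac lr := clr; lra.

(** From [w] the two points of a pair are almost opposite, so the square root in the four-point
    condition is at most [kap] times the product of their distances; this is why the defect in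
    [strained] is quadratic in [kap]. By [ip_drop] the resulting bound on cosines is one on
    distances: no displacement moves much away from both points in total. *)
Lemma strainer_drop_ge w i b c : ball z lam w -> (i < k)%N -> U c ->
  d w c <= kap * lam ->
  - (2 * kap * d w c) <=
  (d w (S i b) - d c (S i b)) + (d w (S i (~~ b)) - d c (S i (~~ b))).
Proof.
move=> zw ik Uc wc; have [lam0 zV SV /(_ _ zw)[sl sa _]] := st.
have := sl i b ik; have := sl i (~~ b) ik; have := sa i b ik.
have := fU (VsubU (zV _ zw)) (VsubU (SV _ b ik)) (VsubU (SV _ (~~ b) ik)) Uc.
set a := S i b; set a' := S i (~~ b); set A := d w a; set B := d w a'.
set r := d w c => h1 h2 Bl Al.
have A0 : 0 < A by exact: lt_le_trans Al.
have B0 : 0 < B by exact: lt_le_trans Bl.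
have r0 : 0 <= r by exact: mdist_ge0.
have AB0 : 0 < A * B by rewrite mulr_gt0.
have /andP[k0 k1] := kap01.
have sq : Num.sqrt (2 * (A * B) * (A * B + ip w a a')) <= kap * (A * B).
  rewrite -[leRHS]ger0_norm; last by rewrite mulr_ge0// ltW.
  rewrite -sqrtr_sqr; apply: ler_wsqrtr.
  have : A * B + ip w a a' <= kap ^+ 2 / 2 * (A * B) by lra.
  have -> : (kap * (A * B)) ^+ 2 = (2 * (A * B)) * (kap ^+ 2 / 2 * (A * B)) by field.
  by move=> h; rewrite ler_wpM2l// mulr_ge0// ltW.
have h3 : 0 <= ip w a c / A + ip w a' c / B + kap * r.
  have -> : ip w a c / A + ip w a' c / B + kap * r =
    (B * ip w a c + A * ip w a' c + r * (kap * (A * B))) / (A * B).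
    by field; rewrite !gt_eqF.
  rewrite divr_ge0 ?(ltW AB0)//; apply: (le_trans h1); rewrite lerD2l.
  by rewrite ler_wpM2l.
have /andP[_ ha] := ip_drop c A0; have /andP[_ hb] := ip_drop c B0.
have hr (D : R) : lam <= D -> r ^+ 2 / (2 * D) <= kap * r / 2.
  move=> lD; have D0 : 0 < D by exact: lt_le_trans lD.
  rewrite ler_pdivrMr ?mulr_gt0//.
  have : r * r <= (kap * D) * r.
    by apply: ler_wpM2r => //; apply: (le_trans wc); rewrite ler_wpM2l// ltW.
  by lr.
have := hr _ Al; have := hr _ Bl; move: ha hb h3; rewrite -/A -/B -/r.
by lr.
Qed.

(** The preceding estimate with [w] and [c] exchanged. *)
Lemma strainer_drop_le w i b c : ball z lam w -> (i < k)%N -> ball z lam c ->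
  d w c <= kap * lam ->
  (d w (S i b) - d c (S i b)) + (d w (S i (~~ b)) - d c (S i (~~ b)))
   <= 2 * kap * d w c.
Proof.
move=> zw ik zc wc; have [_ zV _ _] := st.
have := strainer_drop_ge (w := c) (i := i) b (c := w) zc ik (VsubU (zV _ zw)).
by rewrite (metric_sym c w) => /(_ wc); lr.
Qed.

(** The point [w'] lies about [t] along an almost shortest path from [w] to [S i b]. Almost
    orthogonality bounds the drops towards the other pairs from above, and [strainer_drop_ge] for
    the opposite points bounds them from below. In the last clause [w'] is almost opposite to
    [S i (~~ b)] as seen from [w], whence a lower bound for [ip w w' c]. *)
Lemma strainer_move w i b (t : R) : ball z lam w -> (i < k)%N -> 0 < t ->
  2 * t <= kap * lam ->
  exists w', [/\ U w', d w w' <= (1 + kap) * t,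
    d w (S i b) - d w' (S i b) - 2 * kap * t <= t
      <= d w (S i b) - d w' (S i b) + 2 * kap * t /\
    d w' (S i (~~ b)) - d w (S i (~~ b)) - 2 * kap * t <= t
      <= d w' (S i (~~ b)) - d w (S i (~~ b)) + 2 * kap * t,
    forall j c, (j < k)%N -> j != i -> `|d w' (S j c) - d w (S j c)| <= 6 * kap * t &
    forall c, U c -> d w c <= kap * lam ->
      d c w' ^+ 2 <= d w c ^+ 2 + t ^+ 2
        + 2 * t * (d w (S i (~~ b)) - d c (S i (~~ b))) + 7 * kap * t * (t + d w c)].
Proof.
move=> zw ik t0 tl; have [lam0 zV SV /(_ _ zw)[sl sa sm]] := st.
have /andP[k0 k1] := kap01.
(* The inequality for [w'] will be divided by a product of two distances, each at least [lam]; so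
   both [e] and [e / lam ^+ 2] have to be at most [kap ^+ 2 / 4 * t]. *)
pose e := kap ^+ 2 / 4 * t * Num.min 1 (lam ^+ 2).
have l20 : 0 < lam ^+ 2 by rewrite exprn_gt0.
have m0 : 0 < Num.min 1 (lam ^+ 2) by rewrite lt_min ltr01.
have k20 : 0 < kap ^+ 2 by rewrite exprn_gt0.
have k2k : kap ^+ 2 <= kap by rewrite expr2 ler_piMl// ltW.
have kt0 : 0 < kap ^+ 2 / 4 * t by rewrite mulr_gt0// divr_gt0.
have e0 : 0 < e by rewrite mulr_gt0.
have e1 : e <= kap ^+ 2 / 4 * t by rewrite /e ler_piMr ?(ltW kt0)// ge_min lexx.
have e2 : e / lam ^+ 2 <= kap ^+ 2 / 4 * t.
  by rewrite ler_pdivrMr// /e ler_wpM2l ?(ltW kt0)// ge_min lexx orbT.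
have k2t : kap ^+ 2 / 4 * t <= kap / 4 * t.
  by rewrite ler_wpM2r ?(ltW t0)// ler_wpM2r.
have ktt : kap * t <= t by rewrite ler_piMl// ltW.
set A := d w (S i b); have lA : lam <= A by exact: sl.
have A0 : 0 < A by exact: lt_le_trans lA.
have kl : kap * lam <= lam by rewrite ler_piMl// ltW.
have tA : 0 <= t <= A.
  by apply/andP; split; [exact: ltW | move: tl kl lA t0; lr].
pose K := \sum_(j < k) (d w (S j true) + d w (S j false)) + lam.
have UM x : d w x <= 2 * d w (S i b) -> U x by exact: VU (zV _ zw) (SV _ b ik).
have [w' [Uw' /andP[wl wu] wa wp]] := approx_point_between iM K fU (VsubU (zV _ zw))
  (VsubU (SV _ b ik)) UM tA e0.
rewrite -/A in wa wp.
set tau := d w w' in wl wu *.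
have sumj j c : (j < k)%N -> d w (S j c) <= K.
  move=> jk; rewrite /K (bigD1 (Ordinal jk))//=.
  have : 0 <= \sum_(i0 < k | i0 != Ordinal jk) (d w (S i0 true) + d w (S i0 false)).
    by apply: sumr_ge0 => j' _; rewrite addr_ge0// mdist_ge0.
  have := mdist_ge0 w (S j true); have := mdist_ge0 w (S j false).
  by case: c; move: lam0; lr.
have dirS j c : (j < k)%N ->
    ip w w' (S j c) / d w (S j c) <=
    t * (ip w (S i b) (S j c) / (A * d w (S j c))) + kap / 4 * t.
  move=> jk; have lB := sl j c jk; set B := d w (S j c) in lB *.
  have B0 : 0 < B by exact: lt_le_trans lB.
  have h := wp _ (VsubU (SV _ c jk)) (sumj _ c jk).
  have -> : ip w w' (S j c) / B = (A * ip w w' (S j c)) / (A * B).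
    by field; rewrite !gt_eqF.
  have h2 : e / (A * B) <= kap / 4 * t.
    apply: le_trans k2t; apply: le_trans e2.
    rewrite ler_pM2l// lef_pV2 ?posrE ?mulr_gt0// expr2.
    by apply: ler_pM => //; exact: ltW.
  apply: le_trans (_ : (t * ip w (S i b) (S j c) + e) / (A * B) <= _).
    by rewrite ler_wpM2r// invr_ge0 mulr_ge0// ltW.
  by rewrite mulrDl -mulrA lerD2l.
have dropS j c : (j < k)%N ->
    d w (S j c) - d w' (S j c) <= ip w w' (S j c) / d w (S j c).
  move=> jk; have B0 : 0 < d w (S j c) by apply: lt_le_trans (sl j c jk).
  by have /andP[] := ip_drop w' B0; rewrite ipC.
have tau2 : tau <= (1 + kap / 4) * t by move: wu e1 k2t; lr.
have taukl : tau <= kap * lam by move: tau2 tl ktt t0; lr.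
have small j c : (j < k)%N -> j != i -> d w (S j c) - d w' (S j c) <= 2 * kap * t.
  move=> jk ji; apply: (le_trans (dropS j c jk)); apply: (le_trans (dirS j c jk)).
  have B0 : 0 < d w (S j c) by apply: lt_le_trans (sl j c jk).
  have := sm i j b c ik jk; rewrite eq_sym ji => /(_ isT).
  rewrite -/A -ler_pdivrMr ?mulr_gt0// => h.
  have : t * (ip w (S i b) (S j c) / (A * d w (S j c))) <= t * kap by rewrite ler_wpM2l// ltW.
  have : 0 < kap * t by rewrite mulr_gt0.
  by lr.
have antip : ip w w' (S i (~~ b)) / d w (S i (~~ b)) <= - t + kap * t.
  apply: (le_trans (dirS i (~~ b) ik)).
  have B0 : 0 < d w (S i (~~ b)) by apply: lt_le_trans (sl i (~~ b) ik).
  have := sa i b ik; rewrite -/A -ler_pdivrMr ?mulr_gt0// => h.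
  have : t * (ip w (S i b) (S i (~~ b)) / (A * d w (S i (~~ b)))) <=
    t * - (1 - kap ^+ 2 / 2) by rewrite ler_wpM2l// ltW.
  have : kap ^+ 2 * t <= kap * t by rewrite ler_wpM2r// ltW.
  have : 0 < kap * t by rewrite mulr_gt0.
  by lr.
have kt1 : 0 < kap * t by rewrite mulr_gt0.
have d1 := mdist_diff w w' (S i b); have d2 := mdist_diff w w' (S i (~~ b)).
rewrite ler_norml -/tau -/A in d1; rewrite ler_norml -/tau in d2.
exists w'; split => //.
- by rewrite -/tau; move: tau2 kt1; lr.
- have := dropS i (~~ b) ik; split; apply/andP; split.
  + by move: d1 tau2 kt1 => /andP[_]; rewrite -/A; lr.
  + by move: wa e1 k2t kt1; rewrite -/A; lr.
  + by move: d2 tau2 kt1 => /andP[+ _]; lr.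
  + by move: H antip kt1; lr.
- move=> j c jk ji; have := strainer_drop_ge c zw jk Uw' taukl.
  have := small j c jk ji; have := small j (~~ c) jk ji.
  have : 2 * kap * tau <= 2 * kap * (2 * t).
    by rewrite ler_wpM2l ?mulr_ge0 ?(ltW k0)//; move: tau2 ktt t0; lr.
  rewrite -/tau ler_norml; move: kt1; clr => *; apply/andP; split; lra.
move=> c Uc wc; set r := d w c in wc *; have r0 : 0 <= r by exact: mdist_ge0.
set s := S i (~~ b); set B := d w s.
have lB : lam <= B by exact: sl.
have B0 : 0 < B by exact: lt_le_trans lB.
have tau0 : 0 <= tau by exact: mdist_ge0.
have h1 := fU (VsubU (zV _ zw)) Uw' (VsubU (SV _ (~~ b) ik)) Uc.
rewrite -/tau -/s -/B -/r in h1.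
have hq : Num.sqrt (2 * (tau * B) * (tau * B + ip w w' s)) <= 2 * kap * t * B.
  rewrite -[leRHS]ger0_norm; last by rewrite !mulr_ge0// ltW.
  rewrite -sqrtr_sqr; apply: ler_wsqrtr.
  have h2 : tau * B + ip w w' s <= kap ^+ 2 * t * B.
    have : ip w w' s <= (- t + 3 / 4 * (kap ^+ 2 * t)) * B.
      have h3 := wp _ (VsubU (SV _ (~~ b) ik)) (sumj _ (~~ b) ik); rewrite -/s in h3.
      have h4 := sa i b ik; rewrite -/s -/A -/B in h4.
      have h5 : t * ip w (S i b) s <= t * (- (1 - kap ^+ 2 / 2) * (A * B)).
        by rewrite ler_wpM2l// ltW.
      have h6 : e <= kap ^+ 2 / 4 * t * (A * B).
        rewrite /e ler_wpM2l ?(ltW kt0)// ge_min; apply/orP; right; rewrite expr2.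
        by apply: ler_pM => //; exact: ltW.
      by rewrite -(ler_pM2l A0); move: h3 h5 h6; lr.
    have : tau * B <= (t + kap ^+ 2 / 4 * t) * B.
      by rewrite ler_wpM2r ?(ltW B0)//; move: wu e1; lr.
    by lr.
  have h7 : tau <= 2 * t by move: tau2 ktt t0; lr.
  apply: le_trans (_ : 2 * (2 * t * B) * (kap ^+ 2 * t * B) <= _); last first.
    by rewrite le_eqVlt; apply/orP; left; apply/eqP; ring.
  apply: le_trans (_ : 2 * (tau * B) * (kap ^+ 2 * t * B) <= _).
    by rewrite ler_wpM2l// !mulr_ge0// ltW.
  have h9 : tau * B <= 2 * t * B by rewrite ler_wpM2r// ltW.
  by apply: ler_pM; rewrite ?mulr_ge0 ?(ltW k0) ?(ltW t0) ?(ltW B0)//; move: h9; lr.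
have /andP[_] := ip_drop c B0; rewrite -/B -/r; set X := B - d c s => hX.
have hr : r ^+ 2 / (2 * B) <= kap * r / 2.
  rewrite ler_pdivrMr ?mulr_gt0//.
  have : r * r <= (kap * B) * r.
    by apply: ler_wpM2r => //; apply: (le_trans wc); rewrite ler_wpM2l// ltW.
  by lr.
have hi : - tau * (X + kap * r / 2) - 2 * kap * t * r <= ip w w' c.
  have h8 : 0 <= ip w w' c + tau * (ip w s c / B) + r * (2 * kap * t).
    have -> : ip w w' c + tau * (ip w s c / B) + r * (2 * kap * t) =
       (B * ip w w' c + tau * ip w s c + r * (2 * kap * t * B)) / B.
      by field; rewrite gt_eqF.
    by rewrite divr_ge0 ?(ltW B0)//; apply: (le_trans h1); rewrite lerD2l ler_wpM2l.
  have : tau * (ip w s c / B) <= tau * (X + kap * r / 2).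
    by rewrite ler_wpM2l//; move: hX hr; lr.
  by move: h8; lr.
rewrite (metric_sym c) (sqr_mdist_ip w) -/tau -/r.
have Xr : `|X| <= r by exact: mdist_diff.
have t2 : tau ^+ 2 <= t ^+ 2 + kap * t * t.
  have : tau * tau <= ((1 + kap / 4) * t) * ((1 + kap / 4) * t) by exact: ler_pM.
  have : kap * kap * (t * t) <= kap * (t * t).
    by rewrite ler_wpM2r ?mulr_ge0 ?(ltW t0)// ler_piMl// ltW.
  have : 0 <= kap * (t * t) by rewrite !mulr_ge0// ltW.
  by lr.
have tX : tau * X <= t * X + kap / 4 * t * r.
  have : (tau - t) * X <= (kap / 4 * t) * r.
    apply: (le_trans (ler_norm _)); rewrite normrM; apply: ler_pM => //.
    by rewrite ler_norml; move: wl wu e1 k2t; clr => *; apply/andP; split; lra.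
  by lr.
have tkr : tau * (kap * r) <= (2 * t) * (kap * r).
  rewrite ler_wpM2r ?mulr_ge0 ?(ltW k0)//; move: tau2 ktt t0; lr.
have : 0 <= kap * t * r by rewrite !mulr_ge0// ltW.
have : 0 <= kap * t * t by rewrite !mulr_ge0// ltW.
by move: hi t2 tX tkr; lr.
Qed.

End strainers.

(** * Distances to strainer points as coordinates *)

Section strainer_coordinates.
Context {R : realType} {M : metricType R}.
Implicit Types x y z p w : M.
Local Notation d x y := (@mdist R M x y : R).

Variables (V U : set M).
Hypotheses (iM : intrinsic M) (fU : fourpt U).
Hypothesis VU : forall x y z, V x -> V y -> d x z <= 2 * d x y -> U z.
Variables (k : nat) (kap lam : R) (z : M) (S : nat -> bool -> M).
Hypothesis kap01 : 0 < kap <= 1.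
Hypothesis st : strained V k kap lam z S.

Local Ltac clr := clear -iM fU VU kap01 st.
Local Ltac lr := clr; lra.

(* The coordinates d (S i true) behave like orthonormal ones: a displacement
   with coordinates D i exists, and distances to third points change according
   to the Euclidean formula up to an error of order kap. *)
Lemma strainer_displace w0 (D : nat -> R) (rho : R) (j : nat) :
  (j <= k)%N -> 0 <= rho ->
  d z w0 + 2 * (\sum_(i < j) `|D i|) < lam ->
  2 * (\sum_(i < j) `|D i|) + rho <= kap * lam ->
  exists w, [/\ d w0 w <= 2 * (\sum_(i < j) `|D i|),
    forall i, (i < k)%N -> `|d w (S i true) - d w0 (S i true) - (if (i < j)%N then D i else 0)|
       <= 6 * kap * (\sum_(i < j) `|D i|) &
    forall p, ball z lam p -> d p w0 <= rho ->
      d p w ^+ 2 <= d p w0 ^+ 2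
        + \sum_(i < j) (D i ^+ 2 - 2 * D i * (d p (S i true) - d w0 (S i true)))
        + 17 * kap * (\sum_(i < j) `|D i|) * (\sum_(i < j) `|D i| + d p w0)].
Proof.
move=> + rho0; have /andP[k0 k1] := kap01; elim: j => [_ _ _|j IH jk].
  exists w0; rewrite !big_ord0 mdistxx mulr0; split => //.
    by move=> i _; rewrite subrr subr0 normr0 mulr0.
  by move=> p _ _; rewrite big_ord0 mulr0 mul0r !addr0.
rewrite !big_ord_recr /=; set T := \sum_(i < j) `|D i|; set t := `|D j|.
have T0 : 0 <= T by apply: sumr_ge0 => i _; exact: normr_ge0.
have t0 : 0 <= t by exact: normr_ge0.
move=> hz hr.
have hz1 : d z w0 + 2 * T < lam by move: hz t0; lr.
have hr1 : 2 * T + rho <= kap * lam by move: hr t0; lr.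
have [w [w1 w2 w3]] := IH (ltnW jk) hz1 hr1; rewrite -/T in w1 w2 w3.
have [tz|tn] := eqVneq t 0.
  have Dj : D j = 0 by apply/eqP; rewrite -normr_eq0 -/t tz.
  exists w; rewrite tz addr0; split => //.
    move=> i ik; have := w2 i ik.
    have -> : (i < j.+1)%N = (i == j) || (i < j)%N by rewrite ltnS leq_eqVlt.
    by have [->|//] := eqVneq i j; rewrite ltnn /= Dj.
  by move=> p zp pw; rewrite big_ord_recr/= Dj expr0n/= mulr0 mul0r subr0 addr0; exact: w3.
have tp : 0 < t by rewrite lt_neqAle eq_sym tn.
have zw : ball z lam w.
  by apply/ballP; have := metric_triangle z w0 w; move: hz1 w1; lr.
(* The coordinate decreases on the way to [S j true] and increases on the way to [S j false]. *)
pose b := D j < 0.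
have tl : 2 * t <= kap * lam by move: hr T0 rho0; lr.
have [w' [Uw' m1 [m2 m3] m4 m5]] := strainer_move iM fU VU kap01 st b zw jk tp tl.
have kt : kap * t <= t by rewrite ler_piMl//; exact: ltW.
have kt0 : 0 < kap * t by rewrite mulr_gt0.
have m23 : `|d w' (S j true) - d w (S j true) - D j| <= 2 * kap * t.
  move: m2 m3; rewrite /b /t; have [Dj|Dj] := ltrP (D j) 0; rewrite /= => /andP[a1 a2] /andP[a3 a4].
    by rewrite ler_norml; rewrite (ltr0_norm Dj) in a1 a2 *; move: a1 a2; clr => *; apply/andP; split; lra.
  by rewrite ler_norml; rewrite (ger0_norm Dj) in a3 a4 *; move: a3 a4; clr => *; apply/andP; split; lra.
exists w'; split.
- by have := metric_triangle w0 w w'; move: w1 m1 kt; lr.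
- move=> i ik; have [->|ij] := eqVneq i j.
    rewrite ltnSn; have := w2 j jk; rewrite ltnn subr0.
    move: m23 kt0; rewrite !ler_norml; clr => h0 h1 h2; apply/andP; split; lra.
  have -> : (i < j.+1)%N = (i < j)%N by rewrite ltnS leq_eqVlt (negbTE ij).
  have := w2 i ik; have := m4 i true ik ij; move: kt0.
  set u := (if _ then _ else _).
  rewrite !ler_norml; clr => h0 h1 h2; apply/andP; split; lra.
move=> p zp pw0; rewrite big_ord_recr/=; have h := w3 p zp pw0.
have [_ zV _ _] := st; have VsU := VsubU VU.
set rp := d p w0 in pw0 h *.
have rp0 : 0 <= rp by exact: mdist_ge0.
have pw : d w p <= rp + 2 * T.
  by have := metric_triangle w w0 p; rewrite (metric_sym w w0) (metric_sym w0 p) -/rp; move: w1; lr.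
have pwl : d w p <= kap * lam by move: pw pw0 hr1; lr.
have := m5 p (VsU _ (zV _ zp)) pwl; rewrite (metric_sym w p) in pw *.
set r := d p w in pw h *; have r0 : 0 <= r by exact: mdist_ge0.
have t2 : D j ^+ 2 = t ^+ 2 by rewrite /t real_normK ?num_real.
have key : 2 * t * (d w (S j (~~ b)) - d p (S j (~~ b))) <=
    - (2 * D j * (d p (S j true) - d w0 (S j true))) + 4 * kap * t * r + 12 * kap * t * T.
  have e1 := w2 j jk; rewrite ltnn subr0 ler_norml in e1.
  have e2 := strainer_drop_le fU VU kap01 st true zw jk zp pwl.
  rewrite (metric_sym w p) -/r /= in e2.
  rewrite /b /t; have [Dj|Dj] := ltrP (D j) 0; rewrite /=.
    have e3 : d w (S j false) - d p (S j false) <=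
      d p (S j true) - d w0 (S j true) + 2 * kap * r + 6 * kap * T by move: e1 e2; lr.
    by have := ler_wpM2l (ltW tp) e3; rewrite /t (ltr0_norm Dj); lr.
  have e3 : d w (S j true) - d p (S j true) <=
     - (d p (S j true) - d w0 (S j true)) + 6 * kap * T by move: e1; lr.
  have := ler_wpM2l (ltW tp) e3; rewrite /t (ger0_norm Dj).
  have : 0 <= kap * D j * r by rewrite !mulr_ge0// ltW.
  by lr.
have p1 : kap * t * r <= kap * t * (rp + 2 * T) by rewrite ler_wpM2l ?(ltW kt0).
have p2 : 0 <= kap * t * t by rewrite mulr_ge0// ltW.
have p3 : 0 <= kap * t * T by rewrite mulr_ge0// ltW.
have p4 : 0 <= kap * t * rp by rewrite mulr_ge0// ltW.
rewrite t2; move: h key p1 p2 p3 p4.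
set Sum := \sum_(i < j) _; set X := 2 * t * _; set Y := 2 * D j * _.
by clr => h1 h2 h3 h4 h5 h6 h7; lra.
Qed.

Hypothesis complete : complete_metric M.

(** Successive approximation: displacing by the remaining coordinate errors halves their bound,
    because [6 * kap * k%:R <= 1 / 2]. The displacements are bounded by a geometric series, and
    completeness provides an exact solution. *)
Lemma strainer_open (h : R) (D : nat -> R) : 12 * kap * k%:R <= 1 -> 0 < h ->
  8 * k%:R * h <= kap * lam -> (forall i, (i < k)%N -> `|D i| <= h) ->
  exists w, ball z lam w /\ forall i, (i < k)%N -> d w (S i true) = d z (S i true) + D i.
Proof.
move=> kk h0 hl Dh; have /andP[k0 k1] := kap01; have lam0 : 0 < lam by case: st.
pose tgt i := d z (S i true) + D i.
pose good n w := d z w <= 4 * k%:R * h * (1 - 2^-1 ^+ n) /\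
  forall i, (i < k)%N -> `|tgt i - d w (S i true)| <= h * 2^-1 ^+ n.
have h2 n : 0 < (2^-1 : R) ^+ n by rewrite exprn_gt0.
have kl : kap * lam <= lam by rewrite ler_piMl// ltW.
have step n w : good n w -> exists w', good n.+1 w' /\ d w w' <= 2 * k%:R * h * 2^-1 ^+ n.
  move=> [g1 g2]; have := h2 n; set q := _ ^+ n in g1 g2 * => q0.
  have Tk : \sum_(i < k) `|tgt i - d w (S i true)| <= k%:R * h * q.
    apply: le_trans (_ : \sum_(i < k) (h * q) <= _).
      by apply: ler_sum => i _; exact: g2.
    by rewrite sumr_const card_ord -[leLHS]mulr_natl mulrA.
  have kh0 : 0 <= k%:R * h by rewrite mulr_ge0// ltW.
  have q1 : q <= 1 by rewrite exprn_ile1 ?invf_le1//; lra.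
  have khq : k%:R * h * q <= k%:R * h by rewrite ler_piMr.
  have khq0 : 0 <= k%:R * h * q by rewrite mulr_ge0// ltW.
  have c1 : d z w + 2 * (\sum_(i < k) `|tgt i - d w (S i true)|) < lam.
    by move: lam0 Tk g1 hl kl khq khq0 kh0; lr.
  have c2 : 2 * (\sum_(i < k) `|tgt i - d w (S i true)|) + 0 <= kap * lam.
    by move: Tk hl khq kh0; lr.
  have [w' [a1 a2 _]] :=
    strainer_displace (D := fun i => tgt i - d w (S i true)) (leqnn k) (lexx 0) c1 c2.
  exists w'; have e : (2^-1 : R) ^+ n.+1 = q / 2 by rewrite exprS mulrC.
  split; last by move: a1 Tk; lr.
  split; rewrite e.
    by have := metric_triangle z w w'; move: a1 Tk g1; lr.
  move=> i ik; have := a2 i ik; rewrite ik => a3.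
  have -> : tgt i - d w' (S i true) =
    - (d w' (S i true) - d w (S i true) - (tgt i - d w (S i true))) by ring.
  rewrite normrN; apply: (le_trans a3).
  apply: le_trans (_ : 6 * kap * (k%:R * h * q) <= _).
    by rewrite ler_wpM2l// mulr_ge0// ltW.
  have : 12 * kap * k%:R * (h * q) <= 1 * (h * q) by rewrite ler_wpM2r// mulr_ge0// ltW.
  by lr.
have g0 : good 0%N z.
  split; first by rewrite mdistxx expr0 subrr mulr0.
  by move=> i ik; rewrite /tgt expr0 mulr1 addrAC subrr add0r; exact: Dh.
(* The relation carries the step number and is conditional on [good], so that it is total, as
   dependent choice requires. *)
pose rel (p q : nat * M) := good p.1 p.2 ->
  [/\ q.1 = p.1.+1, good q.1 q.2 & d p.2 q.2 <= 2 * k%:R * h * 2^-1 ^+ p.1].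
have relP (v : nat * M) : {v' | rel v v'}.
  apply: cid; have [gp|ngp] := pselect (good v.1 v.2); last by exists v.
  by have [w' [a1 a2]] := step _ _ gp; exists (v.1.+1, w').
have [f [f0 fS]] := dependent_choice relP (0%N, z).
have fn n : (f n).1 = n /\ good n (f n).2.
  elim: n => [|n [e gn]]; first by rewrite f0.
  by have := fS n; rewrite /rel e => /(_ gn) [-> ? _].
pose u n := (f n).2; pose C := 4 * k%:R * h.
have C0 : 0 <= C by rewrite !mulr_ge0// ltW.
have uS n : d (u n) (u n.+1) <= C * (2^-1 ^+ n - 2^-1 ^+ n.+1).
  have [e gn] := fn n; have := fS n; rewrite /rel e => /(_ gn) [_ _].
  by rewrite -/(u n) -/(u n.+1) exprS /C; move: (2^-1 ^+ n) => q; lr.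
have um n m : d (u n) (u (n + m)%N) <= C * (2^-1 ^+ n - 2^-1 ^+ (n + m)).
  elim: m => [|m IH]; first by rewrite addn0 mdistxx subrr mulr0.
  have := metric_triangle (u n) (u (n + m)%N) (u (n + m).+1).
  by rewrite addnS; have := uS (n + m)%N; move: IH; lr.
have uc n m : (n <= m)%N -> d (u n) (u m) <= C * 2^-1 ^+ n.
  move=> nm; rewrite -(subnKC nm); apply: (le_trans (um _ _)).
  by rewrite ler_wpM2l// gerBl ltW.
have lim0 (e : R) : 0 < e -> exists n, C * 2^-1 ^+ n < e.
  move=> e0; have /cvgrPdist_lt/(_ _ (divr_gt0 e0 (ltr_wpDl C0 ltr01))) :
    (2^-1 : R) ^+ n @[n --> \oo] --> 0.
    by apply: cvg_expr; rewrite ger0_norm ?invf_lt1//; lra.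
  case=> n _ /(_ n (leqnn n)) /=; rewrite sub0r normrN ger0_norm ?ltW//.
  move=> hn; exists n; rewrite ltr_pdivlMr ?ltr_wpDl// in hn.
  by have := h2 n; move: hn; move: (2^-1 ^+ n) => q; lr.
have uF : cauchy (u @ \oo).
  apply/cauchyP => e e0; have [n hn] := lim0 _ e0; exists (u n).
  exists n => // m /= nm; apply/ballP; exact: le_lt_trans (uc _ _ nm) hn.
have [w uw] := complete _ uF.
have dl (e : R) : 0 < e -> exists n, [/\ C * 2^-1 ^+ n < e & d (u n) w < e].
  move=> e0; have [n hn] := lim0 _ e0.
  have [m _ hm] : \forall m \near \oo, d (u m) w < e.
    move/metricType_numDomainType.cvgr_dist_lt : uw => /(_ e e0).
    by apply: filterS => m; rewrite metric_sym.
  exists (maxn n m); split; last by apply: hm; rewrite /= leq_maxr.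
  apply: le_lt_trans hn; rewrite ler_wpM2l// ler_wiXn2l ?leq_maxl ?invf_le1//; lra.
exists w; split.
  apply/ballP; have [n [hn1 hn2]] := dl _ (divr_gt0 lam0 (ltr0n _ 4)).
  have [_ [gn _]] := fn n; rewrite -/(u n) in gn.
  have := metric_triangle z (u n) w.
  have : C * (1 - 2^-1 ^+ n) <= C by rewrite ler_piMr// gerBl ltW.
  rewrite /C in hn1 *; move: hn1 hn2 gn hl kl lam0.
  by move: (2^-1 ^+ n) => q; lr.
move=> i ik; apply/eqP; rewrite -subr_eq0 -normr_eq0; apply/eqP/le_anti.
rewrite normr_ge0 andbT; apply/ler_addgt0Pl => e e0; rewrite addr0.
have [n [hn1 hn2]] := dl _ (divr_gt0 e0 (ltr0n _ 2)).
have [_ [_ /(_ i ik) a1]] := fn n; rewrite -/(u n) in a1.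
have a2 := mdist_diff (u n) w (S i true); rewrite -/(tgt i).
have k1' : 1 <= k%:R :> R by rewrite ler1n (leq_ltn_trans _ ik).
have : h * 2^-1 ^+ n <= C * 2^-1 ^+ n.
  rewrite ler_wpM2r ?ltW// /C; have := ler_wpM2r (ltW h0) k1'.
  by move: h0; move: (k%:R : R) => kr; lr.
move=> a3; have -> : d w (S i true) - tgt i =
  - (tgt i - d (u n) (S i true)) - (d (u n) (S i true) - d w (S i true)) by ring.
apply: (le_trans (ler_normB _ _)); rewrite normrN.
by move: hn1 hn2 a1 a2 a3; move: (2^-1 ^+ n) => q; lr.
Qed.

End strainer_coordinates.

(** * Adding a pair to a strainer *)

Section strainer_extension.
Context {R : realType} {M : metricType R}.
Implicit Types x y z p w : M.
Local Notation d x y := (@mdist R M x y : R).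

Lemma strained_weaken (V : set M) k (kap kap' lam lam' : R) z z' S :
  0 <= kap <= kap' -> 0 < lam' -> lam' <= lam -> d z z' + lam' <= lam ->
  strained V k kap lam z S -> strained V k kap' lam' z' S.
Proof.
move=> /andP[k0 kk] l0 ll zz [lam0 zV SV sw]; have s : ball z' lam' `<=` ball z lam.
  move=> w /ballP w1; apply/ballP; have := metric_triangle z z' w.
  by move: w1 zz => w1 zz w2; lra.
split => // [w /s /zV//|w /s /sw [s1 s2 s3]]; split.
- by move=> i b ik; exact: le_trans ll (s1 i b ik).
- move=> i b ik; apply: le_trans (s2 i b ik) _; rewrite ler_wpM2r//.
    by rewrite mulr_ge0 ?mdist_ge0.
  rewrite lerN2 lerD2l lerN2 ler_wpM2r// lerXn2r// nnegrE//.
  exact: le_trans kk.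
- move=> i j b c ik jk ij; apply: le_trans (s3 i j b c ik jk ij) _.
  by rewrite ler_wpM2r// mulr_ge0 ?mdist_ge0.
Qed.

Variables (V U : set M).
Hypotheses (iM : intrinsic M) (fU : fourpt U).
Hypothesis VU : forall x y z, V x -> V y -> d x z <= 2 * d x y -> U z.
Variables (k : nat) (kap lam : R) (z : M) (S : nat -> bool -> M).
Hypothesis kap0 : 0 < kap.
Hypothesis kap20 : 20 * kap <= 1.
Hypothesis st : strained V k kap lam z S.

Local Ltac clr := clear -iM fU VU kap0 kap20 st.
Local Ltac lr := clr; lra.

Let kap01 : 0 < kap <= 1.
Proof. by rewrite kap0 /=; move: kap0 kap20; lra. Qed.

(** The distances to the two points of a pair vary oppositely, so it suffices to control one of
    them. *)
Lemma vertical_opposite q y : ball z lam q -> ball z lam y -> d q y <= kap * lam ->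
  (forall i, (i < k)%N -> `|d q (S i true) - d y (S i true)| <= kap * d q y) ->
  forall i b, (i < k)%N -> `|d q (S i b) - d y (S i b)| <= 3 * kap * d q y.
Proof.
move=> zq zy L hv i b ik; have [_ zV _ _] := st; have VsU := VsubU VU.
have := strainer_drop_ge fU VU kap01 st true zq ik (VsU _ (zV _ zy)) L.
have := strainer_drop_le fU VU kap01 st true zq ik zy L.
have := hv i ik; rewrite /=; have : 0 <= kap * d q y by rewrite mulr_ge0 ?mdist_ge0// ltW.
case: b; rewrite !ler_norml; clr => h0 h1 h2 h3; apply/andP; split; lra.
Qed.

(** The new pair is [q], [y], the new centre an almost midpoint [z']. Since [q] and [y] have almost
    the same coordinates, the old points are almost orthogonal to both. The radius
    [8 * kap ^+ 2 * d q y] keeps the excess of [d w q + d w y] over [d q y] below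
    [32 * kap ^+ 2 * d q y], which fits the quadratic defect allowed by the error [20 * kap]. *)
Lemma strained_extend q y : ball z (lam / 2) q -> ball z (lam / 2) y -> q != y ->
  d q y <= kap * lam ->
  (forall i, (i < k)%N -> `|d q (S i true) - d y (S i true)| <= kap * d q y) ->
  exists z' S', strained V k.+1 (20 * kap) (8 * kap ^+ 2 * d q y) z' S' /\ d q z' <= d q y.
Proof.
move=> zq zy qy Ll hv; have [_ zV SV sw] := st; have VsU := VsubU VU.
have lam0 : 0 < lam by case: st.
have k0 := kap0; have kap2 : kap ^+ 2 <= kap / 20.
  by rewrite expr2; have := ler_wpM2l (ltW k0) kap20; lr.
have k20 : 0 < kap ^+ 2 by rewrite exprn_gt0.
have L0 : 0 < d q y by rewrite mdist_gt0.
have zq' : ball z lam q.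
  by apply/ballP; move/ballP: zq; move: lam0; lr.
have zy' : ball z lam y.
  by apply/ballP; move/ballP: zy; move: lam0; lr.
have Vq := zV _ zq'; have Vy := zV _ zy'.
have hv3 := vertical_opposite zq' zy' Ll hv.
set L := d q y in Ll hv hv3 L0 *.
have kL0 : 0 < kap * L by rewrite mulr_gt0.
have k2L0 : 0 < kap ^+ 2 * L by rewrite mulr_gt0.
have k2L : kap ^+ 2 * L <= kap * L / 20.
  by have := ler_wpM2r (ltW L0) kap2; lr.
have kL20 : kap * L <= L / 20 by have := ler_wpM2r (ltW L0) kap20; lr.
have kl20 : kap * lam <= lam / 20 by have := ler_wpM2r (ltW lam0) kap20; lr.
have L3 : 0 < kap * L * (L * lam) / 10 by rewrite divr_gt0// !mulr_gt0.
pose e := Num.min (8 * (kap ^+ 2 * L)) (kap * L * (L * lam) / 10).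
have e0 : 0 < e by rewrite lt_min L3 mulr_gt0.
have e1 : e <= 8 * (kap ^+ 2 * L) by rewrite ge_min lexx.
have e2 : e <= kap * L * (L * lam) / 10 by rewrite ge_min lexx orbT.
pose K := \sum_(j < k) (d q (S j true) + d q (S j false)) + lam.
have sumj j c : (j < k)%N -> d q (S j c) <= K.
  move=> jk; rewrite /K (bigD1 (Ordinal jk))//=.
  have : 0 <= \sum_(i0 < k | i0 != Ordinal jk) (d q (S i0 true) + d q (S i0 false)).
    by apply: sumr_ge0 => j' _; rewrite addr_ge0// mdist_ge0.
  have := mdist_ge0 q (S j true); have := mdist_ge0 q (S j false).
  by case: c; move: lam0; lr.
have tL : 0 <= L / 2 <= L by move: L0; clr => L0; apply/andP; split; lra.
have [z' [Uz' /andP[m1 m2] m3 m4]] := approx_point_between iM K fU (VsU _ Vq) (VsU _ Vy)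
   (fun x => VU Vq Vy) tL e0.
rewrite -/L in m3 m4; have qz'L : d q z' <= L by move: m2 e1 k2L kL20 L0; lr.
have qz'l : d q z' <= kap * lam by apply: le_trans Ll.
have m5 := metric_triangle q z' y; rewrite -/L in m5.
have far j c : (j < k)%N -> lam <= d q (S j c).
  by move=> jk; have [h _ _] := sw _ zq'; exact: h.
(* The inequality for points on almost shortest paths bounds how much closer [z'] is to an old point
   than [q]; [up] derives the reverse bound from the opposite point of the pair. *)
have low j c : (j < k)%N -> d q (S j c) - d z' (S j c) <= 19 / 10 * (kap * L).
  move=> jk; have lB := far j c jk; have B0 : 0 < d q (S j c) by exact: lt_le_trans lB.
  have /andP[h1 _] := ip_drop z' B0; have /andP[_ h2] := ip_drop y B0.
  apply: (le_trans h1); rewrite ipC.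
  have h3 := m4 _ (VsU _ (SV j c jk)) (sumj j c jk).
  set B := d q (S j c) in lB B0 h1 h2 h3 *.
  rewrite ler_pdivrMr//; rewrite ipC ler_pdivrMr// -/L in h2.
  have h4 : L ^+ 2 / (2 * B) <= kap * L / 2.
    rewrite ler_pdivrMr ?mulr_gt0//.
    have : L * L <= (kap * B) * L.
      by apply: ler_wpM2r; [exact: ltW|apply: (le_trans Ll); rewrite ler_wpM2l// ltW].
    by lr.
  have h5 : d q (S j c) - d y (S j c) + L ^+ 2 / (2 * B) <= 7 / 2 * (kap * L).
    by have := hv3 j c jk; rewrite ler_norml; move: h4; lr.
  have h6 : ip q y (S j c) <= 7 / 2 * (kap * L) * B.
    by apply: (le_trans h2); rewrite ler_wpM2r// ltW.
  have h7 : e <= kap * L * (L * B) / 10.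
    apply: (le_trans e2); rewrite ler_wpM2r ?invr_ge0// ler_wpM2l ?(ltW kL0)//.
    by rewrite ler_wpM2l// ltW.
  rewrite -(ler_pM2l L0); apply: (le_trans h3).
  have : 0 <= kap * L * (L * B) by rewrite !mulr_ge0// ltW.
  by have := ler_wpM2l (ltW L0) h6; move: h7; lr.
have up j c : (j < k)%N -> d z' (S j c) - d q (S j c) <= 3 * (kap * L).
  move=> jk; have := strainer_drop_ge fU VU kap01 st c zq' jk Uz' qz'l.
  have h := low j (~~ c) jk.
  have : kap * d q z' <= kap * (L / 2 + L / 50).
    by rewrite ler_wpM2l ?(ltW k0)//; move: m2 e1 k2L kL20; lr.
  have := ler_wpM2l (ltW k0) kL20.
  by move: h kL0; lr.
have upy j c : (j < k)%N -> d z' (S j c) - d y (S j c) <= 6 * (kap * L).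
  by move=> jk; have := up j c jk; have := hv3 j c jk; rewrite ler_norml; lr.
pose S' i b := if i == k then (if b then q else y) else S i b.
exists z', S'; split => //; rewrite -/L; split => //.
- by rewrite !mulr_gt0.
- move=> w /ballP w1; apply: zV; apply/ballP.
  have := metric_triangle z q w; have := metric_triangle q z' w.
  by move/ballP: zq => zq; move: zq w1 qz'l kl20 k2L kL20 Ll L0; lr.
- move=> i b; rewrite ltnS leq_eqVlt /S'; case: eqVneq => [_ _|_ /= ik].
    by case: b.
  exact: SV.
move=> w /ballP wz'.
have zw : ball z lam w.
  apply/ballP; have := metric_triangle z q w; have := metric_triangle q z' w.
  by move/ballP: zq => zq; move: zq wz' qz'l kl20 k2L kL20 Ll L0; lr.
have [sl sa sm] := sw _ zw.
have wq1 : d w q <= L / 2 + 16 * (kap ^+ 2 * L).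
  have := metric_triangle w z' q; rewrite (metric_sym w z') (metric_sym z' q).
  by move: wz' m2 e1; lr.
have wy1 : d w y <= L / 2 + 16 * (kap ^+ 2 * L).
  have := metric_triangle w z' y; rewrite (metric_sym w z').
  by move: wz' m3 e1; lr.
have qwy := metric_triangle q w y; rewrite (metric_sym q w) -/L in qwy.
(* The end [x] of the new pair is not much closer to [s] than [z'] is, so the direction from [w] to
   [x] has almost no component towards [s]. *)
have new x s : (x = q) \/ (x = y) -> lam <= d w s -> d z' s - d x s <= 6 * (kap * L) ->
    ip w x s <= 20 * kap * (d w x * d w s).
  move=> xqy lB h; have B0 : 0 < d w s by exact: lt_le_trans lB.
  have x1 : d w x <= L / 2 + 16 * (kap ^+ 2 * L) by case: xqy => ->.
  have x2 : L / 2 - 16 * (kap ^+ 2 * L) <= d w x.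
    by case: xqy => ->; move: qwy wq1 wy1; lr.
  have h1 : d w s - d x s <= 6 * (kap * L) + 8 * (kap ^+ 2 * L).
    by have := metric_triangle w z' s; rewrite (metric_sym w z'); move: wz' h; lr.
  have /andP[_] := ip_drop x B0; rewrite ipC ler_pdivrMr// => h2.
  have h3 : d w x ^+ 2 / (2 * d w s) <= kap * L / 4.
    rewrite ler_pdivrMr ?mulr_gt0//.
    have : d w x * d w x <= (7 / 10 * L) * (7 / 10 * L).
      by apply: ler_pM; rewrite ?mdist_ge0//; move: x1 k2L kL20 L0; lr.
    have : L * L <= (kap * d w s) * L.
      by apply: ler_wpM2r; [exact: ltW|apply: (le_trans Ll); rewrite ler_wpM2l// ltW].
    have : 0 <= L * L by rewrite mulr_ge0// ltW.
    by lr.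
  rewrite mulrA; apply: (le_trans h2); rewrite ler_wpM2r ?mdist_ge0//.
  have : kap * (L / 2 - 16 * (kap ^+ 2 * L)) <= kap * d w x by rewrite ler_wpM2l// ltW.
  have : kap * (kap ^+ 2 * L) <= kap * (L / 400).
    by rewrite ler_wpM2l ?(ltW k0)//; move: k2L kL20; lr.
  by move: h1 h3 k2L kL0; lr.
split.
- move=> i b; rewrite ltnS leq_eqVlt /S'; case: eqVneq => [_ _|_ /= ik].
    by case: b => /=; move: qwy wq1 wy1 k2L kL20 L0; lr.
  have := sl i b ik; move: Ll k2L kL20 kl20 lam0; lr.
- have half b : ip w (if b then q else y) (if ~~ b then q else y) <=
      - (1 - (20 * kap) ^+ 2 / 2) * (d w (if b then q else y) * d w (if ~~ b then q else y)).
    suff h : ip w q y <= - (1 - (20 * kap) ^+ 2 / 2) * (d w q * d w y).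
      by case: b => //=; rewrite ipC (mulrC (d w y)).
    have a1 : L / 2 - 16 * (kap ^+ 2 * L) <= d w q by move: qwy wy1; lr.
    have a2 : L / 2 - 16 * (kap ^+ 2 * L) <= d w y by move: qwy wq1; lr.
    rewrite /ip -/L; have c1 : L * (9 / 20) <= d w q by move: a1 k2L kL20 L0; lr.
    have c2 : L * (9 / 20) <= d w y by move: a2 k2L kL20 L0; lr.
    have c3 : (L * (9 / 20)) * (L * (9 / 20)) <= d w q * d w y.
      by apply: ler_pM => //; rewrite mulr_ge0// ltW.
    have c4 : (d w q + d w y) ^+ 2 <= (L + 32 * (kap ^+ 2 * L)) ^+ 2.
      rewrite lerXn2r ?nnegrE//; first by rewrite addr_ge0 ?mdist_ge0.
        by move: L0 k2L0; lr.
      by move: wq1 wy1; lr.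
    set P := d w q * d w y in c3 *; set X := kap ^+ 2 * (L * L).
    have c5 : X * (81 / 400) <= kap ^+ 2 * P.
      have -> : X * (81 / 400) = kap ^+ 2 * (L * (9 / 20) * (L * (9 / 20))) by rewrite /X; field.
      by rewrite ler_wpM2l// ltW.
    have c6 : (kap ^+ 2 * L) ^+ 2 <= X / 400.
      have -> : X / 400 = (kap ^+ 2 * L) * (L / 400) by rewrite /X; field.
      by rewrite expr2 ler_wpM2l ?(ltW k2L0)//; move: k2L kL20; lr.
    have c7 : 0 <= X by rewrite mulr_ge0 ?(ltW k20)// mulr_ge0 ?(ltW L0).
    have c8 : (L + 32 * (kap ^+ 2 * L)) ^+ 2 = L ^+ 2 + 64 * X + 1024 * (kap ^+ 2 * L) ^+ 2.
      by rewrite /X; ring.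
    have -> : (d w q ^+ 2 + d w y ^+ 2 - L ^+ 2) / 2 = ((d w q + d w y) ^+ 2 - L ^+ 2) / 2 - P.
      by rewrite /P; field.
    have -> : - (1 - (20 * kap) ^+ 2 / 2) * P = 200 * (kap ^+ 2 * P) - P by field.
    rewrite {}c8 in c4; move: c4 c5 c6 c7.
    clearbody P X; move: ((d w q + d w y) ^+ 2) (L ^+ 2) ((kap ^+ 2 * L) ^+ 2) (kap ^+ 2 * P).
    by clr => *; lra.
  move=> i b; rewrite ltnS leq_eqVlt /S'; case: eqVneq => [_ _|_ /= ik]; first exact: half.
  apply: le_trans (sa i b ik) _; rewrite ler_wpM2r ?mulr_ge0 ?mdist_ge0//.
  by rewrite exprMn; move: k20; lr.
- have old i b j c : (i < k)%N -> (j < k)%N -> i != j ->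
     ip w (S i b) (S j c) <= 20 * kap * (d w (S i b) * d w (S j c)).
    move=> ik jk ij; apply: le_trans (sm i j b c ik jk ij) _.
    by rewrite ler_wpM2r ?mulr_ge0 ?mdist_ge0//; move: k0; lr.
  have nw b j c : (j < k)%N -> ip w (if b then q else y) (S j c) <=
      20 * kap * (d w (if b then q else y) * d w (S j c)).
    move=> jk; have l := sl j c jk; case: b; apply: new => //; [by left| |by right|].
      by have := up j c jk; move: kL0; lr.
    exact: upy.
  have ltS i : (i < k.+1)%N = (i == k) || (i < k)%N by rewrite ltnS leq_eqVlt.
  move=> i j b c; rewrite !ltS /S'.
  case: (eqVneq i k) => [->|_]; case: (eqVneq j k) => [->|_] //=.
  + by move=> _ jk _; exact: nw.
  + by move=> ik _ _; rewrite ipC (mulrC (d w (S i b))); exact: nw.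
  + by move=> *; exact: old.
Qed.

End strainer_extension.

(** * Hausdorff measure *)

Section hausdorff_facts.
Context {R : realType}.
Local Open Scope ereal_scope.
Implicit Types (M : metricType R) (s delta : R).

Lemma diam_ge0 M (W : set M) : W !=set0 -> 0 <= diam W.
Proof.
move=> [x Wx]; apply: le_ereal_sup_tmp; exists (mdist x x)%:E.
  by exists x => //; exists x.
by rewrite mdistxx.
Qed.

Lemma diam_le M (W : set M) (r : \bar R) :
  (forall x y, W x -> W y -> (mdist x y)%:E <= r) -> diam W <= r.
Proof. by move=> h; apply: ge_ereal_sup => _ [x Wx [y Wy <-]]; exact: h. Qed.

Lemma mdist_le_diam M (W : set M) x y : W x -> W y -> (mdist x y)%:E <= diam W.
Proof. by move=> Wx Wy; apply: ereal_sup_ubound; exists x => //; exists y. Qed.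

Lemma diam_pow_ge0 M s (W : set M) : 0 <= diam_pow s W.
Proof. by rewrite /diam_pow; case: ifP => // _; exact: poweR_ge0. Qed.

Lemma diam_powE M s delta (W : set M) : W !=set0 -> diam W <= delta%:E ->
  [/\ (0 <= fine (diam W) <= delta)%R, diam W = (fine (diam W))%:E &
  diam_pow s W = (fine (diam W) `^ s)%:E].
Proof.
move=> W0 Wd; have d0 := diam_ge0 W0.
have fin : diam W \is a fin_num by rewrite ge0_fin_numE// (le_lt_trans Wd)// ltry.
have E : diam W = (fine (diam W))%:E by rewrite fineK.
split => //; first by rewrite -!lee_fin -E d0.
rewrite /diam_pow; case: eqP => [W00|_]; first by case: W0; rewrite W00.
by rewrite E poweR_EFin.
Qed.

Lemma diam_pow_le M s (W : set M) (r : R) : (0 <= r)%R -> (0 <= s)%R ->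
  diam W <= r%:E -> diam_pow s W <= (r `^ s)%:E.
Proof.
move=> r0 s0 Wr; have [->|/set0P W0] := eqVneq W set0.
  by rewrite /diam_pow eqxx lee_fin powR_ge0.
have [/andP[h0 h] _ ->] := diam_powE s W0 Wr.
by rewrite lee_fin ge0_ler_powR// nnegrE.
Qed.

Lemma unnormalized_hausdorff_le M s (A : set M) (c : \bar R) :
  (forall delta, (0 < delta)%R -> exists W : nat -> set M,
    [/\ A `<=` \bigcup_i W i, forall i, diam (W i) <= delta%:E &
        \sum_(i <oo) diam_pow s (W i) <= c]) ->
  unnormalized_hausdorff s A <= c.
Proof.
move=> h; apply: ge_ereal_sup => _ [delta d0 <-].
have [W [AW Wd Wc]] := h _ d0; apply: le_trans Wc.
by apply: ereal_inf_lbound; exists W.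
Qed.

Lemma unnormalized_hausdorff_cover M s (A : set M) (c : \bar R) :
  unnormalized_hausdorff s A < c ->
  forall delta, (0 < delta)%R -> exists W : nat -> set M,
    [/\ A `<=` \bigcup_i W i, forall i, diam (W i) <= delta%:E &
        \sum_(i <oo) diam_pow s (W i) < c].
Proof.
move=> h delta d0; have : hausdorff_content s delta A < c.
  by apply: le_lt_trans h; apply: ereal_sup_ubound; exists delta.
by move=> /ereal_inf_lt[_ [W [AW Wd] <-] Wc]; exists W.
Qed.

Lemma unnormalized_hausdorff_ge0 M s (A : set M) : 0 <= unnormalized_hausdorff s A.
Proof.
apply: le_ereal_sup_tmp; exists (hausdorff_content s 1 A); first by exists 1%R => //=; rewrite ltr01.
apply: le_ereal_inf_tmp => _ [W _ <-]; apply: nneseries_ge0 => i _ _.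
exact: diam_pow_ge0.
Qed.

Lemma unnormalized_hausdorffS M s (A B : set M) : A `<=` B ->
  unnormalized_hausdorff s A <= unnormalized_hausdorff s B.
Proof.
move=> AB; apply: ge_ereal_sup => _ [delta d0 <-].
apply: le_trans (_ : hausdorff_content s delta B <= _); last first.
  by apply: ereal_sup_ubound; exists delta.
by apply: ereal_inf_le_tmp => _ [W [BW Wd] <-]; exists W => //; split => //; exact: subset_trans BW.
Qed.

(** Covers are taken with diameters at most 1, for which a larger exponent gives a smaller power. *)
Lemma hausdorff_null_le M s s' (A : set M) : (0 <= s <= s')%R ->
  unnormalized_hausdorff s A = 0 -> unnormalized_hausdorff s' A = 0.
Proof.
move=> /andP[s0 ss] h; apply/eqP; rewrite eq_le unnormalized_hausdorff_ge0 andbT.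
apply/lee_addgt0Pr => e e0; rewrite add0e.
apply: unnormalized_hausdorff_le => delta d0.
have m0 : (0 < Num.min 1 delta)%R by rewrite lt_min ltr01.
have : unnormalized_hausdorff s A < e%:E by rewrite h lte_fin.
move=> /unnormalized_hausdorff_cover/(_ _ m0)[W [AW Wd We]].
exists W; split => // [i|]; first by apply: (le_trans (Wd i)); rewrite lee_fin ge_min lexx orbT.
apply: le_trans (ltW We); apply: lee_nneseries => [i _ _|i _]; first exact: diam_pow_ge0.
have [->|/set0P W0] := eqVneq (W i) set0; first by rewrite /diam_pow eqxx.
have [/andP[h0 h1] _ ->] := diam_powE s' W0 (Wd i).
have [_ _ ->] := diam_powE s W0 (Wd i).
(* Diameter 0 is treated apart, because 0 to the power 0 is 1: if [s'] is 0, then so is [s]. *)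
rewrite lee_fin; have [->|p0] := eqVneq (fine (diam (W i))) 0%R.
  have [s'0|s'0] := eqVneq s' 0%R; last by rewrite (powR0 s'0) powR_ge0.
  suff -> : s = s' by [].
  by apply/eqP; rewrite eq_le ss s'0 s0.
apply: ger_powR => //; rewrite lt_neqAle eq_sym p0 h0/=.
by apply: (le_trans h1); rewrite ge_min lexx.
Qed.

(* If f expands distances by at least c, then f^-1 carries covers of B to covers of A. *)
Lemma hausdorff_expanding M s (c : R) (A B : set M) (f : M -> M) :
  (0 <= s)%R -> (0 < c)%R -> (forall x, A x -> B (f x)) ->
  (forall x y, A x -> A y -> (c * mdist x y <= mdist (f x) (f y))%R) ->
  unnormalized_hausdorff s A <= (c `^ (- s))%:E * unnormalized_hausdorff s B.
Proof.
move=> s0 c0 fB fc; have cs : (0 < c `^ (- s))%R by rewrite powR_gt0.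
have := unnormalized_hausdorff_ge0 s B.
case E : (unnormalized_hausdorff s B) => [b| |] // b0; last first.
  by rewrite mulry gtr0_sg// mul1e leey.
apply/lee_addgt0Pr => e e0.
apply: unnormalized_hausdorff_le => delta d0.
have : unnormalized_hausdorff s B < (b + e / c `^ (- s))%:E.
  by rewrite E lte_fin ltrDl divr_gt0.
move=> /unnormalized_hausdorff_cover/(_ _ (mulr_gt0 c0 d0))[W [BW Wd We]].
pose W' i := [set x | A x /\ W i (f x)].
have dW i : W' i !=set0 -> diam (W' i) <= (fine (diam (W i)) / c)%:E.
  move=> [x0 [_ Wx0]]; have W0 : W i !=set0 by exists (f x0).
  have [_ Ed _] := diam_powE s W0 (Wd i).
  apply: diam_le => x y [Ax Wx] [Ay Wy]; rewrite lee_fin ler_pdivlMr// mulrC.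
  by apply: (le_trans (fc _ _ Ax Ay)); rewrite -lee_fin -Ed; exact: mdist_le_diam.
exists W'; split.
- by move=> x Ax; have [i _ Wi] := BW _ (fB _ Ax); exists i.
- move=> i; have [->|/set0P W'0] := eqVneq (W' i) set0.
    by apply: diam_le.
  have W0 : W i !=set0 by case: W'0 => x [_ ?]; exists (f x).
  have [/andP[_ h] _ _] := diam_powE s W0 (Wd i).
  by apply: (le_trans (dW i W'0)); rewrite lee_fin ler_pdivrMr// mulrC.
- apply: le_trans (_ : \sum_(i <oo) ((c `^ (- s))%:E * diam_pow s (W i)) <= _).
    apply: lee_nneseries => [i _ _|i _]; first exact: diam_pow_ge0.
    have [->|/set0P W'0] := eqVneq (W' i) set0.
      by rewrite {1}/diam_pow eqxx mule_ge0// ?diam_pow_ge0// lee_fin ltW.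
    have W0 : W i !=set0 by case: W'0 => x [_ ?]; exists (f x).
    have [/andP[h0 h] _ ->] := diam_powE s W0 (Wd i).
    apply: le_trans (diam_pow_le _ s0 (dW i W'0)) _; first by rewrite divr_ge0// ltW.
    rewrite -EFinM lee_fin powRM ?invr_ge0 ?(ltW c0)// mulrC.
    by rewrite -(powR_inv1 (ltW c0)) -powRrM mulN1r.
  rewrite nneseriesZl; last by move=> i _; exact: diam_pow_ge0.
  have -> : (c `^ (- s))%:E * b%:E + e%:E = (c `^ (- s))%:E * (b + e / c `^ (- s))%:E.
    by rewrite -!EFinM -EFinD mulrDr mulrCA divff ?mulr1// gt_eqF.
  by rewrite lee_pmul2l//; exact: ltW.
Qed.

(** Covers with sums below [e / (2 ^ n.+1)%:R] are merged into one sequence along a bijection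
    between [nat] and [nat * nat]. *)
Lemma hausdorff_null_bigcup M s (A : nat -> set M) :
  (forall n, unnormalized_hausdorff s (A n) = 0) ->
  unnormalized_hausdorff s (\bigcup_n A n) = 0.
Proof.
move=> A0; apply/eqP; rewrite eq_le unnormalized_hausdorff_ge0 andbT.
apply/lee_addgt0Pr => e e0; rewrite add0e.
apply: unnormalized_hausdorff_le => delta d0.
have en n : (0 < e / (2 ^ n.+1)%:R)%R by rewrite divr_gt0// ltr0n expn_gt0.
have ex n : {W : nat -> set M | [/\ A n `<=` \bigcup_i W i,
    forall i, diam (W i) <= delta%:E & \sum_(i <oo) diam_pow s (W i) < (e / (2 ^ n.+1)%:R)%:E]}.
  by apply: cid; apply: unnormalized_hausdorff_cover => //; rewrite A0 lte_fin.
pose W n := sval (ex n).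
have WP n := svalP (ex n).
have /card_esym/ppcard_eqP[f] := card_nat2.
pose w (k : nat * nat) := diam_pow s (W k.1 k.2).
have w0 k : 0 <= w k by exact: diam_pow_ge0.
exists (fun k => W (f k).1 (f k).2); split.
- move=> x [n _ Ax]; have [+ _ _] := WP n; move=> /(_ _ Ax)[i _ Wx].
  by exists (f^-1%FUN (n, i)) => //=; rewrite invK ?inE.
- by move=> i; have [_ + _] := WP (f i).1; exact.
rewrite (nneseries_esumT (a := fun k => w (f k)))//.
rewrite -(@reindex_esum _ _ _ setT setT f w); last exact: bij.
have -> : [set: nat * nat] = [set: nat] `*`` (fun=> [set: nat]).
  by apply/seteqP; split.
rewrite -(esum_esum (a := fun i j => w (i, j)))//.
rewrite -nneseries_esumT; last by move=> n; apply: esum_ge0.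
apply: le_trans (epsilon_trick0 xpredT (ltW e0)).
apply: lee_nneseries => [n _ _|n _]; first by apply: esum_ge0.
by rewrite -nneseries_esumT//; have [_ _ /ltW] := WP n.
Qed.

Lemma hausdorff_finite_cover M s (A : set M) (N : nat) (r : R) (W : nat -> set M) :
  (0 < s)%R -> (0 <= r)%R -> (forall x, A x -> exists2 i, (i < N)%N & W i x) ->
  (forall i, (i < N)%N -> diam (W i) <= r%:E) ->
  exists W' : nat -> set M, [/\ A `<=` \bigcup_i W' i, forall i, diam (W' i) <= r%:E &
    \sum_(i <oo) diam_pow s (W' i) <= (N%:R * r `^ s)%:E].
Proof.
move=> s0 r0 AW Wr; exists (fun i => if (i < N)%N then W i else set0); split.
- by move=> x /AW[i iN Wx]; exists i => //; rewrite iN.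
- by move=> i; case: ifP => [/Wr//|_]; apply: diam_le.
rewrite (nneseries_split 0 N); last by move=> k _; exact: diam_pow_ge0.
rewrite [X in _ + X]eseries0 ?adde0; last first.
  by move=> i Ni _; rewrite ltnNge -[(N <= i)%N]/(0 + N <= i)%N Ni/= /diam_pow eqxx.
rewrite add0n big_mkord; apply: le_trans (_ : \sum_(i < N) (r `^ s)%:E <= _).
  by apply: lee_sum => i _; rewrite ltn_ord; apply: diam_pow_le => //; [exact: ltW|exact: Wr].
by rewrite sumEFin lee_fin sumr_const card_ord mulr_natl.
Qed.

Lemma hausdorff_dim_gt M (n : nat) (A : set M) s : hausdorff_dim A = n%:R%:E ->
  (n%:R < s)%R -> unnormalized_hausdorff s A = 0.
Proof.
move=> h ns; have : hausdorff_dim A < s%:E by rewrite h lte_fin.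
move=> /ereal_inf_lt[_ [t [t0 At] <-]]; rewrite lte_fin => ts.
by apply: hausdorff_null_le At; rewrite t0 ltW.
Qed.

Lemma hausdorff_dim_lt M (n : nat) (A : set M) s : hausdorff_dim A = n%:R%:E ->
  (0 <= s < n%:R)%R -> unnormalized_hausdorff s A != 0.
Proof.
move=> h /andP[s0 sn]; apply/eqP => As.
have : hausdorff_dim A <= s%:E by apply: ereal_inf_lbound; exists s.
by rewrite h lee_fin leNgt sn.
Qed.

End hausdorff_facts.

(** * Measure of a set with a cube as Lipschitz image *)

Section cube_lower_bound.
Context {R : realType}.

Lemma card_window (p L : nat) (A : {set 'I_p}) :
  (forall a b, a \in A -> b \in A -> (a <= b + L)%N) -> (#|A| <= L.+1)%N.
Proof.
move=> h; have [->|[a0 Aa0]] := set_0Vmem A; first by rewrite cards0.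
have [a aA amin] := arg_minnP (P := mem A) (fun i : 'I_p => nat_of_ord i) Aa0.
rewrite -[L.+1]card_ord -(@card_in_imset _ _ (fun i : 'I_p => inord (i - a) : 'I_L.+1)).
  exact: max_card.
move=> b c bA cA /(congr1 val) /=; rewrite !inordK ?ltnS ?leq_subLR ?h// => e.
apply: val_inj => /=; rewrite -(subnK (amin _ bA)) -(subnK (amin _ cA)).
by rewrite e.
Qed.

Lemma card_ffun_window (m p L : nat) (P : pred {ffun 'I_m -> 'I_p}) :
  (forall g g' j, P g -> P g' -> (g j <= g' j + L)%N) ->
  (#|[set g | P g]%SET| <= L.+1 ^ m)%N.
Proof.
move=> h; pose B (j : 'I_m) : {set 'I_p} := [set a | [exists g, P g && (g j == a)]]%SET.
have cB j : (#|B j| <= L.+1)%N.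
  apply: card_window => a b; rewrite !inE => /existsP[g /andP[Pg /eqP <-]].
  by move=> /existsP[g' /andP[Pg' /eqP <-]]; exact: h.
apply: leq_trans (_ : #|family (fun j => mem (B j))| <= _)%N.
  apply: subset_leq_card; apply/fintype.subsetP => g; rewrite inE => Pg; apply/familyP => j.
  by rewrite inE; apply/existsP; exists g; rewrite Pg eqxx.
rewrite card_family foldrE big_map big_enum/=.
apply: leq_trans (_ : \prod_(j : 'I_m) L.+1 <= _)%N.
  by apply: leq_prod => j _; exact: cB.
by rewrite prod_nat_const card_ord.
Qed.

(** Volume is replaced by counting grid points. The images of the covering sets have controlled
    width in each coordinate, compactness selects finitely many that cover the cube, and on a fine
    grid with [G] steps per side the set number [i] contains at most the [m]-th power of
    [2 * e i * G%:R / h] points. If the sum of the cover were below [(h / 2) ^+ m], there would be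
    fewer than [G ^ m] grid points. *)
Lemma hausdorff_cube (M : metricType R) (m : nat) (f : nat -> M -> R) (A : set M)
    (v0 : nat -> R) (h : R) : (0 < m)%N -> 0 < h ->
  (forall i x y, (i < m)%N -> `|f i x - f i y| <= mdist x y) ->
  (forall D : nat -> R, (forall i, (i < m)%N -> `|D i| <= h) ->
     exists x, A x /\ forall i, (i < m)%N -> f i x = v0 i + D i) ->
  (((h / 2) ^+ m)%:E <= unnormalized_hausdorff m%:R A)%E.
Proof.
move=> m0 h0 fL fA; rewrite leNgt; apply/negP.
move=> /unnormalized_hausdorff_cover/(_ _ ltr01)[W [AW Wd]].
have p0 i : (0 <= diam_pow m%:R (W i))%E by exact: diam_pow_ge0.
have fin i : diam_pow m%:R (W i) \is a fin_num.
  have [->|/set0P W0] := eqVneq (W i) set0; first by rewrite /diam_pow eqxx.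
  by have [_ _ ->] := diam_powE m%:R W0 (Wd i).
pose p i := fine (diam_pow m%:R (W i)).
have pE i : diam_pow m%:R (W i) = (p i)%:E by rewrite /p fineK.
have pp i : 0 <= p i by rewrite -lee_fin -pE.
have := nneseries_ge0 (N := 0) (P := xpredT) (fun n _ _ => p0 n).
case E : (\sum_(_ <= _ <oo | _) _)%E => [s| |] // s0.
rewrite lte_fin => sh; set c := (h / 2) ^+ m in sh.
have sumN N : \sum_(i < N) p i <= s.
  rewrite -lee_fin -E -sumEFin -(big_mkord xpredT (fun i => (p i)%:E)).
  under eq_bigr do rewrite -pE.
  exact: nneseries_lim_ge.
(* Half of the gap between [c] and [s] is distributed over the covering sets, so that each gets a
   positive size [e i], even if its diameter is 0. *)
pose q i := (c - s) / 2 / (2 ^ i.+1)%:R.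
have q0 i : 0 < q i by rewrite !divr_gt0 ?subr_gt0// ltr0n expn_gt0.
have qN N : \sum_(i < N) q i <= (c - s) / 2.
  have c0 : 0 <= (c - s) / 2 by rewrite divr_ge0// subr_ge0 ltW.
  rewrite -lee_fin -sumEFin -(big_mkord xpredT (fun i => (q i)%:E)).
  apply: le_trans (epsilon_trick0 xpredT c0).
  by apply: nneseries_lim_ge => n _ _; rewrite lee_fin ltW.
pose e i := (p i + q i) `^ (m%:R^-1).
have pq0 i : 0 < p i + q i by rewrite ltr_wpDl.
have e0 i : 0 < e i by rewrite powR_gt0.
have em i : e i ^+ m = p i + q i.
  by rewrite -powR_mulrn ?(ltW (e0 i))// -powRrM mulVf ?powRr1 ?(ltW (pq0 i))// pnatr_eq0 -lt0n.
have We i x y : W i x -> W i y -> mdist x y <= e i.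
  move=> Wx Wy; have W0 : W i !=set0 by exists x.
  have [/andP[d0 _] dE dp] := diam_powE m%:R W0 (Wd i).
  have : mdist x y <= fine (diam (W i)) by rewrite -lee_fin -dE; exact: mdist_le_diam.
  move=> /le_trans; apply; rewrite -(@ler_pXn2r _ m) ?nnegrE ?(ltW (e0 i))//.
  rewrite em -powR_mulrn// -lee_fin -dp pE lee_fin lerDl; exact: ltW.
pose vec x : 'rV[R]_m := \row_j (f j x - v0 j).
(* The images are thickened to open sets for the sake of compactness; their widths stay below
   [3 * e i]. *)
pose O i : set 'rV[R]_m := \bigcup_(x in W i) (ball (vec x) (e i))°.
pose K : set 'rV[R]_m := [set v | forall i, `[- h, h]%classic (v ord0 i)].
have Kc : compact K by apply: (@rV_compact _ _ (fun=> `[- h, h]%classic)) => i; exact: segment_compact.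
have Kcov : K `<=` cover setT O.
  move=> v Kv; have [|x [Ax fx]] := fA (fun i => if insub i is Some j then v ord0 j else 0).
    move=> i im; rewrite insubT; have := Kv (Sub i im); rewrite /= in_itv/= ler_norml.
    by [].
  have [i _ Wx] := AW _ Ax; exists i => //; exists x => //.
  have -> : v = vec x.
    apply/rowP => j; rewrite mxE fx ?ltn_ord// addrAC subrr add0r.
    by rewrite valK.
  apply: nbhsx_ballx; exact: e0.
move: Kc; rewrite compact_cover => /(_ _ _ O (fun i _ => bigcup_open (fun x _ => @open_interior _ _)) Kcov).
move=> [F _ KF].
pose N := (\max_(i <- finmap.enum_fset F) i).+1.
have KN v : K v -> exists2 i, (i < N)%N & O i v.
  move=> /KF[i iF Ov]; exists i => //; rewrite /N ltnS.
  by apply: (@leq_bigmax_seq _ (finmap.enum_fset F) xpredT id i).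
have Oe i v v' j : O i v -> O i v' -> `|v ord0 j - v' ord0 j| < 3 * e i.
  move=> [x Wx /interior_subset Bx] [y Wy /interior_subset By].
  have := Bx.2 ord0 j; have := By.2 ord0 j; rewrite !mxE -!ball_normE/=.
  have := We i x y Wx Wy; have := fL j x y (ltn_ord j).
  rewrite !ltr_norml !ler_norml => /andP[a1 a2] a3 /andP[a4 a5] /andP[a6 a7].
  by apply/andP; split; lra.
have [r r0 re] : exists2 r, 0 < r & forall i, (i < N)%N -> r <= e i.
  elim: N {KN} => [|N' [r r0 re]]; first by exists 1.
  exists (Num.min r (e N')); first by rewrite lt_min r0 e0.
  move=> i; rewrite ltnS leq_eqVlt => /orP[/eqP ->|/re]; first by rewrite ge_min lexx orbT.
  by move=> h1; rewrite ge_min h1.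
(* The mesh [2 * h / G%:R] is below every [e i] with [i < N], so rounding up the number of grid
   points in a window costs a constant factor only. *)
pose G := (Num.truncn (2 * h / r)).+1.
have G0 : 0 < G%:R :> R by rewrite ltr0n.
have Gr : 2 * h / r < G%:R by exact: truncnS_gt.
pose w (g : {ffun 'I_m -> 'I_G.+1}) : 'rV[R]_m := \row_j (- h + 2 * h * (g j)%:R / G%:R).
have Kw g : K (w g).
  move=> j; rewrite mxE /= in_itv/=.
  have : 0 <= 2 * h * (g j)%:R / G%:R by rewrite divr_ge0 ?mulr_ge0// ltW.
  have : 2 * h * (g j)%:R / G%:R <= 2 * h.
    rewrite ler_pdivrMr// ler_pM2l ?mulr_gt0// ler_nat -ltnS; exact: ltn_ord.
  by move=> *; apply/andP; split; lra.
pose L i := Num.truncn (3 * e i * G%:R / (2 * h)).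
have cardP i : (#|[set g | `[< O i (w g) >]]%SET| <= (L i).+1 ^ m)%N.
  apply: card_ffun_window => g g' j /asboolP Og /asboolP Og'.
  rewrite leqNgt; apply/negP => lt; have := Oe i _ _ j Og Og'; rewrite !mxE.
  rewrite ltr_norml => /andP[_].
  have : (L i).+1%:R + (g' j)%:R <= (g j)%:R :> R.
    by rewrite -natrD ler_nat addnC addnS.
  have : 3 * e i * G%:R / (2 * h) < (L i).+1%:R by exact: truncnS_gt.
  rewrite ltr_pdivrMr ?mulr_gt0// => a1 a2.
  have -> : - h + 2 * h * (g j)%:R / G%:R - (- h + 2 * h * (g' j)%:R / G%:R) =
     ((g j)%:R - (g' j)%:R) * (2 * h) / G%:R by field; rewrite gt_eqF.
  rewrite ltr_pdivrMr// => a3.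
  have : (L i).+1%:R * (2 * h) <= ((g j)%:R - (g' j)%:R) * (2 * h).
    by rewrite ler_pM2r ?mulr_gt0// lerBrDr.
  by move: a1 a3; lra.
have Le i : (i < N)%N -> ((L i).+1%:R : R) <= 2 * e i * G%:R / h.
  move=> iN; have a0 : 0 <= 3 * e i * G%:R / (2 * h).
    by rewrite divr_ge0 ?mulr_ge0 ?(ltW (e0 i)) ?(ltW h0).
  have : (L i)%:R <= 3 * e i * G%:R / (2 * h) by rewrite truncn_le.
  have : 1 <= e i * G%:R / (2 * h).
    rewrite ler_pdivlMr ?mulr_gt0// mul1r; move: Gr; rewrite ltr_pdivrMr// => /ltW/le_trans; apply.
    by rewrite mulrC ler_pM2r// re.
  have -> : 2 * e i * G%:R / h = e i * G%:R / (2 * h) + 3 * e i * G%:R / (2 * h).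
    by field; rewrite gt_eqF.
  by rewrite -[(L i).+1%:R]natr1 => *; rewrite addrC lerD.
have : (G.+1 ^ m <= \sum_(i < N) (L i).+1 ^ m)%N.
  have -> : (G.+1 ^ m = #|[set: {ffun 'I_m -> 'I_G.+1}]%SET|)%N.
    by rewrite cardsT card_ffun !card_ord.
  apply: leq_trans (_ : \sum_(i < N) #|[set g | `[< O i (w g) >]]%SET| <= _)%N; last first.
    by apply: leq_sum => i _; exact: cardP.
  apply: leq_trans (_ : #|\bigcup_(i < N) [set g | `[< O i (w g) >]]%SET|%SET <= _)%N.
    apply: subset_leq_card; apply/fintype.subsetP => g _; apply/finset.bigcupP.
    have [i iN Ow] := KN _ (Kw g).
    by exists (Ordinal iN) => //; rewrite inE; exact/asboolP.
  elim/big_rec2 : _ => [|i n1 A1 _ h1]; first by rewrite cards0.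
  by apply: leq_trans (leq_card_setU _ _) _; rewrite leq_add2l.
rewrite -(@ler_nat R) natr_sum natrX.
under eq_bigr do rewrite natrX.
apply/negP; rewrite -ltNge.
apply: le_lt_trans (_ : \sum_(i < N) ((2 * G%:R / h) ^+ m * (p i + q i)) < _).
  apply: ler_sum => i _; rewrite -em -exprMn lerXn2r ?nnegrE ?ler0n//.
    by rewrite !mulr_ge0 ?invr_ge0 ?(ltW h0) ?(ltW G0) ?(ltW (e0 i)).
  by apply: (le_trans (Le i (ltn_ord i))); rewrite le_eqVlt; apply/orP; left; apply/eqP; ring.
rewrite -mulr_sumr big_split/=.
apply: lt_trans (_ : (2 * G%:R / h) ^+ m * c < _).
  rewrite ltr_pM2l ?exprn_gt0 ?divr_gt0 ?mulr_gt0//.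
  by have := sumN N; have := qN N; lra.
rewrite /c -exprMn; have -> : 2 * G%:R / h * (h / 2) = G%:R by field; rewrite gt_eqF.
by rewrite ltr_pXn2r ?nnegrE ?ler0n// ltr_nat.
Qed.

End cube_lower_bound.

(** * Packing *)

Section packing.
Context {R : realType} {M : metricType R}.
Implicit Types x y z p w : M.
Local Notation d x y := (@mdist R M x y : R).

Definition spaced (r : R) (s : seq M) : bool := pairwise (fun x y => r <= d x y) s.

Lemma spaced_map (Y : M -> M) (r r' : R) (s : seq M) :
  (forall x y, x \in s -> y \in s -> r <= d x y -> r' <= d (Y x) (Y y)) ->
  spaced r s -> spaced r' (map Y s).
Proof.
move=> h; rewrite /spaced pairwise_map.
apply: (@sub_in_pairwise _ (mem s)); first by move=> x y xs ys; exact: h.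
exact/allP.
Qed.

(** The [k] coordinates are rounded to cells of side [kap * r], and the bound on [size s] is the
    number of cells. Two points in one cell agree up to [kap * r], hence up to [kap] times their
    distance. *)
Lemma spaced_pigeonhole (k : nat) (kap r rho : R) (f : nat -> M -> R) z (s : seq M) :
  0 < kap -> 0 < r -> (forall i x y, `|f i x - f i y| <= d x y) ->
  (forall x, x \in s -> d z x < rho) -> spaced r s ->
  ((Num.truncn (2 * rho / (kap * r))).+1 ^ k < size s)%N ->
  exists q y, [/\ q \in s, y \in s, r <= d q y &
    forall i, (i < k)%N -> `|f i q - f i y| <= kap * d q y].
Proof.
move=> kap0 r0 fL sz sep; set m := (Num.truncn _).+1 => ms.
have kr0 : 0 < kap * r by rewrite mulr_gt0.
pose val i x := (f i x - f i z + rho) / (kap * r).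
have vb i x : x \in s -> 0 <= val i x < m%:R.
  move=> /sz xs; have := fL i x z; rewrite (metric_sym x z) ler_norml => /andP[h1 h2].
  apply/andP; split; first by rewrite divr_ge0 ?(ltW kr0)//; lra.
  apply: le_lt_trans (truncnS_gt _); rewrite /val ler_pM2r ?invr_gt0//; lra.
pose cell (a : 'I_(size s)) : {ffun 'I_k -> 'I_m} :=
  [ffun i : 'I_k => inord (Num.truncn (val i (nth z s a)))].
have /injectivePn[a [b ab eab]] : ~~ injectiveb cell.
  apply/negP => /injectiveP inj; have := leq_card cell inj.
  by rewrite card_ffun !card_ord leqNgt ms.
wlog lt_ab : a b ab eab / (a < b)%N.
  move=> H; have [lt|lt|e] := ltngtP a b; [exact: (H a b)|apply: (H b a) => //|].
    by rewrite eq_sym.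
  by move: ab; rewrite (val_inj e) eqxx.
have as_ : nth z s a \in s by rewrite mem_nth.
have bs : nth z s b \in s by rewrite mem_nth.
have rab : r <= d (nth z s a) (nth z s b).
  by have /(pairwiseP z) := sep; apply => //; rewrite inE.
exists (nth z s a), (nth z s b); split => // i ik.
apply: le_trans (_ : kap * r <= _); last by rewrite ler_pM2l.
move/ffunP/(_ (Ordinal ik)) : eab; rewrite !ffunE /= => /(congr1 (@nat_of_ord _)).
have ta x : x \in s -> (Num.truncn (val i x) < m)%N.
  by move=> /(vb i) /andP[v0 vm]; rewrite truncn_lt_nat.
rewrite !inordK ?ta//; set va := val i _; set vb' := val i _ => e.
have /andP[a0 _] := vb i _ as_; have /andP[b0 _] := vb i _ bs.
have := truncn_itv a0; have := truncn_itv b0; rewrite -/va -/vb' e -natr1.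
move=> /andP[h1 h2] /andP[h3 h4].
have -> : f i (nth z s a) - f i (nth z s b) = (va - vb') * (kap * r).
  by rewrite /va /vb' /val; field; rewrite !gt_eqF.
rewrite normrM (gtr0_norm kr0) ler_piMl ?(ltW kr0)// ler_norml.
by apply/andP; split; lra.
Qed.

Variables (V U : set M).
Hypotheses (iM : intrinsic M) (fU : fourpt U).
Hypothesis VU : forall x y z, V x -> V y -> d x z <= 2 * d x y -> U z.

Lemma approx_homothety_point z x (tau e K : R) : V z -> V x -> 0 <= tau <= 1 -> 0 < e ->
  exists y, [/\ U y, tau * d z x - e <= d z y <= tau * d z x + e &
    forall p, U p -> d z p <= K -> ip z y p <= tau * ip z x p + e].
Proof.
move=> Vz Vx /andP[t0 t1] e0; have Uz := VsubU VU Vz; have Ux := VsubU VU Vx.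
have [zx|zx] := eqVneq z x.
  exists z; rewrite zx mdistxx mulr0 -zx; split => //.
    by apply/andP; split; lra.
  by move=> p _ _; rewrite ip0l mulr0 add0r ltW.
have D0 : 0 < d z x by rewrite mdist_gt0.
pose e' := e * Num.min 1 (d z x).
have e'0 : 0 < e' by rewrite mulr_gt0// lt_min ltr01.
have tD : 0 <= tau * d z x <= d z x by rewrite mulr_ge0 ?(ltW D0)//= ler_piMl// ltW.
have [y [Uy /andP[y1 y2] _ y3]] := approx_point_between iM K fU Uz Ux (fun w => VU Vz Vx) tD e'0.
have e'e : e' <= e by rewrite /e' ler_piMr ?(ltW e0)// ge_min lexx.
exists y; split => //; first by apply/andP; split; lra.
move=> p Up Kp; have h := y3 p Up Kp; rewrite -(ler_pM2l D0).
apply: (le_trans h).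
have -> : d z x * (tau * ip z x p + e) = tau * d z x * ip z x p + e * d z x by ring.
by rewrite lerD2l /e' ler_wpM2l ?(ltW e0)// ge_min lexx orbT.
Qed.

(** Half of the spacing is sacrificed to the errors of almost shortest paths. Up to a constant, the
    ratio of spacing to radius is the same for every [tau]. *)
Lemma approx_homothety z (D r tau : R) (s : seq M) : V z -> 0 < D -> 0 < r -> 0 < tau <= 1 ->
  (forall x, x \in s -> V x /\ d z x <= D) -> spaced r s ->
  exists s', [/\ size s' = size s, forall y, y \in s' -> d z y < 2 * tau * D &
    spaced (tau * r / 2) s'].
Proof.
move=> Vz D0 r0 /andP[t0 t1] sV sep.
have tr0 : 0 < tau * r by rewrite mulr_gt0.
have tD0 : 0 < tau * D by rewrite mulr_gt0.
have q0 : 0 < 4 * (tau * D) + 4 by lra.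
(* The squared distance of two images loses at most [e * (4 * (tau * D) + 4)]: the first summand
   comes from their distances to [z], the second from the doubled product [ip]. *)
pose e := Num.min (tau * D / 2) ((tau * r) ^+ 2 / 2 / (4 * (tau * D) + 4)).
have e0 : 0 < e by rewrite lt_min !divr_gt0// exprn_gt0.
have eD : e <= tau * D / 2 by rewrite ge_min lexx.
have er : e * (4 * (tau * D) + 4) <= (tau * r) ^+ 2 / 2.
  by rewrite -ler_pdivlMr// ge_min lexx orbT.
have t01 : 0 <= tau <= 1 by rewrite ltW.
have ex x : {y | x \in s -> [/\ U y, tau * d z x - e <= d z y <= tau * d z x + e &
    forall p, U p -> d z p <= 2 * D -> ip z y p <= tau * ip z x p + e]}.
  apply: cid; have [xs|xs] := boolP (x \in s); last by exists z.
  have [Vx _] := sV x xs.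
  by have [y hy] := approx_homothety_point (2 * D) Vz Vx t01 e0; exists y.
pose Y x := sval (ex x).
have YP x := svalP (ex x : {y | _}); rewrite -/(Y _) in YP.
have tx x : x \in s -> tau * d z x <= tau * D.
  by move=> /sV[_ h]; rewrite ler_pM2l.
exists (map Y s); split; first by rewrite size_map.
- move=> _ /mapP[x xs ->]; have [_ /andP[_ h] _] := YP x xs; have := tx x xs.
  rewrite -/(Y x) in h; lra.
apply: spaced_map sep => x y xs ys rxy.
have [Ux /andP[x1 x2] x3] := YP x xs; have [Uy /andP[y1 y2] y3] := YP y ys.
rewrite -/(Y x) in Ux x1 x2 x3; rewrite -/(Y y) in Uy y1 y2 y3.
have [Vx xD] := sV x xs; have [Vy yD] := sV y ys.
have Yy : d z (Y y) <= 2 * D.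
  have : tau * D <= D by rewrite ler_piMl// ltW.
  have := tx y ys; lra.
have h1 := x3 _ Uy Yy.
have h2 := y3 _ (VsubU VU Vx) (le_trans xD (ltac:(lra) : D <= 2 * D)).
have h3 : tau * ip z x (Y y) <= tau * (tau * ip z x y + e).
  by rewrite ler_pM2l// ipC (ipC _ x).
have te : tau * e <= e by rewrite ler_piMl// ltW.
have sq (v u : R) : 0 <= u -> u - e <= v -> 0 <= v -> u ^+ 2 - 2 * e * u <= v ^+ 2.
  move=> u0 uv v0; have [eu|ue] := lerP e u.
    have : (u - e) ^+ 2 <= v ^+ 2 by rewrite lerXn2r ?nnegrE//; lra.
    have := sqr_ge0 e; lra.
  have : u * u <= e * u by rewrite ler_wpM2r// ltW.
  have : 0 <= e * u by rewrite mulr_ge0// ltW.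
  have := sqr_ge0 v; lra.
have s1 := sq _ _ (mulr_ge0 (ltW t0) (mdist_ge0 z x)) x1 (mdist_ge0 _ _).
have s2 := sq _ _ (mulr_ge0 (ltW t0) (mdist_ge0 z y)) y1 (mdist_ge0 _ _).
have s3 : e * (tau * d z x) <= e * (tau * D) by rewrite ler_pM2l// tx.
have s4 : e * (tau * d z y) <= e * (tau * D) by rewrite ler_pM2l// tx.
have s5 : (tau * r) ^+ 2 <= (tau * d x y) ^+ 2.
  by rewrite lerXn2r ?nnegrE ?mulr_ge0 ?mdist_ge0 ?(ltW t0) ?(ltW r0)// ler_pM2l.
have s6 : (tau * r / 2) ^+ 2 <= d (Y x) (Y y) ^+ 2.
  rewrite (sqr_mdist_ip z (Y x)).
  have E : (tau * d x y) ^+ 2 = (tau * d z x) ^+ 2 + (tau * d z y) ^+ 2 - tau * (tau * ip z x y) *+ 2.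
    by rewrite (exprMn _ tau (d x y)) (sqr_mdist_ip z x); ring.
  have s7 := sqr_ge0 (tau * r).
  have -> : (tau * r / 2) ^+ 2 = (tau * r) ^+ 2 / 4 by field.
  rewrite mulrDr in h3; move: h1 h3 te s1 s2 s3 s4 s5 s7 er; rewrite E; set a := (tau * r) ^+ 2; clear -iM fU VU.
  move: ((tau * d z x) ^+ 2) ((tau * d z y) ^+ 2) (tau * (tau * ip z x y)) => b c g; lra.
by move: s6; rewrite ler_pXn2r ?nnegrE ?mdist_ge0// divr_ge0// ltW.
Qed.

Hypothesis complete : complete_metric M.

Lemma strained_hausdorff_ge (m : nat) (kap lam : R) z S :
  (0 < m)%N -> 0 < kap <= 1 -> 12 * kap * m%:R <= 1 -> strained V m kap lam z S ->
  (((kap * lam / (16 * m%:R)) ^+ m)%:E <= unnormalized_hausdorff m%:R (ball z lam))%E.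
Proof.
move=> m0 k01 km st; have lam0 : 0 < lam by case: st.
have k0 : 0 < kap by case/andP: k01.
have m0' : 0 < m%:R :> R by rewrite ltr0n.
pose h := kap * lam / (8 * m%:R).
have h0 : 0 < h by rewrite divr_gt0// mulr_gt0.
have -> : kap * lam / (16 * m%:R) = h / 2 by rewrite /h; field; rewrite gt_eqF.
apply: (hausdorff_cube (f := fun i x => d x (S i true)) (v0 := fun i => d z (S i true))) => //.
  by move=> i x y _; exact: mdist_diff.
move=> D Dh; apply: (strainer_open iM fU VU k01 st complete km h0) => //.
by rewrite /h le_eqVlt; apply/orP; left; apply/eqP; field; rewrite gt_eqF.
Qed.

Variable n : nat.
Hypothesis dimM : hausdorff_dim [set: M] = n%:R%:E.

(** Such a strainer would give its ball positive measure in dimension [n.+1], above the Hausdorff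
    dimension. *)
Lemma no_strainer (kap lam : R) z S : 0 < kap <= 1 -> 12 * kap * n.+1%:R <= 1 ->
  ~ strained V n.+1 kap lam z S.
Proof.
move=> k01 km st; have lam0 : 0 < lam by case: st.
have := strained_hausdorff_ge (ltn0Sn n) k01 km st.
have -> : unnormalized_hausdorff n.+1%:R (ball z lam) = 0%E.
  apply/eqP; rewrite eq_le unnormalized_hausdorff_ge0 andbT.
  rewrite -(hausdorff_dim_gt (s := n.+1%:R) dimM) ?ltr_nat//.
  exact: unnormalized_hausdorffS.
rewrite leNgt lte_fin exprn_gt0// divr_gt0 ?mulr_gt0//.
by case/andP: k01.
Qed.

(* This is 25 / kap0, where kap0 = 1 / (12 * 20 ^ m.+1 * m.+1) is the error of the
   first strainer in packing_bound. *)
Definition packing_const (m : nat) : R := 300 * 20 ^+ m.+1 * m.+1%:R.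

Lemma packing_const_gt0 m : 0 < packing_const m.
Proof.
apply: mulr_gt0; last by rewrite ltr0n.
by apply: mulr_gt0; [rewrite ltr0n|exact: exprn_gt0].
Qed.

(** The same family [s] serves for every extension: contracted into a tiny ball around the present
    centre it keeps its size and, up to a constant, its relative spacing. Pigeonholing then yields
    two points with almost equal coordinates, which extend the strainer. It is needed for [k <= n]
    coordinates only, whence the exponent [n]. *)
Lemma packing_bound p (rho alpha : R) (s : seq M) : 0 < rho -> 0 < alpha <= 1 ->
  ball p (2 * rho) `<=` V -> (forall x, x \in s -> d p x < rho) ->
  spaced (alpha * rho) s ->
  (size s)%:R <= (packing_const n / alpha) ^+ n.
Proof.
move=> rho0 /andP[al0 al1] pV sp sep; rewrite leNgt; apply/negP => big.
(* Chosen such that after [n.+1] extensions, each multiplying the error by 20, the hypothesis of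
   [no_strainer] holds with equality. *)
pose kap0 : R := (12 * 20 ^+ n.+1 * n.+1%:R)^-1.
have K0 : 0 < 12 * 20 ^+ n.+1 * n.+1%:R :> R by rewrite !mulr_gt0// exprn_gt0.
have kap00 : 0 < kap0 by rewrite invr_gt0.
pose kap k := kap0 * 20 ^+ k.
have kapS k : kap k.+1 = 20 * kap k by rewrite /kap exprS; ring.
have kap_gt0 k : 0 < kap k by rewrite mulr_gt0// exprn_gt0.
have kap0k k : kap0 <= kap k by rewrite ler_peMr ?(ltW kap00)// exprn_ege1// ler1n.
have kapn : 12 * kap n.+1 * n.+1%:R = 1.
  by rewrite /kap /kap0; field; rewrite gt_eqF//= !gt_eqF// exprn_gt0.
have kapn1 : kap n.+1 <= 1 / 12.
  have : 12 * kap n.+1 <= 12 * kap n.+1 * n.+1%:R.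
    have h := kap_gt0 n.+1; have h1 : 1 <= n.+1%:R :> R by rewrite ler1n.
    by rewrite ler_peMr//; lra.
  rewrite kapn; lra.
have kapmono k : (k <= n.+1)%N -> kap k <= kap n.+1.
  by move=> kn; rewrite ler_pM2l// ler_eXn2l// ltr1n.
have main k : (k <= n.+1)%N -> exists z lam S,
    strained V k (kap k) lam z S /\ d p z < 2 * rho.
  elim: k => [_|k IH kn].
    exists p, (2 * rho), (fun _ _ => p); split; last by rewrite mdistxx mulr_gt0.
    by split=> //; rewrite mulr_gt0.
  have [z [lam [S [st pz]]]] := IH (ltnW kn).
  have lam0 : 0 < lam by case: st.
  have k20 : 20 * kap k <= 1 by rewrite -kapS; have := kapmono _ kn; lra.
  have k0 := kap_gt0 k.
  pose rho1 := Num.min (kap k * lam / 4) (Num.min ((2 * rho - d p z) / 4) rho).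
  have rho10 : 0 < rho1 by rewrite !lt_min rho0 !divr_gt0 ?mulr_gt0// subr_gt0.
  have r1 : rho1 <= kap k * lam / 4 by rewrite ge_min lexx.
  have r2 : rho1 <= (2 * rho - d p z) / 4 by rewrite !ge_min lexx !orbT.
  have r3 : rho1 <= rho by rewrite !ge_min lexx !orbT.
  have Vz : V z by apply: pV; exact/ballP.
  have klam : kap k * lam <= lam / 20 by have := ler_wpM2r (ltW lam0) k20; lra.
  (* All of [s] lies within [3 * rho] of [z]; this factor brings it within [rho1] of [z], with
     spacing [rho1 * alpha / 12]. *)
  have [|||||s' [sz' s'z sep']] := @approx_homothety z (3 * rho) (alpha * rho) (rho1 / (6 * rho)) s Vz.
  - lra.
  - by rewrite mulr_gt0.
  - by rewrite divr_gt0 ?mulr_gt0//= ler_pdivrMr ?mulr_gt0//; lra.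
  - move=> x xs; have := sp x xs => px; split; first by apply/pV/ballP; lra.
    by have := metric_triangle z p x; rewrite (metric_sym z p); lra.
  - exact: sep.
  have e1 : 2 * (rho1 / (6 * rho)) * (3 * rho) = rho1 by field; rewrite gt_eqF.
  have e2 : rho1 / (6 * rho) * (alpha * rho) / 2 = rho1 * alpha / 12 by field; rewrite gt_eqF.
  rewrite e1 in s'z; rewrite e2 in sep'.
  have ra0 : 0 < rho1 * alpha / 12 by rewrite divr_gt0 ?mulr_gt0.
  have fL (i : nat) x y : `|d x (S i true) - d y (S i true)| <= d x y by exact: mdist_diff.
  have [|q [y [qs ys rqy vert]]] := spaced_pigeonhole (k := k) k0 ra0 fL s'z sep'.
    rewrite sz' -(ltr_nat R); apply: le_lt_trans big; rewrite natrX.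
    (* The scale [rho1] cancels, so the number of cells does not depend on how small the strainer
       has become. *)
    have -> : 2 * rho1 / (kap k * (rho1 * alpha / 12)) = 24 / (kap k * alpha).
      by field; rewrite !gt_eqF.
    have ka0 : 0 < kap0 * alpha by rewrite mulr_gt0.
    have h24 : 24 / (kap k * alpha) <= 24 / (kap0 * alpha).
      by rewrite ler_pM2l// lef_pV2 ?posrE ?mulr_gt0// ler_pM2r.
    have h25 : (Num.truncn (24 / (kap k * alpha))).+1%:R <= packing_const n / alpha :> R.
      have -> : packing_const n / alpha = 24 / (kap0 * alpha) + 1 / (kap0 * alpha).
        rewrite /packing_const /kap0; field.
        have n0 : 0 <= n%:R :> R by [].
        by rewrite !gt_eqF//; lra.
      rewrite -natr1; apply: lerD.
        by apply: le_trans h24; rewrite truncn_le// divr_ge0// mulr_ge0// ltW.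
      rewrite ler_pdivlMr// mul1r.
      have : kap0 <= 1 by have := kap0k n.+1; lra.
      by move=> h; apply: le_trans h; rewrite ler_piMr// ltW.
    have one : 1 <= packing_const n / alpha.
      by apply: le_trans h25; rewrite ler1n.
    apply: le_trans (_ : (packing_const n / alpha) ^+ k <= _).
      by rewrite lerXn2r ?nnegrE// (le_trans _ one).
    by rewrite ler_weXn2l.
  have qz := s'z q qs; have yz := s'z y ys.
  have qy : d q y <= kap k * lam.
    by have := metric_triangle q z y; rewrite (metric_sym q z); lra.
  have qyn : q != y by rewrite -mdist_gt0; exact: lt_le_trans rqy.
  have zq : ball z (lam / 2) q by apply/ballP; lra.
  have zy : ball z (lam / 2) y by apply/ballP; lra.
  have [z' [S' [st' qz']]] := strained_extend iM fU VU k0 k20 st zq zy qyn qy vert.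
  exists z', (8 * kap k ^+ 2 * d q y), S'; rewrite kapS; split => //.
  have := metric_triangle p z z'; have := metric_triangle z q z'.
  by have := metric_triangle q z y; rewrite (metric_sym q z); lra.
have [z [lam [S [st _]]]] := main n.+1 (leqnn _).
apply: no_strainer st; last by rewrite kapn.
by rewrite kap_gt0 /=; lra.
Qed.

End packing.

(** * Properness *)

Section properness.
Context {R : realType} {M : metricType R}.
Implicit Types x y z p w : M.
Local Notation d x y := (@mdist R M x y : R).

Definition totally_bounded (A : set M) : Prop := forall e : R, 0 < e ->
  exists s : seq M, (forall y, y \in s -> A y) /\
    forall x, A x -> exists2 y, y \in s & d x y < e.

Lemma maximal_spaced (A : set M) (e : R) (N : nat) : 0 < e ->
  (forall s : seq M, (forall x, x \in s -> A x) -> spaced e s -> (size s <= N)%N) ->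
  exists s : seq M, [/\ spaced e s, (forall y, y \in s -> A y) &
    forall x, A x -> exists2 y, y \in s & d x y < e].
Proof.
move=> e0 hN.
pose P m := `[< exists s : seq M, [/\ size s = m, spaced e s & forall y, y \in s -> A y] >].
have P0 : exists m, P m by exists 0%N; apply/asboolP; exists [::].
have PN m : P m -> (m <= N)%N.
  by move=> /asboolP[s [<- sep sA]]; exact: hN.
have [m /asboolP[s [sm sep sA]] mmax] := ex_maxnP P0 PN.
exists s; split => // x Ax; apply: contrapT => nx.
have : P m.+1.
  apply/asboolP; exists (x :: s); split; first by rewrite /= sm.
    rewrite /spaced /= -/(spaced e s) sep andbT; apply/allP => y ys /=.
    by rewrite leNgt; apply/negP => xy; apply: nx; exists y.
  by move=> y; rewrite inE => /orP[/eqP ->|/sA].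
by move=> /mmax; rewrite ltnn.
Qed.

Lemma spaced_le (e e' : R) (s : seq M) : e' <= e -> spaced e s -> spaced e' s.
Proof. by move=> h; apply: sub_pairwise => x y /=; exact: le_trans. Qed.

Lemma tb_bigcup (T : eqType) (s : seq T) (B : T -> set M) (A : set M) :
  A `<=` \bigcup_(i in [set` s]) B i -> (forall i, i \in s -> totally_bounded (B i)) ->
  (forall i, i \in s -> B i `<=` A) -> totally_bounded A.
Proof.
move=> AB Bt BA e e0.
have ex i : {t : seq M | i \in s -> (forall y, y \in t -> B i y) /\
    forall x, B i x -> exists2 y, y \in t & d x y < e}.
  apply: cid; have [si|si] := boolP (i \in s); last by exists [::].
  by have [t ht] := Bt i si e e0; exists t.
exists (flatten [seq sval (ex i) | i <- s]); split.
  move=> y /flatten_mapP[i si yi]; apply: (BA i si).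
  by have [h _] := svalP (ex i) si; exact: h.
move=> x /AB[i /= si Bx]; have [_ h] := svalP (ex i) si.
have [y yt xy] := h _ Bx; exists y => //; apply/flatten_mapP; by exists i.
Qed.

Hypothesis complete : complete_metric M.

(** Of finitely many balls covering [A] one belongs to [F], since otherwise the intersection of [A]
    with all their complements would; so [F] is Cauchy. The ultrafilter property is a plain
    disjunction in order to apply to images of ultrafilters. *)
Lemma tb_ultra (F : set_system M) (A : set M) : ProperFilter F ->
  (forall B, F B \/ F (~` B)) -> F A -> totally_bounded A -> exists l : M, F --> l.
Proof.
move=> PF UF FA tbA; apply: complete; apply/cauchyP => e e0.
have [s [_ sA]] := tbA e e0.
apply: contrapT => /forallNP nF.
have : F (A `&` \bigcap_(y in [set` s]) ~` ball y e).
  elim: s {sA} => [|y s IH].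
    by apply: filterS FA => x Ax; split.
  have [/nF//|Fy] := UF (ball y e).
  apply: filterS (filterI IH Fy) => x [[Ax h] hy]; split => // w /=.
  by rewrite inE => /orP[/eqP ->|] //; exact: h.
move=> /filter_ex[x [Ax h]]; have [y ys xy] := sA x Ax.
by apply: (h y ys); apply/ballP; rewrite metric_sym.
Qed.

Lemma tb_compact : totally_bounded [set: M] -> compact [set: M].
Proof.
move=> tb; rewrite compact_ultra => F UF FT; have [l Fl] := tb_ultra ultra_proper (fun B => in_ultra_setVsetC B UF) FT tb.
by exists l.
Qed.

Lemma ultra_nat : exists G : set_system nat, UltraFilter G /\ \oo `<=` G.
Proof. by have [G [UG sG]] := @ultraFilterLemma nat \oo _; exists G. Qed.

Lemma tb_ultra_limit (G : set_system nat) (u : nat -> M) (A : set M) : UltraFilter G ->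
  (forall k, A (u k)) -> totally_bounded A ->
  exists l, forall e : R, 0 < e -> G [set k | d (u k) l < e].
Proof.
move=> UG uA tbA; have PG : ProperFilter G := ultra_proper.
have UF B : (u k @[k --> G]) B \/ (u k @[k --> G]) (~` B).
  exact: (in_ultra_setVsetC (u @^-1` B) UG).
have FA : (u k @[k --> G]) A by apply: (@filterS _ G _ setT) => [k _|]; [exact: uA|exact: filterT].
have [l ul] := tb_ultra _ UF FA tbA; exists l => e e0.
have := ul _ (nbhsx_ballx l e e0); apply: (@filterS _ G) => k /=.
by move=> /ballP; rewrite metric_sym.
Qed.

(** Otherwise points of [A] violate [P] at radii tending to 0. Their limit along an ultrafilter has
    a positive radius, which nearby points inherit. As the limit may lie outside [A], a radius is
    assumed at every point of the space. *)
Lemma lebesgue_number (A : set M) (P : M -> R -> Prop) : totally_bounded A ->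
  (forall x, exists2 r, 0 < r & P x r) ->
  (forall x y r r', P x r -> 0 < r' -> d x y + r' <= r -> P y r') ->
  exists2 r, 0 < r & forall x, A x -> P x r.
Proof.
move=> tbA Pr Pm; apply: contrapT => h.
have bad k : exists x, A x /\ ~ P x (k.+1%:R^-1).
  apply: contrapT => /forallNP nx; apply: h; exists k.+1%:R^-1; first by rewrite invr_gt0.
  by move=> x Ax; apply: contrapT => nP; apply: (nx x).
pose u k := sval (cid (bad k)); have uP k := svalP (cid (bad k)); have {}uP k : A (u k) /\ ~ P (u k) k.+1%:R^-1 by exact: uP.
clearbody u; have [G [UG sG]] := ultra_nat.
have [l ul] := tb_ultra_limit UG (fun k => (uP k).1) tbA.
have [r r0 Pl] := Pr l; have r2 : 0 < r / 2 by rewrite divr_gt0.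
have inf : G [set k : nat | k.+1%:R^-1 < r / 2].
  by apply: sG; exact: near_infty_natSinv_lt (PosNum r2).
have [k [k1 k2]] := @filter_ex _ _ ultra_proper _ (filterI (ul _ r2) inf).
apply: (uP k).2; apply: (Pm l _ r _ Pl); first by rewrite invr_gt0.
move: k1 k2 => /=; rewrite (metric_sym l); move: (d (u k) l) (k.+1%:R^-1) => a b.
by lra.
Qed.

Variable n : nat.
Hypotheses (iM : intrinsic M) (dimM : hausdorff_dim [set: M] = n%:R%:E).

(** The packing bound with [V] the ball of radius [r / 8]: going twice the distance of two of its
    points does not lead out of [ball x r]. *)
Lemma fourpt_ball_tb x (r : R) : 0 < r -> fourpt (ball x r) -> totally_bounded (ball x (r / 16)).
Proof.
move=> r0 fU e e0; pose rho := r / 16; have rho0 : 0 < rho by rewrite divr_gt0.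
have VU a b c : ball x (r / 8) a -> ball x (r / 8) b -> d a c <= 2 * d a b -> ball x r c.
  move=> /ballP h1 /ballP h2 h3; apply/ballP.
  by have := metric_triangle x a c; have := metric_triangle a x b; rewrite (metric_sym a x); lra.
pose al := Num.min 1 (e / rho).
have al0 : 0 < al <= 1 by rewrite lt_min ltr01 divr_gt0//= ge_min lexx.
have ale : al * rho <= e by rewrite -ler_pdivlMr// ge_min lexx orbT.
have [|s [sep sA sN]] := @maximal_spaced (ball x rho) e
    (Num.truncn ((packing_const n / al) ^+ n)) e0.
  move=> s sA sep; rewrite -(ler_nat R).
  have pV : ball x (2 * rho) `<=` ball x (r / 8).
    by move=> w /ballP h; apply/ballP; move: h; rewrite /rho; lra.
  have := packing_bound iM fU VU complete dimM rho0 al0 pV (fun y ys => (ballP _ _ _).1 (sA y ys))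
    (spaced_le ale sep).
  set B := _ ^+ n => h; rewrite ler_nat -ltnS -(ltr_nat R).
  exact: le_lt_trans (truncnS_gt _).
by exists s.
Qed.

(** Nets consist of points of the set itself, so a net of [B] cannot be reused. It bounds the size
    of spaced families in [A], because a net point is within [e / 2] of at most one of their
    members, and a maximal such family is a net of [A]. *)
Lemma tb_sub (A B : set M) : A `<=` B -> totally_bounded B -> totally_bounded A.
Proof.
move=> AB tb e e0; have e2 : 0 < e / 2 by rewrite divr_gt0.
have [s [_ hs]] := tb _ e2.
have [|s' [sep s'A s'N]] := @maximal_spaced A e (size s) e0; last by exists s'.
move=> t tA sep; have [/size0nil ->//|t0] := posnP (size t).
have [c0 c0t] : exists c0, c0 \in t.
  by case: t t0 {tA sep} => // c0 t' _; exists c0; rewrite inE eqxx.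
have ex x : {y | x \in t -> y \in s /\ d x y < e / 2}.
  apply: cid; have [xt|xt] := boolP (x \in t); last by exists c0.
  by have [y ys xy] := hs _ (AB _ (tA x xt)); exists y.
pose Y x := sval (ex x).
have YP x : x \in t -> Y x \in s /\ d x (Y x) < e / 2 by exact: svalP (ex x).
rewrite -(size_map Y t); apply: uniq_leq_size; last first.
  by move=> _ /mapP[x xt ->]; case: (YP x xt).
rewrite map_inj_in_uniq.
  rewrite uniq_pairwise; apply: sub_pairwise sep => x y /= h; rewrite -mdist_gt0.
  exact: lt_le_trans h.
move=> x y xt yt Yxy; apply: contrapT => /eqP xy.
have [_ h1] := YP x xt; have [_ h2] := YP y yt.
have h3 : d x y < e.
  have := metric_triangle x (Y x) y; rewrite {2}Yxy (metric_sym (Y y)).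
  by move: h1 h2; rewrite Yxy; lra.
have /(pairwiseP c0) psep := sep.
have ix : (index x t < size t)%N by rewrite index_mem.
have iy : (index y t < size t)%N by rewrite index_mem.
have [lt|lt|e'] := ltngtP (index x t) (index y t).
- by have := psep _ _ ix iy lt; rewrite !nth_index// leNgt h3.
- by have := psep _ _ iy ix lt; rewrite !nth_index// metric_sym leNgt h3.
- by move: xy; rewrite -(nth_index c0 xt) -(nth_index c0 yt) e' eqxx.
Qed.

Hypothesis cM : curvature_ge0 M.

Lemma local_fourpt x : exists2 r : R, 0 < r & fourpt (ball x r).
Proof.
have [U Ux hU] := cM x; have /nbhs_ballP[r /= r0 rU] := Ux.
by exists r => //; apply: fourptS rU _; exact: fourpt_of_curvature.
Qed.

Lemma local_tb x : exists2 r : R, 0 < r & totally_bounded (ball x r).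
Proof.
have [r r0 /(fourpt_ball_tb r0) h] := local_fourpt x.
by exists (r / 16) => //; rewrite divr_gt0.
Qed.

(** The Hopf-Rinow argument: the ball whose radius is the supremum of the admissible radii is itself
    totally bounded, as its points are close to smaller balls. A uniform radius for local total
    boundedness then leads beyond the supremum. *)
Lemma ball_totally_bounded o (r : R) : totally_bounded (ball o r).
Proof.
have [r1 r10 tb1] := local_tb o.
pose E := [set r : R | totally_bounded (ball o r)].
have E0 : E !=set0 by exists r1.
apply: contrapT => ntb.
have Eub : ubound E r.
  move=> t Et; rewrite leNgt; apply/negP => rt.
  by apply: ntb; apply: tb_sub Et => x /ballP h; apply/ballP; exact: lt_trans h rt.
have hs : has_sup E by split => //; exists r.
set rho := sup E.
have rho0 : 0 < rho by apply: lt_le_trans r10 _; exact: ub_le_sup hs.2 _ tb1.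
have below t : t < rho -> totally_bounded (ball o t).
  move=> trho; have [u Eu tu] := sup_adherent (ltac:(by rewrite subr_gt0) : 0 < rho - t) hs.
  apply: tb_sub Eu => x /ballP h; apply/ballP; rewrite -/rho in tu; lra.
have tbrho : totally_bounded (ball o rho).
  move=> e e0; pose e' := Num.min e rho.
  have e'0 : 0 < e' by rewrite lt_min e0.
  have e'e : e' <= e by rewrite ge_min lexx.
  have e'r : e' <= rho by rewrite ge_min lexx orbT.
  have e2 : 0 < e / 2 by rewrite divr_gt0.
  have [s [sA sN]] := below (rho - e' / 16) (ltac:(lra)) _ e2.
  exists s; split.
    by move=> y /sA /ballP h; apply/ballP; lra.
  move=> x /ballP ox; have e8 : 0 < e' / 8 by rewrite divr_gt0.
  have [g [g0 gD gst]] := intrinsic_almost_path iM o x e8.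
  pose t := Num.max 0 (d o x - e' / 4).
  have t0 : 0 <= t by rewrite le_max lexx.
  have tx : d o x - e' / 4 <= t by rewrite le_max lexx orbT.
  have tD : t <= d o x by rewrite ge_max mdist_ge0/=; lra.
  have tr : t <= rho - e' / 4 by rewrite ge_max; apply/andP; split; lra.
  have := gst 0 t (lexx _) t0 tD; rewrite g0 subr0 => /andP[_ h1].
  have /andP[_ h2] := gst t (d o x) t0 tD (lexx _).
  have [|y ys yg] := sN (g t); first by apply/ballP; lra.
  exists y => //; have := metric_triangle x (g t) y.
  have := metric_triangle (g t) (g (d o x)) x; rewrite (metric_sym x (g t)).
  by lra.
have [x y r' r'' tb _ h|r2 r20 hr2] := lebesgue_number
  (P := fun x r => totally_bounded (ball x r)) tbrho local_tb.
  apply: tb_sub tb => w /ballP yw; apply/ballP.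
  by have := metric_triangle x y w; lra.
have r24 : 0 < r2 / 4 by rewrite divr_gt0.
have [s [sA sN]] := tbrho _ r24.
pose B := \bigcup_(i in [set` s]) ball i r2.
have tbB : totally_bounded B.
  apply: (tb_bigcup (B := fun i : M => ball i r2) (s := s)) => // [i si|i si].
    exact: hr2 (sA i si).
  by move=> x Bx; exists i.
have : E (rho + r2 / 2).
  apply: tb_sub tbB => x /ballP ox.
  pose e := Num.min (r2 / 20) (rho / 4).
  have e0 : 0 < e by rewrite lt_min !divr_gt0.
  have e1 : e <= r2 / 20 by rewrite ge_min lexx.
  have e2 : e <= rho / 4 by rewrite ge_min lexx orbT.
  have [g [g0 gD gst]] := intrinsic_almost_path iM o x e0.
  pose t := Num.max 0 (d o x - 6 / 10 * r2).
  have t0 : 0 <= t by rewrite le_max lexx.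
  have tx : d o x - 6 / 10 * r2 <= t by rewrite le_max lexx orbT.
  have tD : t <= d o x by rewrite ge_max mdist_ge0/=; lra.
  have tr : t + e < rho.
    have : t <= Num.max 0 (rho - r2 / 10) by rewrite ge_max !le_max lexx/=; apply/orP; right; lra.
    by have [h|h] := leP 0 (rho - r2 / 10); lra.
  have := gst 0 t (lexx _) t0 tD; rewrite g0 subr0 => /andP[_ h1].
  have /andP[_ h2] := gst t (d o x) t0 tD (lexx _).
  have [|y ys yg] := sN (g t); first by apply/ballP; lra.
  exists y => //; apply/ballP; have := metric_triangle x (g t) y.
  have := metric_triangle (g t) (g (d o x)) x; rewrite (metric_sym x (g t)) (metric_sym y x).
  by lra.
by move=> /(ub_le_sup hs.2); rewrite -/rho; lra.
Qed.

Lemma ball_fourpt_radius o (r : R) : exists2 r0 : R, 0 < r0 &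
  forall x, ball o r x -> fourpt (ball x r0).
Proof.
apply: (lebesgue_number (P := fun x r => fourpt (ball x r)) (ball_totally_bounded o r)).
  exact: local_fourpt.
move=> x y r1 r2 h _ xy; apply: fourptS h => w /ballP yw; apply/ballP.
by have := metric_triangle x y w; lra.
Qed.

(** Almost shortest paths may be discontinuous, so their limit is taken at each time separately,
    along one ultrafilter. Their distance estimates have errors tending to 0 and become equalities
    in the limit. *)
Lemma shortest_path_exists p q : exists g, shortest_path p q g.
Proof.
have ek k : 0 < k.+1%:R^-1 :> R by rewrite invr_gt0.
pose D := d p q; have D0 : 0 <= D by exact: mdist_ge0.
pose G k := sval (cid (intrinsic_almost_path iM p q (ek k))).
have {G}[G GP] : exists G : nat -> R -> M, forall k, [/\ G k 0 = p, d (G k D) q <= k.+1%:R^-1 &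
    forall s t, 0 <= s -> s <= t -> t <= D ->
      t - s - k.+1%:R^-1 <= d (G k s) (G k t) <= t - s + k.+1%:R^-1].
  by exists G => k; exact: (svalP (cid (intrinsic_almost_path iM p q (ek k)))).
(* Times are clamped to the interval from 0 to [D], so that the limit exists at every real time. *)
pose cl (t : R) := Num.max 0 (Num.min t D).
have cl0 t : 0 <= cl t by rewrite le_max lexx.
have clD t : cl t <= D by rewrite ge_max D0 ge_min lexx orbT.
have clE t : 0 <= t <= D -> cl t = t.
  by move=> /andP[t0 tD]; rewrite /cl (min_idPl tD) (max_idPr t0).
have [UF [UG sG]] := ultra_nat.
have inB t k : ball p (D + 2) (G k (cl t)).
  have [g0 _ gst] := GP k; have /andP[_] := gst 0 (cl t) (lexx _) (cl0 t) (clD t).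
  rewrite g0 subr0 => h; apply/ballP; have := clD t.
  have : k.+1%:R^-1 <= 1 :> R by rewrite invf_le1 ?ler1n.
  by move: h; move: (k.+1%:R^-1 : R) => e; lra.
have exl t := tb_ultra_limit UG (inB t) (ball_totally_bounded p (D + 2)).
pose g t := sval (cid (exl t)).
have gl t e : 0 < e -> UF [set k | d (G k (cl t)) (g t) < e] by exact: (svalP (cid (exl t))).
clearbody g.
have PG : ProperFilter UF := ultra_proper.
have inf (e : R) : 0 < e -> UF [set k : nat | k.+1%:R^-1 < e].
  by move=> e0; apply: sG; exact: near_infty_natSinv_lt (PosNum e0).
exists g; split.
- apply: mdist_positivity; apply/eqP; rewrite eq_le mdist_ge0 andbT.
  apply/ler_addgt0Pl => e e0; rewrite addr0; have [k /=] := filter_ex (gl 0 e e0).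
  rewrite clE ?lexx//; have [-> _ _] := GP k; rewrite metric_sym; exact: ltW.
- apply: mdist_positivity; apply/eqP; rewrite eq_le mdist_ge0 andbT.
  apply/ler_addgt0Pl => e e0; rewrite addr0; have e2 : 0 < e / 2 by rewrite divr_gt0.
  have [k [/= h1 h2]] := filter_ex (filterI (gl D _ e2) (inf _ e2)).
  rewrite clE ?lexx ?D0// in h1; have [_ h3 _] := GP k.
  have := metric_triangle (g D) (G k D) q; rewrite (metric_sym (g D) (G k D)) -/D.
  by move: h1 h2 h3; move: (k.+1%:R^-1 : R) => u; lra.
have main s t : 0 <= s <= D -> 0 <= t <= D -> s <= t -> d (g s) (g t) = t - s.
  move=> sD tD st; apply/eqP; rewrite -subr_eq0 -normr_eq0 eq_le normr_ge0 andbT.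
  apply/ler_addgt0Pl => e e0; rewrite addr0; have e4 : 0 < e / 4 by rewrite divr_gt0.
  have [k [[/= h1 h2] h3]] := filter_ex (filterI (filterI (gl s _ e4) (gl t _ e4)) (inf _ e4)).
  rewrite !clE// in h1 h2; have [_ _ gst] := GP k.
  have /andP[s0 _] := sD; have /andP[_ tD'] := tD; have /andP[h4 h5] := gst s t s0 st tD'.
  have a1 := metric_triangle (g s) (G k s) (g t); have a2 := metric_triangle (G k s) (G k t) (g t).
  have a3 := metric_triangle (G k s) (g s) (G k t); have a4 := metric_triangle (g s) (g t) (G k t).
  rewrite (metric_sym (g s) (G k s)) in a1; rewrite (metric_sym (g t) (G k t)) in a4.
  rewrite ler_norml; move: h1 h2 h3 h4 h5 a1 a2 a3 a4; move: (k.+1%:R^-1 : R) => u.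
  by clear => *; apply/andP; split; lra.
move=> s t; rewrite !in_itv/= => sD tD; have [st|/ltW ts] := leP s t.
  by rewrite distrC ger0_norm ?subr_ge0// main.
by rewrite ger0_norm ?subr_ge0// metric_sym main.
Qed.

End properness.

(** * Globalization *)

Section globalization.
Context {R : realType} {M : metricType R}.
Implicit Types x y z p q w o : M.
Implicit Types (g h : R -> M) (L : R).
Local Notation d x y := (@mdist R M x y : R).

Lemma shortest_path_dist x p g (s t : R) : shortest_path x p g ->
  0 <= s -> s <= t -> t <= d x p -> d (g s) (g t) = t - s.
Proof.
move=> [_ _ h] s0 st tp; rewrite h ?in_itv/= ?s0 ?(le_trans st)//; last by rewrite (le_trans s0).
by rewrite distrC ger0_norm// subr_ge0.
Qed.

Lemma shortest_path_start x p g (t : R) : shortest_path x p g ->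
  0 <= t -> t <= d x p -> d x (g t) = t.
Proof.
move=> hg t0 tp; case: (hg) => e _ _; rewrite -{1}e (shortest_path_dist hg)// ?subr0//.
Qed.

Lemma shortest_path_end x p g (t : R) : shortest_path x p g ->
  0 <= t -> t <= d x p -> d (g t) p = d x p - t.
Proof.
by move=> hg t0 tp; case: (hg) => _ e _; rewrite -[p in LHS]e (shortest_path_dist hg).
Qed.

Lemma shortest_path_prefix x p g (u : R) : shortest_path x p g ->
  0 <= u -> u <= d x p -> shortest_path x (g u) g.
Proof.
move=> hg u0 up; have e := shortest_path_start hg u0 up; case: (hg) => g0 g1 gd.
split=> //; first by rewrite e.
rewrite e => s t; rewrite !in_itv/= => /andP[s0 su] /andP[t0 tu].
by apply: gd; rewrite in_itv/= ?s0 ?t0 (le_trans _ up).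
Qed.

Lemma shortest_path_suffix x p g (u : R) : shortest_path x p g ->
  0 <= u -> u <= d x p -> shortest_path (g u) p (fun s => g (u + s)).
Proof.
move=> hg u0 up; have e := shortest_path_end hg u0 up; case: (hg) => g0 g1 gd.
split; first by rewrite addr0.
  by rewrite e addrC subrK.
rewrite e => s t; rewrite !in_itv/= => /andP[s0 su] /andP[t0 tu].
rewrite gd ?in_itv/=; last 2 first.
- by apply/andP; split; lra.
- by apply/andP; split; lra.
by congr `|_|; ring.
Qed.

Lemma shortest_path_back x p g (u : R) : shortest_path x p g ->
  0 <= u -> u <= d x p -> shortest_path (g u) x (fun s => g (u - s)).
Proof.
move=> hg u0 up; have e := shortest_path_start hg u0 up; case: (hg) => g0 g1 gd.
split; first by rewrite subr0.
  by rewrite metric_sym e subrr.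
rewrite metric_sym e => s t; rewrite !in_itv/= => /andP[s0 su] /andP[t0 tu].
rewrite gd ?in_itv/=; last 2 first.
- by apply/andP; split; lra.
- by apply/andP; split; lra.
by rewrite distrC; congr `|_|; ring.
Qed.

(** For paths from [x] parametrized by arc length, [L] is the cosine of their angle; the product
    form avoids quotients. *)
Definition germ_cos x g h L : Prop := forall e : R, 0 < e -> exists2 rho : R, 0 < rho &
  forall s t, 0 < s < rho -> 0 < t < rho -> `|ip x (g s) (h t) - L * (s * t)| <= e * (s * t).

Lemma germ_cosC x g h L : germ_cos x g h L -> germ_cos x h g L.
Proof.
move=> H e /H[rho r0 hr]; exists rho => // s t hs ht.
by rewrite ipC (mulrC s); exact: hr.
Qed.

Lemma fourpt_path_mono x p g y (r s s' : R) : fourpt (ball x r) -> shortest_path x p g ->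
  0 <= s' -> s' <= s -> s <= d x p -> s < r -> ball x r y ->
  s * ip x (g s') y <= s' * ip x (g s) y.
Proof.
move=> fr hg s0 ss sp sr yr.
have e1 := shortest_path_start hg (le_trans s0 ss) sp.
have e2 := shortest_path_start hg s0 (le_trans ss sp).
have e3 := shortest_path_dist hg s0 ss sp.
have r0 : 0 < r by lra.
have h := @ip_between R M (ball x r) x (g s) (g s') y fr.
rewrite e1 e2 e3 in h; apply: h => //.
- by apply/ballP; rewrite mdistxx.
- by apply/ballP; rewrite e1.
- by apply/ballP; rewrite e2; lra.
- by ring.
Qed.

Lemma fourpt_path_mono2 x p q g h (r s s' t t' : R) : fourpt (ball x r) ->
  shortest_path x p g -> shortest_path x q h ->
  0 < s' -> s' <= s -> s <= d x p -> s < r -> 0 < t' -> t' <= t -> t <= d x q -> t < r ->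
  ip x (g s') (h t') / (s' * t') <= ip x (g s) (h t) / (s * t).
Proof.
move=> fr hg hh s0 ss sp sr t0 tt tp tr.
have s1 : 0 < s by lra.
have t1 : 0 < t by lra.
have b1 : ball x r (h t').
  by apply/ballP; rewrite (shortest_path_start hh (ltW t0) (le_trans tt tp)); lra.
have b2 : ball x r (g s).
  by apply/ballP; rewrite (shortest_path_start hg (ltW s1) sp); lra.
have h1 := fourpt_path_mono fr hg (ltW s0) ss sp sr b1.
have h2 := fourpt_path_mono fr hh (ltW t0) tt tp tr b2.
rewrite (ipC x (h t')) (ipC x (h t)) in h2.
rewrite ler_pdivrMr ?mulr_gt0// mulrAC ler_pdivlMr ?mulr_gt0//.
have := ler_wpM2r (ltW t1) h1; have := ler_wpM2l (ltW s0) h2.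
by lra.
Qed.

(** By [fourpt_path_mono2] comparison cosines decrease as both points approach [x], so they converge
    to their infimum. That the limit is a lower bound is the local hinge comparison. *)
Lemma germ_cos_exists x p q g h (r : R) : fourpt (ball x r) -> 0 < r -> x != p -> x != q ->
  shortest_path x p g -> shortest_path x q h ->
  exists L, [/\ germ_cos x g h L, `|L| <= 1 &
    forall s t, 0 < s <= d x p -> s < r -> 0 < t <= d x q -> t < r ->
      L * (s * t) <= ip x (g s) (h t)].
Proof.
rewrite -!mdist_gt0 => fr r0 xp xq hg hh.
pose c s t := ip x (g s) (h t) / (s * t).
pose r1 := Num.min r (Num.min (d x p) (d x q)).
have r10 : 0 < r1 by rewrite !lt_min r0 xp xq.
have r1r : r1 <= r by rewrite ge_min lexx.
have r1p : r1 <= d x p by rewrite !ge_min lexx !orbT.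
have r1q : r1 <= d x q by rewrite !ge_min lexx !orbT.
clearbody r1.
pose E := [set v | exists s t, [/\ 0 < s <= d x p, s < r, 0 < t <= d x q, t < r & v = c s t]].
have cb s t : 0 < s <= d x p -> 0 < t <= d x q -> `|c s t| <= 1.
  move=> /andP[s0 sp] /andP[t0 tq]; rewrite /c normrM normfV.
  have st0 : 0 < s * t by rewrite mulr_gt0.
  rewrite (gtr0_norm st0) ler_pdivrMr// mul1r.
  have := ip_bounds x (g s) (h t).
  by rewrite (shortest_path_start hg (ltW s0) sp) (shortest_path_start hh (ltW t0) tq).
have hE : has_inf E.
  split.
    exists (c (r1 / 2) (r1 / 2)), (r1 / 2), (r1 / 2).
    by split => //; first [lra | apply/andP; split; lra].
  exists (-1) => _ [s [t [hs _ ht _ ->]]].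
  by have := cb s t hs ht; rewrite ler_norml => /andP[].
have lb s t : 0 < s <= d x p -> s < r -> 0 < t <= d x q -> t < r -> inf E <= c s t.
  by move=> *; apply: (ge_inf hE.2); exists s, t.
exists (inf E); split.
- move=> e e0; have [_ [s [t [/andP[s0 sp] sr /andP[t0 tq] tr ->]]] hst] := inf_adherent e0 hE.
  exists (Num.min r1 (Num.min s t)); first by rewrite !lt_min r10 s0 t0.
  move=> s' t'; rewrite !lt_min => /andP[s'0 /and3P[s'r s's _]] /andP[t'0 /and3P[t'r _ t't]].
  have st0 : 0 < s' * t' by rewrite mulr_gt0.
  have m : c s' t' <= c s t.
    by apply: (fourpt_path_mono2 fr hg hh) => //; exact: ltW.
  have l : inf E <= c s' t' by apply: lb; first [apply/andP; split; lra | lra].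
  have -> : ip x (g s') (h t') - inf E * (s' * t') = (c s' t' - inf E) * (s' * t').
    by rewrite /c mulrBl divfK// gt_eqF.
  rewrite normrM (gtr0_norm st0) ler_wpM2r ?(ltW st0)//.
  by rewrite ger0_norm ?subr_ge0//; lra.
- rewrite ler_norml; apply/andP; split.
    apply: lb_le_inf; first exact: hE.1.
    by move=> _ [s [t [hs _ ht _ ->]]]; have := cb s t hs ht; rewrite ler_norml => /andP[].
  have := lb (r1 / 2) (r1 / 2); have := cb (r1 / 2) (r1 / 2).
  have a1 : 0 < r1 / 2 <= d x p by apply/andP; split; lra.
  have a2 : 0 < r1 / 2 <= d x q by apply/andP; split; lra.
  have a3 : r1 / 2 < r by lra.
  move=> /(_ a1 a2); rewrite ler_norml => /andP[_ a4] /(_ a1 a3 a2 a3).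
  by move=> /le_trans; apply.
- move=> s t hs sr ht tr; have := lb s t hs sr ht tr.
  by case/andP: hs => s0 _; case/andP: ht => t0 _; rewrite /c ler_pdivlMr ?mulr_gt0.
Qed.

(** As [h1 s] and [h2 s] are exactly opposite, the square root in the four-point condition vanishes:
    adjacent angles add up to at most pi. *)
Lemma germ_cos_opposite x g h1 h2 (r : R) L1 L2 : fourpt (ball x r) -> 0 < r ->
  (forall s, 0 <= s < r -> [/\ d x (g s) = s, d x (h1 s) = s, d x (h2 s) = s & d (h1 s) (h2 s) = s + s]) ->
  germ_cos x g h1 L1 -> germ_cos x g h2 L2 -> 0 <= L1 + L2.
Proof.
move=> fr r0 hd g1 g2; apply/ler_addgt0Pr => e e0; have e2 : 0 < e / 2 by rewrite divr_gt0.
have [r1 r10 H1] := g1 _ e2; have [r2 r20 H2] := g2 _ e2.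
pose s := Num.min r (Num.min r1 r2) / 2.
have m0 : 0 < Num.min r (Num.min r1 r2) by rewrite !lt_min r0 r10 r20.
have s0 : 0 < s by rewrite divr_gt0.
have sr : s < r by apply: lt_le_trans (_ : Num.min r (Num.min r1 r2) <= _); [rewrite /s; lra|rewrite ge_min lexx].
have sr1 : 0 < s < r1.
  rewrite s0 /=; apply: lt_le_trans (_ : Num.min r (Num.min r1 r2) <= _); first by rewrite /s; lra.
  by rewrite !ge_min lexx !orbT.
have sr2 : 0 < s < r2.
  rewrite s0 /=; apply: lt_le_trans (_ : Num.min r (Num.min r1 r2) <= _); first by rewrite /s; lra.
  by rewrite !ge_min lexx !orbT.
have [e1 e3 e4 e5] := hd s (ltac:(by rewrite (ltW s0))).
have := fr x (h1 s) (h2 s) (g s); rewrite e1 e3 e4.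
have -> : ip x (h1 s) (h2 s) = - (s * s) by rewrite /ip e3 e4 e5; field.
rewrite subrr mulr0 sqrtr0 mulr0 addr0 -mulrDr pmulr_rge0// => f0.
have {f0} : 0 <= ip x (h1 s) (g s) + ip x (h2 s) (g s).
  by apply: f0; apply/ballP; rewrite ?mdistxx ?e1 ?e3 ?e4.
have := H1 s s sr1 sr1; have := H2 s s sr2 sr2; rewrite !ler_norml (ipC x (g s)) (ipC x (g s)).
have ss0 : 0 < s * s by rewrite mulr_gt0.
move=> /andP[_ a1] /andP[_ a2] a3.
have : 0 <= (L1 + L2 + e) * (s * s) by move: a1 a2 a3; lra.
by rewrite pmulr_lge0.
Qed.

(** Toponogov's hinge comparison for legs of total length below [l]. The ends are confined to a
    ball, because the scale at which the four-point condition is known is uniform on bounded sets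
    only. *)
Definition hinge_comparison o (D l : R) : Prop := forall x p q g h L,
  d o p < D -> d o q < D -> x != p -> x != q ->
  shortest_path x p g -> shortest_path x q h -> germ_cos x g h L ->
  d x p + d x q < l -> L * (d x p * d x q) <= ip x p q.

Hypothesis geod : forall p q, exists g, shortest_path p q g.
Hypothesis radius : forall o (r : R), exists2 r0 : R, 0 < r0 &
  forall x, ball o r x -> fourpt (ball x r0).

Lemma fourpt_at x : exists2 r : R, 0 < r & fourpt (ball x r).
Proof.
by have [r r0 h] := radius x 1; exists r => //; apply: h; apply/ballP; rewrite mdistxx.
Qed.

Lemma germ_cos_unique x g h L L' : germ_cos x g h L -> germ_cos x g h L' -> L = L'.
Proof.
move=> g1 g2; apply/eqP; rewrite -subr_eq0 -normr_eq0 eq_le normr_ge0 andbT.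
apply/ler_addgt0Pl => e e0; rewrite addr0; have e2 : 0 < e / 2 by rewrite divr_gt0.
have [r1 r10 H1] := g1 _ e2; have [r2 r20 H2] := g2 _ e2.
pose s := Num.min r1 r2 / 2; have m0 : 0 < Num.min r1 r2 by rewrite lt_min r10.
have m1 : Num.min r1 r2 <= r1 by rewrite ge_min lexx.
have m2 : Num.min r1 r2 <= r2 by rewrite ge_min lexx orbT.
have s0 : 0 < s by rewrite divr_gt0.
have s1 : 0 < s < r1 by rewrite s0 /= /s; lra.
have s2 : 0 < s < r2 by rewrite s0 /= /s; lra.
have ss0 : 0 < s * s by rewrite mulr_gt0.
have := H1 s s s1 s1; have := H2 s s s2 s2; rewrite !ler_norml => /andP[a1 a2] /andP[a3 a4].
have b1 : (L - L') * (s * s) <= e * (s * s) by move: a1 a4; lra.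
have b2 : - e * (s * s) <= (L - L') * (s * s) by move: a2 a3; lra.
by apply/andP; split; [rewrite -(ler_pM2r ss0)|rewrite -(ler_pM2r ss0)].
Qed.

Lemma germ_cos_le1 x p q g h L : x != p -> x != q -> shortest_path x p g ->
  shortest_path x q h -> germ_cos x g h L -> `|L| <= 1.
Proof.
move=> xp xq hg hh gL; have [r r0 fr] := fourpt_at x.
have [L' [gL' L1 _]] := germ_cos_exists fr r0 xp xq hg hh.
by rewrite (germ_cos_unique gL gL').
Qed.

Lemma hinge_comparison_base o (D : R) : exists2 l : R, 0 < l & hinge_comparison o D l.
Proof.
have [r r0 hr] := radius o (D + 1); pose l := Num.min 1 r.
have l0 : 0 < l by rewrite lt_min ltr01.
have l1 : l <= 1 by rewrite ge_min lexx.
have lr : l <= r by rewrite ge_min lexx orbT.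
exists l => // x p q g h L op oq xp xq hg hh gL sz.
have p0 := mdist_ge0 x p; have q0 := mdist_ge0 x q.
have fr : fourpt (ball x r).
  apply: hr; apply/ballP; have := metric_triangle o p x; rewrite (metric_sym p x); lra.
have [L' [gL' _ hL]] := germ_cos_exists fr r0 xp xq hg hh.
rewrite (germ_cos_unique gL gL').
have := hL (d x p) (d x q); rewrite !mdist_gt0 xp xq !lexx.
case: hg => _ -> _; case: hh => _ -> _; apply => //; lra.
Qed.

End globalization.

(** * From hinges of size 2 l / 3 to hinges of size l *)

Section globalization_step.
Context {R : realType} {M : metricType R}.
Implicit Types x y z p q w o : M.
Implicit Types (g h : R -> M) (L : R).
Local Notation d x y := (@mdist R M x y : R).

Hypothesis geod : forall p q, exists g, shortest_path p q g.
Hypothesis radius : forall o (r : R), exists2 r0 : R, 0 < r0 &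
  forall x, ball o r x -> fourpt (ball x r0).

Section reduction.
Variables (o : M) (D l e : R).
Hypothesis HC : hinge_comparison o D (2 / 3 * l).
Hypotheses (e0 : 0 < e) (el : e <= l / 18).

Local Ltac lr := clear -geod radius HC e0 el; lra.

(** Here [m] counts shortenings by [e]. The error [36 * l * e] does not grow with [m]: a shortening
    passes it on unchanged, and only almost straight hinges really need it. *)
Definition almost_comparison (m : nat) : Prop := forall x p q g h L,
  d o p < D - l -> d o q < D - l -> x != p -> x != q ->
  shortest_path x p g -> shortest_path x q h -> germ_cos x g h L ->
  d x p + d x q < l -> d x p + d x q < 2 / 3 * l + m%:R * e ->
  d p q ^+ 2 <= d x p ^+ 2 + d x q ^+ 2 - 2 * (d x p * d x q) * L + 36 * l * e.

(* Replacing the vertex x by a point on the longer side shortens the hinge and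
   does not increase its Euclidean side; a hinge that is hardly shortened is
   almost straight at x. *)
Lemma almost_comparison_step (m : nat) x p q g h L :
  almost_comparison m ->
  d o p < D - l -> d o q < D - l -> x != p -> x != q ->
  shortest_path x p g -> shortest_path x q h -> germ_cos x g h L ->
  2 / 3 * l <= d x p + d x q < l -> d x p + d x q < 2 / 3 * l + m.+1%:R * e ->
  d x p <= d x q ->
  d p q ^+ 2 <= d x p ^+ 2 + d x q ^+ 2 - 2 * (d x p * d x q) * L + 36 * l * e.
Proof.
move=> IH op oq xp xq hg hh gL /andP[sz1 sz2] sz3 ab; have e00 := e0; have el0 := el.
have L1 := germ_cos_le1 radius xp xq hg hh gL.
have a0 : 0 < d x p by rewrite mdist_gt0.
have b0 : 0 < d x q by rewrite mdist_gt0.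
set a := d x p in sz1 sz2 sz3 ab a0 *; set b := d x q in sz1 sz2 sz3 ab b0 *.
have l0 : 0 < l by lra.
(* Both auxiliary hinges, at [x] with ends [p], [x'] and at [x'] with ends [p], [x], have size at
   most [a + 2 * u < 2 / 3 * l]. Since [a < l / 2], also [l / 18 < u]. *)
pose u := (2 / 3 * l - a) / 3.
have u1 : l / 18 < u by rewrite /u; lra.
have u0 : 0 < u by lra.
have ub : u < b by rewrite /u; lra.
pose x' := h u.
have xx' : d x x' = u by exact: (shortest_path_start hh (ltW u0) (ltW ub)).
have x'q : d x' q = b - u by exact: (shortest_path_end hh (ltW u0) (ltW ub)).
have xnx' : x != x' by rewrite -mdist_gt0 xx'.
have x'nq : x' != q by rewrite -mdist_gt0 x'q subr_gt0.
have ox : d o x < D.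
  by have := metric_triangle o p x; rewrite (metric_sym p x) -/a; lra.
have ox' : d o x' < D.
  by have := metric_triangle o q x'; rewrite (metric_sym q x') x'q; lra.
have op' : d o p < D by lra.
have hpre := shortest_path_prefix hh (ltW u0) (ltW ub); rewrite -/x' in hpre.
have hc1 := HC op' ox' xp xnx' hg hpre gL; rewrite xx' -/a in hc1.
have {}hc1 : L * (a * u) <= ip x p x' by apply: hc1; rewrite /u; lra.
have [Lm LM] : -1 <= L /\ L <= 1 by move: L1; rewrite ler_norml => /andP.
have le0 : 0 <= l * e by rewrite mulr_ge0// ltW.
have [px'|px'] := eqVneq x' p.
  have pq : d p q = b - u by rewrite -px' x'q.
  have au : a = u by rewrite /a -px' xx'.
  rewrite pq -au; have : 0 <= (a * b) * (1 - L) by rewrite !mulr_ge0 ?(ltW a0) ?(ltW b0) ?subr_ge0.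
  by lra.
set a' := d x' p; have a'0 : 0 < a' by rewrite mdist_gt0.
have tri1 : a' <= a + u.
  by have := metric_triangle x' x p; rewrite (metric_sym x' x) xx' -/a -/a'; lra.
have ipE : ip x p x' = (a ^+ 2 + u ^+ 2 - a' ^+ 2) / 2 by rewrite /ip xx' (metric_sym p x').
have [big|small] := lerP (a + u - e) a'.
  have sq : (a + u - e) ^+ 2 <= a' ^+ 2 by rewrite lerXn2r ?nnegrE//; move: el0 u1 a0 a'0; lr.
  have h1 : a * u * (1 + L) <= e * (a + u).
    by rewrite ipE in hc1; have := sqr_ge0 e; move: hc1 sq; lra.
  have h2 : a * b * (1 + L) <= 18 * (e * l).
    have h3 : a * b * (1 + L) * u <= 18 * (e * l) * u.
      have : b * (a * u * (1 + L)) <= b * (e * (a + u)) by rewrite ler_pM2l.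
      have : e * (b * (a + u)) <= e * (l * l).
        rewrite ler_pM2l//; apply: ler_pM; move: a0 b0 u0 ab sz2 ub; lr.
      have : 18 * (e * l) * (l / 18) <= 18 * (e * l) * u.
        by rewrite ler_wpM2l ?(ltW u1)// !mulr_ge0// ltW.
      by lra.
    by rewrite -(ler_pM2r u0).
  have pq : d p q <= a + b by have := metric_triangle p x q; rewrite (metric_sym p x).
  have : d p q ^+ 2 <= (a + b) ^+ 2 by rewrite lerXn2r ?nnegrE ?mdist_ge0// ltW// addr_gt0.
  by lra.
have [g' hg'] := geod x' p.
have hf := shortest_path_suffix hh (ltW u0) (ltW ub); rewrite -/x' in hf.
have hb := shortest_path_back hh (ltW u0) (ltW ub); rewrite -/x' in hb.
have [r r0 fr] := fourpt_at radius x'.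
have x'nx : x' != x by rewrite eq_sym.
have [L1' [gL1 _ _]] := germ_cos_exists fr r0 px' x'nx hg' hb.
have [L2 [gL2 _ _]] := germ_cos_exists fr r0 px' x'nq hg' hf.
have L12 : 0 <= L1' + L2.
  pose r1 := Num.min r (Num.min u (Num.min (b - u) a')).
  have r10 : 0 < r1 by rewrite !lt_min r0 u0 subr_gt0 ub a'0.
  have r1r : r1 <= r by rewrite ge_min lexx.
  have r1u : r1 <= u by rewrite !ge_min lexx !orbT.
  have r1b : r1 <= b - u by rewrite !ge_min lexx !orbT.
  have r1a : r1 <= a' by rewrite !ge_min lexx !orbT.
  apply: (germ_cos_opposite (r := r1) _ r10 _ gL1 gL2).
    by apply: fourptS fr => w /ballP h1; apply/ballP; exact: lt_le_trans h1 r1r.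
  move=> s /andP[s0 sr]; split.
  - by apply: (shortest_path_start hg') => //; exact: le_trans (ltW sr) r1a.
  - by apply: (shortest_path_start hb) => //; rewrite metric_sym xx'; exact: le_trans (ltW sr) r1u.
  - by apply: (shortest_path_start hf) => //; rewrite x'q; exact: le_trans (ltW sr) r1b.
  - by rewrite (shortest_path_dist hh) -/b//; move: s0 sr r1u r1b; lr.
have hc2 := HC op' ox px' x'nx hg' hb gL1; rewrite (metric_sym x' x) xx' -/a' in hc2.
have {}hc2 : L1' * (a' * u) <= ip x' p x by apply: hc2; have eu : u = (2 / 3 * l - a) / 3 by []; move: eu tri1 ab sz2 l0; clear; lra.
rewrite /ip -/a' (metric_sym x' x) xx' (metric_sym p x) -/a in hc2.
have := IH x' p q g' _ L2 op oq px' x'nq hg' hf gL2; rewrite x'q -/a' => IH'.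
have {IH'} : d p q ^+ 2 <= a' ^+ 2 + (b - u) ^+ 2 - 2 * (a' * (b - u)) * L2 + 36 * l * e.
  by apply: IH'; [move: tri1 sz2; lr|rewrite -natr1 mulrDl mul1r in sz3; move: small sz3; lr].
move=> /le_trans; apply; rewrite lerD2r.
rewrite ipE in hc1.
(* Adjacent angles at [x'] replace [L2] by [L1']; the auxiliary hinge at [x'] bounds [L1'] and the
   one at [x] bounds [a']. *)
have k1 : (b - u) * (- L2 * (a' * u)) <= (b - u) * (L1' * (a' * u)).
  apply: ler_wpM2l; first by rewrite subr_ge0 ltW.
  by apply: ler_wpM2r; [exact: mulr_ge0 (ltW a'0) (ltW u0)|move: L12; lr].
have k2 : (b - u) * (L1' * (a' * u)) <= (b - u) * ((a' ^+ 2 + u ^+ 2 - a ^+ 2) / 2).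
  by rewrite ler_wpM2l ?subr_ge0 ?(ltW ub).
have k3 : b * (L * (a * u)) <= b * ((a ^+ 2 + u ^+ 2 - a' ^+ 2) / 2).
  by rewrite ler_wpM2l// ltW.
rewrite -(ler_pM2r u0); move: k1 k2 k3; clear; lra.
Qed.

Lemma almost_comparison_all (m : nat) : almost_comparison m.
Proof.
have e00 := e0; elim: m => [|m IH] x p q g h L op oq xp xq hg hh gL sz1 sz2.
  have p0 : 0 < d x p by rewrite mdist_gt0.
  have q0 : 0 < d x q by rewrite mdist_gt0.
  have l0 : 0 < l by lra.
  have := HC (ltac:(lra) : d o p < D) (ltac:(lra) : d o q < D) xp xq hg hh gL.
  rewrite mul0r addr0 in sz2; move=> /(_ sz2); rewrite /ip.
  have le0 : 0 <= l * e by rewrite mulr_ge0// ltW.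
  by lra.
have [small|big] := ltrP (d x p + d x q) (2 / 3 * l).
  apply: (IH x p q g h L) => //; apply: (lt_le_trans small).
  by rewrite lerDl mulr_ge0// ltW.
have [ab|/ltW ba] := leP (d x p) (d x q).
  by apply: (almost_comparison_step IH op oq xp xq hg hh gL) => //; rewrite big.
rewrite metric_sym (addrC (d x p ^+ 2)) (mulrC (d x p)).
apply: (almost_comparison_step IH oq op xq xp hh hg (germ_cosC gL)) => //.
  by rewrite addrC big.
by rewrite addrC.
Qed.
End reduction.

(** The radius decreases by [l] because the vertices used in the reduction may be farther from [o]
    than the ends, though by less than [l]. The error disappears as [e] is arbitrarily small. *)
Lemma hinge_comparison_step o (D l : R) :
  hinge_comparison o D (2 / 3 * l) -> hinge_comparison o (D - l) l.
Proof.
move=> HC x p q g h L op oq xp xq hg hh gL sz.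
have p0 : 0 < d x p by rewrite mdist_gt0.
have q0 : 0 < d x q by rewrite mdist_gt0.
have l0 : 0 < l by lra.
apply/ler_addgt0Pr => e' e'0.
pose e := Num.min (l / 18) (e' / (18 * l)).
have e0 : 0 < e by rewrite lt_min !divr_gt0// mulr_gt0.
have e1 : e <= l / 18 by rewrite ge_min lexx.
have e2 : 18 * l * e <= e'.
  by rewrite mulrC -ler_pdivlMr ?mulr_gt0// ge_min lexx orbT.
pose m := (Num.truncn (l / e)).+1.
have hm : l < m%:R * e by rewrite -ltr_pdivrMr//; exact: truncnS_gt.
have := almost_comparison_all HC e0 e1 (m := m) op oq xp xq hg hh gL sz.
have -> : d x p + d x q < 2 / 3 * l + m%:R * e by lra.
move=> /(_ isT); rewrite /ip; move: e2; clear; lra.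
Qed.

(** Sizes grow by the factor 3 / 2, and each step costs its size in radius. These losses form a
    geometric series with sum at most three times the last size, so the radius [4 * l + 1] around
    [x] leaves [l + 1] in the end. *)
Lemma hinge_comparison_all x p q g h L : x != p -> x != q ->
  shortest_path x p g -> shortest_path x q h -> germ_cos x g h L ->
  L * (d x p * d x q) <= ip x p q.
Proof.
move=> xp xq hg hh gL; pose l := d x p + d x q + 1.
have p0 := mdist_ge0 x p; have q0 := mdist_ge0 x q.
pose D := 4 * l + 1.
have [l0 l00 base] := hinge_comparison_base radius x D.
have l1 : 0 < l by rewrite /l; lra.
have [J hJ] : exists J, (2 / 3) ^+ J * l < l0.
  have /cvgrPdist_lt/(_ _ (divr_gt0 l00 l1)) : ((2 / 3) : R) ^+ k @[k --> \oo] --> 0.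
    by apply: cvg_expr; rewrite ger0_norm; lra.
  case=> J _ /(_ J (leqnn J)) /=; rewrite sub0r normrN ger0_norm ?exprn_ge0//.
  by rewrite ltr_pdivlMr// => hJ; exists J.
pose lj j := (3 / 2) ^+ j * ((2 / 3) ^+ J * l).
have c32 j : 0 < (3 / 2 : R) ^+ j by rewrite exprn_gt0.
have c23 j : 0 < (2 / 3 : R) ^+ j by rewrite exprn_gt0.
have lj0 j : 0 < lj j by rewrite !mulr_gt0.
have main j : hinge_comparison x (D - 3 * lj j) (lj j).
  elim: j => [|j IH].
    move=> y p' q' g' h' L' op oq yp yq hg' hh' gL' sz.
    apply: (base y p' q' g' h' L') => //; have := lj0 0%N; rewrite /lj expr0 mul1r in op oq sz *; lra.
  have -> : D - 3 * lj j.+1 = D - 3 * lj j - lj j.+1 by rewrite /lj exprS; lra.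
  apply: hinge_comparison_step.
  by have -> : 2 / 3 * lj j.+1 = lj j by rewrite /lj exprS; lra.
have lJ : lj J = l by rewrite /lj mulrA -exprMn (_ : 3 / 2 * (2 / 3) = 1 :> R) ?expr1n ?mul1r//; lra.
have := main J; rewrite lJ => H; apply: (H x p q g h L) => //; rewrite /D /l; lra.
Qed.

(** Hinge comparison at [z] for the sides to [x] and to [y], whose angles with a shortest path to
    [p] are adjacent. *)
Lemma global_stewart x y z p : d x z + d z y = d x y ->
  0 <= d z y * ip z x p + d z x * ip z y p.
Proof.
move=> E; have [->|zx] := eqVneq z x; first by rewrite mdistxx ip0l mulr0 mul0r addr0.
have [->|zy] := eqVneq z y; first by rewrite mdistxx ip0l mulr0 mul0r addr0.
have [->|zp] := eqVneq z p; first by rewrite !ip0r !mulr0 addr0.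
have [gx hx] := geod z x; have [gy hy] := geod z y; have [gp hp] := geod z p.
have [r r0 fr] := fourpt_at radius z.
have [L1 [gL1 _ _]] := germ_cos_exists fr r0 zp zx hp hx.
have [L2 [gL2 _ _]] := germ_cos_exists fr r0 zp zy hp hy.
have x0 : 0 < d z x by rewrite mdist_gt0.
have y0 : 0 < d z y by rewrite mdist_gt0.
have p0 : 0 < d z p by rewrite mdist_gt0.
have L12 : 0 <= L1 + L2.
  pose r1 := Num.min r (Num.min (d z x) (Num.min (d z y) (d z p))).
  have r10 : 0 < r1 by rewrite !lt_min r0 x0 y0 p0.
  have r1r : r1 <= r by rewrite ge_min lexx.
  have r1x : r1 <= d z x by rewrite !ge_min lexx !orbT.
  have r1y : r1 <= d z y by rewrite !ge_min lexx !orbT.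
  have r1p : r1 <= d z p by rewrite !ge_min lexx !orbT.
  apply: (germ_cos_opposite (r := r1) _ r10 _ gL1 gL2).
    by apply: fourptS fr => w /ballP h1; apply/ballP; exact: lt_le_trans h1 r1r.
  move=> s /andP[s0 sr].
  have sx : s <= d z x by lra.
  have sy : s <= d z y by lra.
  have sp : s <= d z p by lra.
  have e1 := shortest_path_start hx s0 sx; have e2 := shortest_path_start hy s0 sy.
  split => //; first exact: (shortest_path_start hp s0 sp).
  have e3 := shortest_path_end hx s0 sx; have e4 := shortest_path_end hy s0 sy.
  apply/eqP; rewrite eq_le; apply/andP; split.
    by have := metric_triangle (gx s) z (gy s); rewrite (metric_sym (gx s) z) e1 e2.
  have := metric_triangle x (gx s) y; have := metric_triangle (gx s) (gy s) y.
  by rewrite (metric_sym x (gx s)) e3 e4 -E (metric_sym x z); lra.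
have h1 := hinge_comparison_all zp zx hp hx gL1; have h2 := hinge_comparison_all zp zy hp hy gL2.
rewrite (ipC z x) (ipC z y).
have := ler_wpM2l (ltW y0) h1; have := ler_wpM2l (ltW x0) h2.
have : 0 <= (L1 + L2) * (d z p * d z x * d z y) by rewrite !mulr_ge0 ?(ltW p0) ?(ltW x0) ?(ltW y0).
by lra.
Qed.

Lemma global_mono x y z p : d x z + d z y = d x y -> d x y * ip x z p <= d x z * ip x y p.
Proof.
move=> E; have := global_stewart p E; rewrite /ip (metric_sym z x) -E.
by set a := d x z; set b := d z y; lra.
Qed.

(** Written with quotients, every term, including the square root, decreases when the points move
    along shortest paths towards [z]; close to [z] the local condition applies. *)
Lemma global_fourpt : fourpt [set: M].
Proof.
move=> z x y p _ _ _ _.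
have [|] := boolP [|| z == x, z == y, z == p, x == y, x == p | y == p].
  exact: fourpt_degenerate.
rewrite !negb_or => /and5P[zx zy zp _ _]; rewrite fourpt_ratio//.
have [gx hx] := geod z x; have [gy hy] := geod z y; have [gp hp] := geod z p.
have [r r0 fr] := fourpt_at radius z.
have x0 : 0 < d z x by rewrite mdist_gt0.
have y0 : 0 < d z y by rewrite mdist_gt0.
have p0 : 0 < d z p by rewrite mdist_gt0.
pose r1 := Num.min r (Num.min (d z x) (Num.min (d z y) (d z p))).
have r10 : 0 < r1 by rewrite !lt_min r0 x0 y0 p0.
have r1r : r1 <= r by rewrite ge_min lexx.
have r1x : r1 <= d z x by rewrite !ge_min lexx !orbT.
have r1y : r1 <= d z y by rewrite !ge_min lexx !orbT.
have r1p : r1 <= d z p by rewrite !ge_min lexx !orbT.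
clearbody r1; pose s := r1 / 2; have s0 : 0 < s by rewrite divr_gt0.
have sr : s < r by rewrite /s; lra.
have sx : s <= d z x by rewrite /s; lra.
have sy : s <= d z y by rewrite /s; lra.
have sp : s <= d z p by rewrite /s; lra.
clearbody s.
have ex := shortest_path_start hx (ltW s0) sx; have ey := shortest_path_start hy (ltW s0) sy.
have ep := shortest_path_start hp (ltW s0) sp.
have mono a b ga gb : 0 < d z a -> 0 < d z b -> s <= d z a -> s <= d z b ->
  shortest_path z a ga -> shortest_path z b gb ->
  ip z (ga s) (gb s) / (s * s) <= ip z a b / (d z a * d z b).
  move=> a0 b0 sa sb ha hb.
  have ea := shortest_path_start ha (ltW s0) sa; have ea' := shortest_path_end ha (ltW s0) sa.
  have eb := shortest_path_start hb (ltW s0) sb; have eb' := shortest_path_end hb (ltW s0) sb.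
  have m1 := @global_mono z a (ga s) (gb s); rewrite ea ea' subrKC in m1.
  have m2 := @global_mono z b (gb s) a; rewrite eb eb' subrKC in m2.
  rewrite ler_pdivrMr ?mulr_gt0// mulrAC ler_pdivlMr ?mulr_gt0//.
  have := ler_wpM2r (ltW b0) (m1 erefl); rewrite ipC (ipC z a b).
  have := ler_wpM2l (ltW s0) (m2 erefl); rewrite (ipC z _ a); rewrite (ipC z (gb s) (ga s)).
  by lra.
have zs w : d z w = s -> z != w by move=> e; rewrite -mdist_gt0 e.
have := fr z (gx s) (gy s) (gp s); rewrite fourpt_ratio ?zs// ex ey ep.
have b0 w : d z w = s -> ball z r w by move=> e; apply/ballP; rewrite e.
move=> /(_ (ltac:(by apply/ballP; rewrite mdistxx)) (b0 _ ex) (b0 _ ey) (b0 _ ep)).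
have m1 := mono x p gx gp x0 p0 sx sp hx hp; have m2 := mono y p gy gp y0 p0 sy sp hy hp.
have m3 := mono x y gx gy x0 y0 sx sy hx hy.
have : Num.sqrt (2 * (1 + ip z (gx s) (gy s) / (s * s))) <=
       Num.sqrt (2 * (1 + ip z x y / (d z x * d z y))).
  by apply: ler_wsqrtr; rewrite ler_pM2l// lerD2l.
by move: m1 m2; lra.
Qed.

End globalization_step.

(** * Volume growth *)

Section volume.
Context {R : realType} {M : metricType R}.
Implicit Types x y z p w : M.
Local Notation d x y := (@mdist R M x y : R).

(** The balls of radius [e] around a maximal spaced family cover [A] and have diameter at most
    [2 * e], whence the power of 2. *)
Lemma hausdorff_le_packingR (A : set M) (a B : R) : 0 < a -> 0 <= B ->
  (forall e0 : R, 0 < e0 -> exists2 e : R, 0 < e <= e0 &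
     forall s, (forall x, x \in s -> A x) -> spaced e s -> (size s)%:R <= B / e `^ a) ->
  (unnormalized_hausdorff a A <= (2 `^ a * B)%:E)%E.
Proof.
move=> a0 B0 hB; apply: unnormalized_hausdorff_le => delta delta0.
have [e /andP[e0 ed] he] := hB (delta / 2) (divr_gt0 delta0 (ltr0n R 2)).
have [|s [sep sA sN]] := @maximal_spaced R M A e (Num.truncn (B / e `^ a)) e0.
  move=> s sA sep; rewrite -ltnS -(ltr_nat R).
  exact: le_lt_trans (he s sA sep) (truncnS_gt _).
have e20 : 0 <= 2 * e by rewrite mulr_ge0// ltW.
have [|i iN|W' [W1 W2 W3]] := @hausdorff_finite_cover R M a A (size s) (2 * e)
    (fun i => if s is x0 :: _ then ball (nth x0 s i) e else set0) a0 e20.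
- move=> x Ax; have [y ys xy] := sN x Ax; exists (index y s); first by rewrite index_mem.
  case: s ys {sep sA sN} => // x0 s ys.
  by apply/ballP; rewrite nth_index// metric_sym.
- case: s {sep sA sN} iN => // x0 s _; apply: diam_le => x y /ballP hx /ballP hy.
  rewrite lee_fin; have := metric_triangle x (nth x0 (x0 :: s) i) y.
  by rewrite (metric_sym x (nth _ _ _)); lra.
- exists W'; split => // [i|].
    by apply: (le_trans (W2 i)); rewrite lee_fin; lra.
  apply: (le_trans W3); rewrite lee_fin powRM ?(ltW e0)// mulrCA ler_pM2l ?powR_gt0//.
  by rewrite -ler_pdivlMr ?powR_gt0//; exact: he.
Qed.

Lemma hausdorff_le_packing (A : set M) (n : nat) (B : R) : (0 < n)%N -> 0 <= B ->
  (forall e0 : R, 0 < e0 -> exists2 e : R, 0 < e <= e0 &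
     forall s, (forall x, x \in s -> A x) -> spaced e s -> (size s)%:R <= B / e ^+ n) ->
  (unnormalized_hausdorff n%:R A <= (2 ^+ n * B)%:E)%E.
Proof.
move=> n0 B0 hB; rewrite -powR_mulrn//; apply: hausdorff_le_packingR; rewrite ?ltr0n//.
move=> e0 /hB[e /andP[ep ee] he]; exists e; first by rewrite ep.
by move=> s sA sep; rewrite powR_mulrn ?(ltW ep)//; exact: he.
Qed.

Hypothesis geod : forall p q, exists g, shortest_path p q g.
Hypothesis mono : forall x y z p, d x z + d z y = d x y -> d x y * ip x z p <= d x z * ip x y p.

(** Applying [mono] to both points in turn shows that [ip p (f x) (f y)] is at most
    [c ^+ 2 * ip p x y], while the distances from [p] scale exactly; the law of cosines gives the
    expansion bound. *)
Lemma homothety_exists p (c : R) : 0 <= c <= 1 -> exists f : M -> M,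
  (forall x, [/\ d p (f x) = c * d p x, d p (f x) + d (f x) x = d p x,
     forall y, ip p (f x) y <= c * ip p x y &
     exists2 g, shortest_path p x g & f x = g (c * d p x)]) /\
  forall x y, c * d x y <= d (f x) (f y).
Proof.
move=> /andP[c0 c1].
have ex x : exists y, [/\ d p y = c * d p x, d p y + d y x = d p x &
    exists2 g, shortest_path p x g & y = g (c * d p x)].
  have [g hg] := geod p x; exists (g (c * d p x)).
  have cd0 : 0 <= c * d p x by rewrite mulr_ge0 ?mdist_ge0.
  have cd1 : c * d p x <= d p x by rewrite ler_piMl ?mdist_ge0.
  rewrite (shortest_path_start hg cd0 cd1) (shortest_path_end hg cd0 cd1) subrKC.
  by split => //; exists g.
pose f x := sval (cid (ex x)).
have fP x : [/\ d p (f x) = c * d p x, d p (f x) + d (f x) x = d p x &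
  exists2 g, shortest_path p x g & f x = g (c * d p x)] by exact: svalP (cid (ex x)).
clearbody f.
have fip x y : ip p (f x) y <= c * ip p x y.
  have [e1 e2 _] := fP x; have [<-|px] := eqVneq p x.
    have : f p = p by apply: mdist_positivity; move: (fP p) => [+ _ _]; rewrite mdistxx mulr0 metric_sym.
    by move=> ->; rewrite !ip0l mulr0.
  have := mono y e2; rewrite e1 (mulrC c) -mulrA ler_pM2l ?mdist_gt0//.
exists f; split; first by move=> x; have [] := fP x.
move=> x y; have [e1 _ _] := fP x; have [e2 _ _] := fP y.
rewrite -(@ler_pXn2r _ 2) ?nnegrE ?mulr_ge0 ?mdist_ge0//.
rewrite (sqr_mdist_ip p (f x)) e1 e2 !exprMn (sqr_mdist_ip p x).
have h1 := fip x (f y); have h2 := ler_wpM2l c0 (fip y x).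
rewrite (ipC p x) in h1; rewrite (ipC p y x) in h2.
by lra.
Qed.

Lemma bishop_gromov p (n : nat) (r r' : R) : 0 < r -> r <= r' ->
  (unnormalized_hausdorff n%:R (ball p r') <=
   ((r' / r) ^+ n)%:E * unnormalized_hausdorff n%:R (ball p r))%E.
Proof.
move=> r0 rr; have r'0 : 0 < r' by exact: lt_le_trans rr.
have c01 : 0 <= r / r' <= 1 by rewrite divr_ge0 ?(ltW r0) ?(ltW r'0)//= ler_pdivrMr// mul1r.
have [f [f1 f2]] := homothety_exists p c01.
have c0 : 0 < r / r' by rewrite divr_gt0.
have -> : ((r' / r) ^+ n)%R = (r / r') `^ (- n%:R).
  by rewrite powRN powR_mulrn ?(ltW c0)// -exprVn invf_div.
apply: (hausdorff_expanding (f := f)) => // x /ballP px; apply/ballP.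
by have [-> _ _ _] := f1 x; rewrite mulrAC ltr_pdivrMr// ltr_pM2l.
Qed.

Variable n : nat.
Hypothesis n0 : (0 < n)%N.
Variable C : R.
Hypothesis C0 : 0 < C.
Hypothesis packing : forall p (rho alpha : R) (s : seq M), 0 < rho -> 0 < alpha <= 1 ->
  (forall x, x \in s -> d p x < rho) -> spaced (alpha * rho) s ->
  (size s)%:R <= (C / alpha) ^+ n.

Lemma ball_hausdorff_le p (r : R) : 0 < r ->
  (unnormalized_hausdorff n%:R (ball p r) <= ((2 * C) ^+ n * r ^+ n)%:E)%E.
Proof.
move=> r0; rewrite (_ : (2 * C) ^+ n * r ^+ n = 2 ^+ n * (C * r) ^+ n); last by rewrite !exprMn mulrA.
apply: hausdorff_le_packing => //; first by rewrite exprn_ge0// mulr_ge0// ltW.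
move=> e0 e00; pose al := Num.min 1 (e0 / r).
have al0 : 0 < al by rewrite lt_min ltr01 divr_gt0.
have al1 : al <= 1 by rewrite ge_min lexx.
exists (al * r).
  by rewrite mulr_gt0//= -ler_pdivlMr// ge_min lexx orbT.
move=> s sA sep; have := packing r0 (ltac:(by rewrite al0) : 0 < al <= 1) (fun x xs => (ballP _ _ _).1 (sA x xs)) sep.
move=> /le_trans; apply; rewrite -expr_div_n le_eqVlt; apply/orP; left; apply/eqP.
by congr (_ ^+ n); field; rewrite !gt_eqF.
Qed.

Let om : R := unit_ball_volume R n / 2 ^+ n.

Lemma unit_ball_volume_gt0 m : 0 < unit_ball_volume R m.
Proof.
suff : 0 < unit_ball_volume R m /\ 0 < unit_ball_volume R m.+1 by case.
elim: m => [|m [IH1 IH2]] /=; first by split; rewrite ?ltr01.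
by split => //; rewrite mulr_gt0// divr_gt0// mulr_gt0// pi_gt0.
Qed.

Let om0 : 0 < om.
Proof. by rewrite divr_gt0 ?unit_ball_volume_gt0// exprn_gt0. Qed.

Let phi p (r : R) : R := om * fine (unnormalized_hausdorff n%:R (ball p r)) / r ^+ n.

Let uhE p (r : R) : 0 < r -> unnormalized_hausdorff n%:R (ball p r) =
  (fine (unnormalized_hausdorff n%:R (ball p r)))%:E.
Proof.
move=> r0; rewrite fineK// ge0_fin_numE ?unnormalized_hausdorff_ge0//.
by apply: le_lt_trans (ball_hausdorff_le p r0) _; rewrite ltry.
Qed.

Let phi_mono p (r r' : R) : 0 < r -> r <= r' -> phi p r' <= phi p r.
Proof.
move=> r0 rr; have r'0 : 0 < r' by exact: lt_le_trans rr.
have := bishop_gromov p n r0 rr; rewrite uhE// (uhE p r0) -EFinM lee_fin => h.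
rewrite /phi ler_pdivrMr ?exprn_gt0//; set u' := fine _ in h *; set u := fine _ in h *.
have -> : om * u / r ^+ n * r' ^+ n = om * ((r' / r) ^+ n * u).
  by rewrite expr_div_n; field; rewrite expf_neq0// gt_eqF.
by rewrite ler_pM2l.
Qed.

Let phi_ge0 p (r : R) : 0 < r -> 0 <= phi p r.
Proof.
move=> r0; apply: divr_ge0; last by rewrite exprn_ge0// ltW.
apply: mulr_ge0; first exact: (ltW om0).
by apply: fine_ge0; exact: unnormalized_hausdorff_ge0.
Qed.

(** By [phi_mono] the limit is an infimum. So a lower bound passes to it when it holds at all radii,
    and an upper bound as soon as it holds at one. *)
Lemma volume_growth_spec p : 
  [/\ 0 <= volume_growth_rate n p,
   forall b : R, (forall r : R, 0 < r -> ((b * r ^+ n)%:E <= unnormalized_hausdorff n%:R (ball p r))%E) ->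
     om * b <= volume_growth_rate n p &
   forall b r0 : R, (forall r : R, r0 < r -> (unnormalized_hausdorff n%:R (ball p r) <= (b * r ^+ n)%:E)%E) ->
     volume_growth_rate n p <= om * b].
Proof.
pose E := [set v | exists2 r : R, 0 < r & v = phi p r].
have hE : has_inf E.
  split; first by exists (phi p 1), 1.
  by exists 0 => _ [r r0 ->]; exact: phi_ge0.
have vE : volume_growth_rate n p = inf E.
  rewrite /volume_growth_rate.
  suff -> : lim (hausdorff_measure n (ball p r) * ((r ^+ n)^-1)%:E @[r --> +oo%R])%E = (inf E)%:E by [].
  apply: cvg_lim => //.
  have c : phi p r @[r --> +oo%R] --> inf E.
    apply/cvgrPdist_le => /= e e0.
    have [_ [r r0 ->] hr] := inf_adherent e0 hE.
    near=> t.
    have rt : r <= t by near: t; exact: nbhs_pinfty_ge (num_real r).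
    have t0 : 0 < t by exact: lt_le_trans rt.
    have h1 : inf E <= phi p t by apply: (ge_inf hE.2); exists t.
    have h2 := phi_mono p r0 rt.
    by rewrite ler_norml; apply/andP; split; lra.
  have c' : (phi p r)%:E @[r --> +oo%R] --> (inf E)%:E by apply: cvg_EFin => //; near=> t.
  apply: cvg_trans c'; apply: near_eq_cvg.
  near=> t; have t0 : 0 < t by near: t; exact: nbhs_pinfty_gt (num_real 0).
  by rewrite /phi /hausdorff_measure (uhE p t0) -!EFinM.
rewrite vE; split.
- by apply: lb_le_inf; [exact: hE.1|move=> _ [r r0 ->]; exact: phi_ge0].
- move=> b hb; apply: lb_le_inf; first exact: hE.1.
  move=> _ [r r0 ->]; have := hb r r0; rewrite uhE// lee_fin => h.
  by rewrite /phi ler_pdivlMr ?exprn_gt0// -mulrA ler_pM2l.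
- move=> b r0 hb; pose r := Num.max 1 (r0 + 1).
  have r00 : r0 < r by rewrite lt_max ltrDl ltr01 orbT.
  have r10 : 0 < r by rewrite lt_max ltr01.
  apply: le_trans (_ : phi p r <= _); first by apply: (ge_inf hE.2); exists r.
  have := hb r r00; rewrite uhE// lee_fin => h.
  by rewrite /phi ler_pdivrMr ?exprn_gt0// -[leRHS]mulrA ler_pM2l.
Unshelve. all: by end_near. Qed.

End volume.

(** * Angles *)

Section angles.
Context {R : realType} {M : metricType R}.
Implicit Types x y z p q w o : M.
Implicit Types (g h : R -> M).
Local Notation d x y := (@mdist R M x y : R).

Lemma sin_le (x : R) : 0 <= x -> sin x <= x.
Proof.
move=> x0; have [|c cx] := @MVT_segment R (@sin R) (@cos R) 0 x x0 (fun t _ => is_derive_sin t).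
  exact/continuous_subspaceT/continuous_sin.
rewrite sin0 !subr0 => ->; rewrite ler_piMl// cos_le1.
Qed.

Lemma cos_pihalfD (x : R) : cos (pi / 2 + x) = - sin x.
Proof. by rewrite addrC cosDpihalf. Qed.

Hypothesis fT : fourpt [set: M].
Hypothesis geod : forall p q, exists g, shortest_path p q g.

Lemma comparison_path p q x g h (s t : R) : shortest_path p q g -> shortest_path p x h ->
  0 < s <= d p q -> 0 < t <= d p x ->
  comparison_angle p (g s) (h t) = acos (ip p (g s) (h t) / (s * t)) /\
  -1 <= ip p (g s) (h t) / (s * t) <= 1.
Proof.
move=> hg hh /andP[s0 sq] /andP[t0 tx].
have eg := shortest_path_start hg (ltW s0) sq; have eh := shortest_path_start hh (ltW t0) tx.
have ng : p != g s by rewrite -mdist_gt0 eg.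
have nh : p != h t by rewrite -mdist_gt0 eh.
by have := comparison_cos ng nh; rewrite comparison_angleE// eg eh.
Qed.

Lemma comparison_angle_mono p q x g h (s s' t t' : R) :
  shortest_path p q g -> shortest_path p x h ->
  0 < s' -> s' <= s -> s <= d p q -> 0 < t' -> t' <= t -> t <= d p x ->
  comparison_angle p (g s) (h t) <= comparison_angle p (g s') (h t').
Proof.
move=> hg hh s0 ss sq t0 tt tx.
have [|| -> c1] := comparison_path hg hh (s := s) (t := t).
- by rewrite sq (lt_le_trans s0).
- by rewrite tx (lt_le_trans t0).
have [|| -> c2] := comparison_path hg hh (s := s') (t := t').
- by rewrite s0 (le_trans ss).
- by rewrite t0 (le_trans tt).
rewrite acos_le//; pose r := s + t + 1.
have fr : fourpt (ball p r) by exact: fourptS fT.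
apply: (fourpt_path_mono2 fr hg hh) => //; rewrite /r; lra.
Qed.

(** Comparison angles increase towards [p], so the limit in [path_angle] exists and is their
    supremum. *)
Lemma path_angle_spec p q x g h : p != q -> p != x ->
  shortest_path p q g -> shortest_path p x h ->
  [/\ 0 <= path_angle p g h <= pi,
   forall s t, 0 < s <= d p q -> 0 < t <= d p x ->
     comparison_angle p (g s) (h t) <= path_angle p g h &
   forall e : R, 0 < e -> exists2 rho : R, 0 < rho & forall s t, 0 < s < rho -> 0 < t < rho ->
     path_angle p g h - e < comparison_angle p (g s) (h t)].
Proof.
rewrite -!mdist_gt0 => pq px hg hh.
pose E := [set v | exists s t, [/\ 0 < s <= d p q, 0 < t <= d p x &
   v = comparison_angle p (g s) (h t)]].
have b s t : 0 < s <= d p q -> 0 < t <= d p x -> 0 <= comparison_angle p (g s) (h t) <= pi.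
  by move=> hs ht; have [-> c] := comparison_path hg hh hs ht; rewrite acos_ge0 ?acos_lepi.
have pqq : 0 < d p q <= d p q by rewrite pq lexx.
have pxx : 0 < d p x <= d p x by rewrite px lexx.
have hE : has_sup E.
  split; first by exists (comparison_angle p (g (d p q)) (h (d p x))), (d p q), (d p x).
  by exists pi => _ [s [t [hs ht ->]]]; have /andP[] := b s t hs ht.
have ub s t : 0 < s <= d p q -> 0 < t <= d p x -> comparison_angle p (g s) (h t) <= sup E.
  by move=> hs ht; apply: (ub_le_sup hE.2); exists s, t.
have close (e : R) : 0 < e -> exists2 rho : R, 0 < rho & forall s t, 0 < s < rho -> 0 < t < rho ->
    sup E - e < comparison_angle p (g s) (h t) <= sup E.
  move=> e0; have [_ [s [t [/andP[s0 sq] /andP[t0 tx] ->]]] hst] := sup_adherent e0 hE.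
  exists (Num.min s t); first by rewrite lt_min s0.
  move=> s' t'; rewrite !lt_min => /and3P[s'0 ss _] /and3P[t'0 _ tt].
  rewrite ub ?s'0 ?t'0 ?(le_trans (ltW ss)) ?(le_trans (ltW tt))// andbT.
  apply: lt_le_trans hst _.
  by apply: (comparison_angle_mono hg hh) => //; exact: ltW.
have -> : path_angle p g h = sup E.
  rewrite /path_angle; apply: cvg_lim => //; apply/cvgrPdist_lt => e e0.
  have [rho rho0 hr] := close e e0.
  exists ([set s | 0 < s < rho], [set t | 0 < t < rho]).
    split => /=.
      near=> s; apply/andP; split; near: s; first exact: nbhs_right_gt.
      exact: nbhs_right_lt.
    near=> s; apply/andP; split; near: s; first exact: nbhs_right_gt.
    exact: nbhs_right_lt.
  move=> [s t] /= [hs ht]; have /andP[h1 h2] := hr s t hs ht.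
  by rewrite ger0_norm ?subr_ge0// ltrBlDr -ltrBlDl.
split => //.
- apply/andP; split.
    by apply: le_trans (ub _ _ pqq pxx); have /andP[] := b _ _ pqq pxx.
  by apply: ge_sup; [exact: hE.1|move=> _ [s [t [hs ht ->]]]; have /andP[] := b s t hs ht].
- move=> e e0; have [rho rho0 hr] := close e e0; exists rho => // s t hs ht.
  by have /andP[] := hr s t hs ht.
Unshelve. all: by end_near. Qed.

Lemma path_angle_refl p q g : p != q -> shortest_path p q g -> path_angle p g g = 0.
Proof.
move=> pq hg; have [/andP[a0 _] _ a2] := path_angle_spec pq pq hg hg.
apply/eqP; rewrite eq_le a0 andbT; apply/ler_addgt0Pl => e e0; rewrite addr0.
have [rho rho0 hr] := a2 e e0.
have pq0 : 0 < d p q by rewrite mdist_gt0.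
pose s := Num.min rho (d p q) / 2.
have m0 : 0 < Num.min rho (d p q) by rewrite lt_min rho0.
have m1 : Num.min rho (d p q) <= rho by rewrite ge_min lexx.
have m2 : Num.min rho (d p q) <= d p q by rewrite ge_min lexx orbT.
have s0 : 0 < s by rewrite divr_gt0.
have sr : 0 < s < rho by rewrite s0 /= /s; lra.
have sq : 0 < s <= d p q by rewrite s0 /= /s; lra.
have := hr s s sr sr; have [-> _] := comparison_path hg hg sq sq.
have -> : ip p (g s) (g s) / (s * s) = 1.
  rewrite ipxx (shortest_path_start hg (ltW s0)) ?(andP sq).2// expr2 divff//.
  by rewrite mulf_neq0// gt_eqF.
by rewrite acos1; lra.
Qed.

(** A constant sequence is Cauchy because a path makes angle 0 with itself. *)
Lemma directions_toP p q (u : nat -> R -> M) : p != q ->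
  directions_to p q u <-> exists2 g, shortest_path p q g & u = fun=> g.
Proof.
move=> pq; split; first by case.
move=> [g hg ->]; split; last by exists g.
split; first by move=> _; exists q => //; rewrite eq_sym.
by move=> e e0; exists 0%N => j k _ _; rewrite (path_angle_refl pq hg).
Qed.

Lemma angle_cst p g h : angle p (fun=> g) (fun=> h) = path_angle p g h.
Proof. by rewrite /angle lim_cst. Qed.

Lemma angle_to_set_ub p q h (r : R) : p != q ->
  (angle_to_set p (directions_to p q) (fun=> h) < r%:E)%E ->
  exists2 g, shortest_path p q g & path_angle p g h < r.
Proof.
move=> pq /ereal_inf_lt[_ [u /(directions_toP _ pq)[g hg ->] <-]].
by rewrite angle_cst lte_fin => hr; exists g.
Qed.

Lemma angle_to_set_lb p q h (r : R) : p != q ->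
  (r%:E < angle_to_set p (directions_to p q) (fun=> h))%E ->
  forall g, shortest_path p q g -> r < path_angle p g h.
Proof.
move=> pq hr g hg; rewrite -lte_fin; apply: lt_le_trans hr _.
apply: ereal_inf_lbound; exists (fun=> g); last by rewrite angle_cst.
by apply/directions_toP => //; exists g.
Qed.

Lemma ob_pair_lt p q (eta : R) : p != q -> (ob_infty_pair p q < eta%:E)%E ->
  exists o (r : R), forall x, p != x -> q != x -> r <= d o x ->
    forall g k, shortest_path p x g -> shortest_path q x k ->
    (exists2 h, shortest_path p q h & path_angle p h g < pi / 2 + eta) /\
    (exists2 h, shortest_path q p h & path_angle q h k < pi / 2 + eta).
Proof.
move=> pq; rewrite /ob_infty_pair lteBlDr// -EFinD addrC limf_esupE.
move=> /ereal_inf_lt[_ [A [c [r cA]] <-] Aeta]; exists c, r => x px qx ox g k hg hk.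
have Ax : A x by apply: cA => /ballP; rewrite ltNge ox.
have qp : q != p by rewrite eq_sym.
have : (maxe (angle_to_set p (directions_to p q) (fun=> g))
             (angle_to_set q (directions_to q p) (fun=> k)) < (pi / 2 + eta)%:E)%E.
  apply: le_lt_trans Aeta; apply: le_ereal_sup_tmp.
  exists (ereal_sup [set maxe (angle_to_set p (directions_to p q) xi)
                          (angle_to_set q (directions_to q p) zeta)
                | xi in directions_to p x & zeta in directions_to q x]).
    by exists x.
  apply: ereal_sup_ubound; exists (fun=> g); first by apply/directions_toP => //; exists g.
  by exists (fun=> k) => //; apply/directions_toP => //; exists k.
by rewrite gt_max => /andP[/(angle_to_set_ub pq) h1 /(angle_to_set_ub qp) h2].
Qed.

(** The distance to a set of directions is an infimum, so the bound holds for every [h]; the maximum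
    leaves open at which end it does. *)
Lemma ob_pair_gt p q (eta : R) : p != q -> (eta%:E < ob_infty_pair p q)%E ->
  forall o (r : R), 0 <= r -> d o p < r -> d o q < r -> exists x, r <= d o x /\
    ((exists2 g, shortest_path p x g &
      forall h, shortest_path p q h -> pi / 2 + eta < path_angle p h g) \/
     (exists2 k, shortest_path q x k &
      forall h, shortest_path q p h -> pi / 2 + eta < path_angle q h k)).
Proof.
move=> pq; rewrite /ob_infty_pair lteBrDr// -EFinD addrC limf_esupE => hob o r r0 op oq.
have : ((pi / 2 + eta)%:E < ereal_sup ((fun x : M => ereal_sup [set maxe (angle_to_set p (directions_to p q) xi)
                          (angle_to_set q (directions_to q p) zeta)
                | xi in directions_to p x & zeta in directions_to q x]) @` (~` ball o r)))%E.
  apply: lt_le_trans hob _; apply: ereal_inf_lbound; exists (~` ball o r) => //.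
  by exists o, r.
move=> /ereal_sup_gt[_ [x ox <-] /ereal_sup_gt[_ [xi hxi [zeta hzeta <-]]]].
have {}ox : r <= d o x by rewrite leNgt; apply/negP => /ballP.
have px : p != x by apply/eqP => e; move: ox; rewrite -e leNgt op.
have qx : q != x by apply/eqP => e; move: ox; rewrite -e leNgt oq.
have qp : q != p by rewrite eq_sym.
have [g hg e1] := (directions_toP _ px).1 hxi; have [k hk e2] := (directions_toP _ qx).1 hzeta.
rewrite e1 e2 lt_max => /orP[h1|h1]; exists x; split => //; [left|right].
  by exists g => //; exact: angle_to_set_lb.
by exists k => //; exact: angle_to_set_lb.
Qed.

Lemma ob_pair_le p q : p != q -> (ob_infty_pair p q <= (pi / 2)%:E)%E.
Proof.
move=> pq; have pi0 := pi_gt0 R; have e0 : 0 < pi / 2 :> R by rewrite divr_gt0.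
rewrite leNgt; apply/negP => h.
pose r := d p q + 1; have r0 : 0 <= r by rewrite addr_ge0 ?mdist_ge0.
have [||x [px]] := ob_pair_gt pq h (o := p) r0; rewrite /r ?mdistxx ?ltrDl//.
  by rewrite ltr_wpDl ?mdist_ge0.
have qp : q != p by rewrite eq_sym.
have pq0 : 0 <= d p q by exact: mdist_ge0.
have {}px : d p q + 1 <= d p x by [].
have px0 : p != x by rewrite -mdist_gt0; lra.
have qx0 : q != x by rewrite -mdist_gt0; have := metric_triangle p q x; lra.
have two : pi / 2 + pi / 2 = pi :> R by field.
case=> [[g hg H]|[k hk H]].
  have [h' hh] := geod p q; have := H _ hh; rewrite two.
  by have [/andP[_ a] _ _] := path_angle_spec pq px0 hh hg; rewrite ltNge a.
have [h' hh] := geod q p; have := H _ hh; rewrite two.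
by have [/andP[_ a] _ _] := path_angle_spec qp qx0 hh hk; rewrite ltNge a.
Qed.

Lemma ob_infty_lt (eta : R) : (ob_infty M < eta%:E)%E ->
  forall e : R, 0 < e -> exists p q, [/\ p != q, d p q < e & (ob_infty_pair p q < eta%:E)%E].
Proof.
rewrite /ob_infty limf_einfE => h e e0.
have : (ereal_inf ((fun pq : M * M => ob_infty_pair pq.1 pq.2) @`
   [set pq | pq.1 != pq.2 /\ (d pq.1 pq.2 < e)%R]) < eta%:E)%E.
  apply: le_lt_trans h; apply: ereal_sup_ubound.
  by exists [set pq | pq.1 != pq.2 /\ (d pq.1 pq.2 < e)%R] => //; exists e.
by move=> /ereal_inf_lt[_ [[p q] [/= pq pqe] <-] h']; exists p, q.
Qed.

Lemma ob_infty_gt (eta : R) : (eta%:E < ob_infty M)%E ->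
  exists2 e : R, 0 < e & forall p q, p != q -> d p q < e -> (eta%:E < ob_infty_pair p q)%E.
Proof.
rewrite /ob_infty limf_einfE => /ereal_sup_gt[_ [A [e e0 eA] <-] h]; exists e => // p q pq pqe.
apply: lt_le_trans h _; apply: ereal_inf_lbound; exists (p, q) => //; exact: eA.
Qed.

End angles.

(** * Volume growth bounded by the obtuse constant *)

Section spaced_sets.
Context {R : realType} {M : metricType R}.
Implicit Types x y z p q w : M.
Local Notation d x y := (@mdist R M x y : R).

Lemma spaced_filter (e : R) (P : pred M) (s : seq M) : spaced e s -> spaced e [seq x <- s | P x].
Proof. exact: subseq_pairwise (filter_subseq P s). Qed.

Lemma size_covered (T s : seq M) (B : M -> M -> bool) (K : nat) :
  (forall x, x \in s -> exists2 t, t \in T & B t x) ->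
  (forall t, t \in T -> (size [seq x <- s | B t x] <= K)%N) -> (size s <= size T * K)%N.
Proof.
move=> cov hK; apply: leq_trans (_ : \sum_(t <- T) size [seq x <- s | B t x] <= _)%N; last first.
  rewrite -sum1_size big_distrl/= big_seq_cond [leqRHS]big_seq_cond.
  by apply: leq_sum => t /andP[tT _]; rewrite mul1n; exact: hK.
elim: s cov {hK} => [//|x s IH] cov.
have [t tT Bt] := cov x (mem_head _ _).
apply: leq_trans (_ : \sum_(t <- T) (B t x + size [seq x <- s | B t x]) <= _)%N; last first.
  by apply: leq_sum => u _ /=; case: (B u x).
rewrite big_split/= -addn1 addnC leq_add//.
  by rewrite (big_rem t tT)/= Bt.
by apply: IH => y ys; apply: cov; rewrite inE ys orbT.
Qed.

Lemma spaced_slides (e : R) (Y : seq M) (F : nat -> M -> M) (m : nat) :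
  (forall l, (l < m)%N -> spaced e (map (F l) Y)) ->
  (forall l l' y y', (l < l')%N -> (l' < m)%N -> y \in Y -> y' \in Y -> e <= d (F l y) (F l' y')) ->
  exists Z : seq M, [/\ size Z = (m * size Y)%N, spaced e Z &
    forall z, z \in Z -> exists l y, [/\ (l < m)%N, y \in Y & z = F l y]].
Proof.
elim: m => [|m IH] h1 h2; first by exists [::].
have [||Z [Zs Zsp ZF]] := IH.
- by move=> l lm; apply: h1; exact: ltnW.
- by move=> l l' y y' ll lm; apply: h2 => //; exact: ltnW.
exists (Z ++ map (F m) Y); split.
- by rewrite size_cat Zs size_map mulSn addnC.
- rewrite /spaced pairwise_cat -/(spaced e Z) Zsp -/(spaced e _) h1// !andbT.
  apply/allrelP => z w /ZF[l [y [lm yY ->]]] /mapP[y' y'Y ->]; exact: h2.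
- move=> z; rewrite mem_cat => /orP[/ZF[l [y [lm yY ->]]]|/mapP[y yY ->]].
    by exists l, y; rewrite ltnS ltnW.
  by exists m, y.
Qed.

End spaced_sets.

(** The thickness of the slab by the law of cosines: [L] is the distance pq, [y] and [a] are the
    distances of a point of the slab from p and q, and [t] is its product [ip] with q at p. *)
Lemma band_estimate (R : realFieldType) (eta L y t a : R) : 0 < eta <= 1 / 24 -> 0 < L -> 0 <= y <= eta * L ->
  - eta * (L * y) <= t <= 2 * eta * L * y -> 0 <= a -> a ^+ 2 = L ^+ 2 + y ^+ 2 - t *+ 2 ->
  `|a - L| <= 3 * eta * (eta * L).
Proof.
move=> /andP[eta0 eta1] L0 /andP[y0 yr] /andP[t1 t2] a0 E.
set r := eta * L in yr *; have r0 : 0 < r by rewrite mulr_gt0.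
have yr2 : y ^+ 2 <= r ^+ 2 by rewrite lerXn2r ?nnegrE// ltW.
have Ly : eta * L * y <= eta * L * r by rewrite ler_pM2l.
have rr2 : r ^+ 2 = eta * L * r by rewrite expr2.
have rr0 : 0 < eta * L * r by rewrite mulr_gt0.
have er0 : 0 < eta * r by rewrite mulr_gt0.
have rL : r <= L / 24 by rewrite /r mulrC ler_pM2l//; lra.
have erL : 3 * eta * r <= L / 100.
  have : eta * r <= (1 / 24) * r by rewrite ler_pM2r.
  by move: rL L0; clear; lra.
have up : a ^+ 2 <= (L + 3 * eta * r) ^+ 2.
  have := sqr_ge0 (3 * eta * r); move: E t1 Ly yr2 rr0; rewrite rr2; clear; lra.
have lo : (L - 3 * eta * r) ^+ 2 <= a ^+ 2.
  have : (3 * eta * r) ^+ 2 <= (3 * eta * r) * (L / 100).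
    by rewrite expr2 ler_wpM2l//; move: er0; clear; lra.
  have := sqr_ge0 y; move: E t2 Ly rr0; clear; lra.
rewrite ler_norml; apply/andP; split.
  have : L - 3 * eta * r <= a.
    by rewrite -(@ler_pXn2r _ 2) ?nnegrE//; move: erL L0; clear; lra.
  by clear; lra.
have : a <= L + 3 * eta * r.
  by rewrite -(@ler_pXn2r _ 2) ?nnegrE//; move: er0 L0; clear; lra.
by clear; lra.
Qed.

(** The angle at q bounds the product at p only up to the summand [L ^+ 2]. It becomes negligible
    after contraction, because the original point is far away. *)
Lemma contraction_estimate (R : realFieldType) (c L eta x u t : R) : 0 <= c -> 0 <= L ->
  0 <= eta <= 1 -> u <= L ^+ 2 + eta * (L * (L + x)) -> c * L <= eta * (c * x) / 2 ->
  t <= c * u -> t <= 2 * eta * L * (c * x).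
Proof.
move=> c0 L0 /andP[eta0 eta1] hu hc /le_trans; apply; apply: le_trans (ler_wpM2l c0 hu) _.
have := ler_wpM2l (mulr_ge0 (addr_ge0 ler01 eta0) L0) hc.
have : (1 + eta) * (L * (eta * (c * x) / 2)) <= 2 * (L * (eta * (c * x) / 2)).
  rewrite ler_wpM2r//; last by lra.
  by rewrite mulr_ge0// (le_trans _ hc)// mulr_ge0.
by clear; lra.
Qed.

(** The later slide goes about [24 * eta * (eta * L)] further, which exceeds the slab's thickness
    [6 * eta * (eta * L)]. *)
Lemma slide_estimate (R : realFieldType) (eta L a b y y' : R) : 0 <= eta <= 1 / 24 ->
  0 <= L -> 0 <= a -> b <= 2 * eta -> 24 * eta * eta <= b - a ->
  - (3 * eta * (eta * L)) <= y - L -> y' - L <= 3 * eta * (eta * L) ->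
  12 * eta * (eta * L) / 2 <= (1 - a) * y - (1 - b) * y'.
Proof.
move=> /andP[eta0 eta1] L0 a0 b1 ab hy hy'.
have ee0 : 0 <= eta * eta by rewrite mulr_ge0.
have w0 : 0 <= eta * (eta * L) by rewrite !mulr_ge0.
have h1 := ler_wpM2r L0 ab.
have h2 : (1 - a) * (L - 3 * eta * (eta * L)) <= (1 - a) * y by rewrite ler_wpM2l//; lra.
have h3 : (1 - b) * y' <= (1 - b) * (L + 3 * eta * (eta * L)) by rewrite ler_wpM2l//; lra.
have b0 : 0 <= b by lra.
have h4 := mulr_ge0 a0 w0; have h5 := mulr_ge0 b0 w0.
by move: h1 h2 h3 h4 h5 w0; clear; lra.
Qed.

Section volume_upper_bound.
Context {R : realType} {M : metricType R}.
Implicit Types x y z p q w o : M.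
Implicit Types (g h : R -> M).
Local Notation d x y := (@mdist R M x y : R).

Hypothesis fT : fourpt [set: M].
Hypothesis geod : forall p q, exists g, shortest_path p q g.
Hypothesis mono : forall x y z p, d x z + d z y = d x y -> d x y * ip x z p <= d x z * ip x y p.

Lemma ip_ge_of_path_angle p q x h g (eta t : R) : p != q -> p != x ->
  shortest_path p q h -> shortest_path p x g -> -1 <= eta <= 1 ->
  path_angle p h g < pi / 2 + eta -> 0 < t <= d p x ->
  - sin eta * (d p q * t) <= ip p q (g t).
Proof.
move=> pq px hh hg /andP[eta0 eta1] ang tx; have pi2 := pi_ge2 R.
have [_ a _] := path_angle_spec fT pq px hh hg.
have pq0 : 0 < d p q by rewrite mdist_gt0.
have qq : 0 < d p q <= d p q by rewrite pq0 lexx.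
have hq : h (d p q) = q by case: hh.
have := a (d p q) t qq tx; have [-> cb] := comparison_path hh hg qq tx.
rewrite hq in cb *; move=> /le_lt_trans/(_ ang).
have i : pi / 2 + eta \in `[0, pi] by rewrite in_itv/=; apply/andP; split; lra.
rewrite -{1}(cosK i) acos_lt ?cos_geN1 ?cos_le1//.
rewrite cos_pihalfD => /ltW; have /andP[t0 _] := tx.
by rewrite ler_pdivlMr ?mulr_gt0.
Qed.

(** If a pair saw all far [x] under angles smaller than pi / 2 by a fixed amount from both ends,
    [ip p q x] would be arbitrarily large and [ip q p x] nonnegative, but their sum is
    [d p q ^+ 2]. *)
Lemma ob_infty_ge0 : (forall o (r : R), exists x, r <= d o x) -> (0 <= ob_infty M)%E.
Proof.
move=> unb; rewrite leNgt; apply/negP => ob0.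
have [p [q [pq pq1 obpq]]] := ob_infty_lt ob0 ltr01.
have [eta [eta0 eta1 obeta]] : exists eta : R, [/\ eta < 0, -1 <= eta & (ob_infty_pair p q < eta%:E)%E].
  case: (ob_infty_pair p q) obpq => [r| |]//.
    rewrite lte_fin => r0; exists (Num.max (-1) (r / 2)); split.
    - by rewrite gt_max; lra.
    - by rewrite le_max lexx.
    - by rewrite lte_fin lt_max; apply/orP; right; lra.
  by move=> _; exists (-1); rewrite ltNyr; split => //; lra.
have [c [r hr]] := ob_pair_lt fT pq obeta.
have pi2 := pi_ge2 R; set sg := - sin eta.
have sg0 : 0 < sg by rewrite /sg -sinN; apply: sin_gt0_pi; lra.
have pq0 : 0 < d p q by rewrite mdist_gt0.
have [x cx] := unb c (Num.max r (d c p + d p q + d p q / sg + 1)).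
have rx : r <= d c x by apply: le_trans cx; rewrite le_max lexx.
have {}cx : d c p + d p q + d p q / sg + 1 <= d c x.
  by apply: le_trans cx; rewrite le_max lexx orbT.
have h0 : 0 < d p q / sg by rewrite divr_gt0.
have px0 : d p q / sg < d p x by have := metric_triangle c p x; lra.
have qx0 : 0 < d q x by have := metric_triangle p q x; have := metric_triangle c p x; lra.
have px : p != x by rewrite -mdist_gt0; lra.
have qx : q != x by rewrite -mdist_gt0.
have qp : q != p by rewrite eq_sym.
have [g hg] := geod p x; have [k hk] := geod q x.
have [[h1 hh1 a1] [h2 hh2 a2]] := hr x px qx rx g k hg hk.
have eb : -1 <= eta <= 1 by rewrite eta1; lra.
have xx : 0 < d p x <= d p x by rewrite mdist_gt0 px lexx.
have yy : 0 < d q x <= d q x by rewrite qx0 lexx.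
have := ip_ge_of_path_angle pq px hh1 hg eb a1 xx.
have := ip_ge_of_path_angle qp qx hh2 hk eb a2 yy.
have -> : g (d p x) = x by case: hg.
have -> : k (d q x) = x by case: hk.
rewrite -/sg (metric_sym q p) => i1 i2.
have : ip p q x + ip q p x = d p q ^+ 2 by rewrite /ip (metric_sym q p); field.
have : 0 <= sg * (d p q * d q x) by rewrite !mulr_ge0// ltW.
have : sg * (d p q / sg) * d p q < sg * d p x * d p q by rewrite ltr_pM2r// ltr_pM2l.
have -> : sg * (d p q / sg) = d p q by field; rewrite gt_eqF.
by move: i1 i2; lra.
Qed.

Variable n : nat.
Hypothesis n0 : (0 < n)%N.
Variable C : R.
Hypothesis C1 : 1 <= C.
Hypothesis packing : forall p (rho alpha : R) (s : seq M), 0 < rho -> 0 < alpha <= 1 ->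
  (forall x, x \in s -> d p x < rho) -> spaced (alpha * rho) s ->
  (size s)%:R <= (C / alpha) ^+ n.

(* Far away points lie, as seen from p, almost orthogonally to q; after
   contraction to a ball around p much smaller than d p q they form a thin slab,
   whose translates towards q are disjoint. *)
Lemma slab_packing p q (eta : R) (o : M) (r0 : R) : p != q -> 0 < eta <= 1 / 24 ->
  (forall x, p != x -> q != x -> r0 <= d o x ->
    forall g k, shortest_path p x g -> shortest_path q x k ->
    (exists2 h, shortest_path p q h & path_angle p h g < pi / 2 + eta) /\
    (exists2 h, shortest_path q p h & path_angle q h k < pi / 2 + eta)) ->
  exists r1 : R, forall (r' : R) (s : seq M), r1 < r' ->
    (forall x, x \in s -> d p x < r') -> spaced (12 * eta * r') s ->
    (forall x, x \in s -> 12 * eta * r' <= d p x) ->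
    (size s)%:R <= 24 * eta * (C / eta) ^+ n.
Proof.
move=> pq /andP[eta0 eta1] far; set L := d p q.
have L0 : 0 < L by rewrite mdist_gt0.
pose e := 12 * eta; have e0 : 0 < e by rewrite mulr_gt0.
have e12 : e <= 1 / 2 by rewrite /e; lra.
pose base := 1 + L + d o p + `|r0|.
have base1 : 1 <= base.
  by have := mdist_ge0 o p; have := normr_ge0 r0; rewrite /base; move: L0; lra.
(* For [r'] beyond this, points at distance at least [e * r'] from [p] satisfy the hypotheses on far
   points, and [L] is small against [eta] times that distance. *)
pose r1 := 2 * base / (eta * e) + 2 * L / (eta * e).
have ee0 : 0 < eta * e by rewrite mulr_gt0.
have ee1 : eta * e <= 1.
  have : eta * e <= 1 * 1 by apply: ler_pM; rewrite ?(ltW eta0) ?(ltW e0)//; lra.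
  by rewrite mulr1.
exists r1 => r' s rr sr sep sfar.
have q10 : 0 < 2 * base / (eta * e) by rewrite divr_gt0 ?mulr_gt0//; lra.
have q20 : 0 < 2 * L / (eta * e) by rewrite divr_gt0 ?mulr_gt0.
have r'0 : 0 < r' by rewrite /r1 in rr; lra.
have rb : 2 * base < eta * e * r'.
  by rewrite [ltRHS]mulrC -ltr_pdivrMr// (le_lt_trans _ rr)// /r1; lra.
have rL : 2 * L < eta * e * r'.
  by rewrite [ltRHS]mulrC -ltr_pdivrMr// (le_lt_trans _ rr)// /r1; lra.
have erb : 2 * base < e * r'.
  apply: (lt_le_trans rb); rewrite -mulrA ler_piMl ?mulr_ge0 ?(ltW e0) ?(ltW r'0)//; lra.
pose r := eta * L; have r_gt0 : 0 < r by rewrite mulr_gt0.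
have c01 : 0 <= r / r' <= 1.
  rewrite divr_ge0 ?(ltW r_gt0) ?(ltW r'0)//= ler_pdivrMr// mul1r.
  apply: le_trans (_ : e * r' <= _); last by rewrite ler_piMl ?(ltW r'0)//; lra.
  have : eta * L <= 1 * L by rewrite ler_pM2r//; lra.
  by have := mdist_ge0 o p; have := normr_ge0 r0; rewrite /base in erb; rewrite /r; lra.
have c0 : 0 < r / r' by rewrite divr_gt0.
have [f [f1 f2]] := homothety_exists geod mono p c01.
pose Y := map f s.
have Ysp : spaced (e * r) Y.
  apply: spaced_map sep => x y _ _ hxy; apply: le_trans (f2 x y).
  have -> : e * r = r / r' * (12 * eta * r') by rewrite -/e; field; rewrite gt_eqF.
  by rewrite ler_pM2l.
have Yb y : y \in Y -> e * r <= d p y <= r.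
  move=> /mapP[x xs ->]; have [-> _ _ _] := f1 x.
  have := sr x xs; have := sfar x xs; rewrite -/e => h1 h2.
  rewrite (mulrAC r) ler_pdivlMr// ler_pdivrMr//; apply/andP; split.
    by rewrite (mulrC e) -mulrA ler_pM2l.
  by rewrite ler_pM2l// ltW.
have Yq y : y \in Y -> `|d q y - L| <= 3 * eta * r.
  move=> yY; have /andP[yl yu] := Yb y yY; case/mapP: (yY) => x xs yx.
  have [ex1 ex2 ex3 [g hg eg]] := f1 x.
  have xfar : 2 * base < d p x by apply: (lt_le_trans erb); exact: sfar.
  have nr := normr_ge0 r0; have op0 := mdist_ge0 o p.
  have px0 : 0 < d p x by move: xfar base1; clear -mono fT geod packing n0 C1; lra.
  have px : p != x by rewrite -mdist_gt0.
  have qx0 : 0 < d q x.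
    by have := metric_triangle p q x; rewrite -/L; move: xfar; rewrite /base; lra.
  have qx : q != x by rewrite -mdist_gt0.
  have ox : r0 <= d o x.
    have := metric_triangle p o x; rewrite (metric_sym p o); have := ler_norm r0.
    by move: xfar nr op0 L0; rewrite /base; clear -mono fT geod packing n0 C1; lra.
  have [k hk] := geod q x.
  have [[h1 hh1 a1] [h2 hh2 a2]] := far x px qx ox g k hg hk.
  have eb : -1 <= eta <= 1 by move: eta0 eta1; clear -mono fT geod packing n0 C1; lra.
  have qp : q != p by rewrite eq_sym.
  have se : sin eta <= eta by apply: sin_le; exact: ltW.
  have yy : 0 < d p y <= d p x.
    rewrite (lt_le_trans _ yl) ?mulr_gt0//= yx ex1 ler_piMl ?(ltW px0)//.
    by case/andP: c01.
  have xx : 0 < d q x <= d q x by rewrite qx0 lexx.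
  have i1 := ip_ge_of_path_angle pq px hh1 hg eb a1 yy.
  have gy : g (d p y) = y by rewrite yx ex1 -eg.
  rewrite gy -/L in i1.
  have i2 := ip_ge_of_path_angle qp qx hh2 hk eb a2 xx.
  have kx : k (d q x) = x by case: hk.
  rewrite kx (metric_sym q p) -/L in i2.
  have i3 := ex3 q; rewrite -yx in i3.
  have y0 : 0 < d p y by case/andP: yy.
  have j1 : - eta * (L * d p y) <= ip p q y.
    by apply: le_trans i1; rewrite ler_wpM2r ?mulr_ge0 ?(ltW L0) ?(ltW y0)// lerN2.
  have j2 : - eta * (L * d q x) <= ip q p x.
    by apply: le_trans i2; rewrite ler_wpM2r ?mulr_ge0 ?(ltW L0) ?(ltW qx0)// lerN2.
  have ipxE : ip p q x = L ^+ 2 - ip q p x by rewrite /ip (metric_sym q p) -/L; field.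
  have j3 : r / r' * L <= eta * d p y / 2.
    have : eta * (e * r) <= eta * d p y by rewrite ler_pM2l.
    have : r / r' * (2 * L) <= r / r' * (eta * e * r') by rewrite ler_pM2l// ltW.
    have -> : r / r' * (eta * e * r') = eta * (e * r) by field; rewrite gt_eqF.
    by clear -mono fT geod packing n0 C1; lra.
  have j4 : ip p q y <= 2 * eta * L * d p y.
    have qxu : d q x <= L + d p x.
      by have := metric_triangle q p x; rewrite (metric_sym q p) -/L.
    have b1 : L ^+ 2 - ip q p x <= L ^+ 2 + eta * (L * (L + d p x)).
      have : eta * (L * d q x) <= eta * (L * (L + d p x)) by rewrite !ler_pM2l.
      by move: j2; clear -mono fT geod packing n0 C1; lra.
    have ey : d p y = r / r' * d p x by rewrite yx ex1.
    rewrite ey in j3 *; apply: (contraction_estimate (ltW c0) (ltW L0) _ b1 j3).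
      by rewrite (ltW eta0); move: eta1; clear -mono fT geod packing n0 C1; lra.
    by rewrite -ipxE !(ipC p q).
  have yr : 0 <= d p y <= r by rewrite mdist_ge0 (le_trans yu).
  have ii : - eta * (L * d p y) <= ip p q y <= 2 * eta * L * d p y by rewrite j1 j4.
  by apply: (band_estimate _ L0 yr ii); rewrite ?eta0 ?mdist_ge0// (sqr_mdist_ip p).
(* Each slide goes a further fraction [2 * e * eta] of the way to [q], about [2 * e * r], so all of
   them together stay within about [2 * r]. *)
pose m := Num.truncn (1 / e).
have me : m%:R * e <= 1.
  by rewrite -ler_pdivlMr// truncn_le// divr_ge0// ltW.
have em : 1 / 2 <= m%:R * e.
  have : 1 / e < m.+1%:R by exact: truncnS_gt.
  by rewrite ltr_pdivrMr// -natr1; move: e12; clear -mono fT geod packing n0 C1; lra.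
pose ome := 2 * e * eta.
have ome0 : 0 < ome by rewrite !mulr_gt0.
have omL : ome * L = 2 * e * r by rewrite /ome /r; ring.
have tau l : (l <= m)%N -> 0 <= l%:R * ome <= 2 * eta.
  move=> lm; rewrite mulr_ge0 ?(ltW ome0)//=.
  apply: le_trans (_ : m%:R * ome <= _); first by rewrite ler_pM2r// ler_nat.
  have : m%:R * e * (2 * eta) <= 1 * (2 * eta) by rewrite ler_pM2r ?mulr_gt0.
  by rewrite /ome; clear -mono fT geod packing n0 C1; lra.
have tau1 l : (l <= m)%N -> 0 <= 1 - l%:R * ome <= 1.
  by move=> /tau /andP[t1 t2]; apply/andP; split; move: t1 t2 eta1; clear -mono fT geod packing n0 C1; lra.
have exF l : exists F : M -> M, (l <= m)%N -> (forall x, d q (F x) = (1 - l%:R * ome) * d q x /\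
    d q (F x) + d (F x) x = d q x) /\ forall x y, (1 - l%:R * ome) * d x y <= d (F x) (F y).
  have [lm|lm] := leqP l m; last by exists id.
  have [F [F1 F2]] := homothety_exists geod mono q (tau1 l lm).
  by exists F => _; split => // x; have [] := F1 x.
pose F l := sval (cid (exF l)).
have FP l : (l <= m)%N -> (forall x, d q (F l x) = (1 - l%:R * ome) * d q x /\
    d q (F l x) + d (F l x) x = d q x) /\ forall x y, (1 - l%:R * ome) * d x y <= d (F l x) (F l y).
  exact: (svalP (cid (exF l))).
clearbody F.
have er0 : 0 < e * r by rewrite mulr_gt0.
have etar : eta * r <= r / 24 by rewrite mulrC ler_pM2l//; move: eta1; clear -mono fT geod packing n0 C1; lra.
have [||Z [Zs Zsp ZF]] := @spaced_slides R M (e * r / 2) Y F m.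
- move=> l lm; apply: spaced_map Ysp => y y' _ _ h.
  have [_ h2] := FP l (ltnW lm); apply: le_trans (h2 y y').
  have /andP[t1 t2] := tau l (ltnW lm).
  have : 1 / 2 * (e * r) <= (1 - l%:R * ome) * d y y'.
    by apply: ler_pM => //; [exact: ltW|move: t1 t2 eta1; clear -mono fT geod packing n0 C1; lra].
  by clear -mono fT geod packing n0 C1; lra.
- move=> l l' y y' ll lm yY y'Y.
  have [H1 _] := FP l (ltnW (ltn_trans ll lm)); have [H2 _] := FP l' (ltnW lm).
  have [e1 _] := H1 y; have [e2 _] := H2 y'.
  have /andP[t1 t2] := tau l (ltnW (ltn_trans ll lm)); have /andP[t3 t4] := tau l' (ltnW lm).
  have := Yq y yY; have := Yq y' y'Y; rewrite !ler_norml => /andP[b1 b2] /andP[b3 b4].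
  have s1 : d q (F l y) - d q (F l' y') <= d (F l y) (F l' y').
    by have := mdist_diff (F l y) (F l' y') q; rewrite ler_norml !(metric_sym _ q) => /andP[].
  apply: le_trans s1; rewrite e1 e2.
  have ll1 : l%:R + 1 <= l'%:R :> R by rewrite natr1 ler_nat.
  have s2 : ome <= l'%:R * ome - l%:R * ome by rewrite -mulrBl ler_peMl ?(ltW ome0)//; move: ll1; clear -mono fT geod packing n0 C1; lra.
  have ee : e * r / 2 = 12 * eta * (eta * L) / 2 by [].
  rewrite ee; apply: slide_estimate (ltW L0) t1 t4 _ b3 b2; first by rewrite (ltW eta0).
  by have -> : 24 * eta * eta = ome by rewrite /ome /e; ring.
have r60 : 0 < 6 * r by rewrite mulr_gt0.
(* All slides lie within [6 * r] of [p] with spacing [e * r / 2], and the ratio of these is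
   [e / 12], that is [eta]. *)
have al : 0 < e / 12 <= 1 by rewrite divr_gt0//=; move: e12; clear -mono fT geod packing n0 C1; lra.
have al6 : e / 12 * (6 * r) = e * r / 2 by field.
have := packing (p := p) r60 al (s := Z); rewrite al6 => /(_ _ Zsp).
have Zb z : z \in Z -> d p z < 6 * r.
  move=> /ZF[l [y [lm yY ->]]]; have [H1 _] := FP l (ltnW lm); have [e1 e2] := H1 y.
  have /andP[_ yr] := Yb y yY; have := Yq y yY; rewrite ler_norml => /andP[_ b2].
  have /andP[t1 t2] := tau l (ltnW lm).
  have : l%:R * ome * d q y <= 2 * eta * (2 * L).
    apply: ler_pM => //; first by rewrite mdist_ge0.
    have : eta * r <= r / 24 by [].
    have : r <= L by rewrite /r ler_piMl ?(ltW L0)//; move: eta1; clear -mono fT geod packing n0 C1; lra.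
    by move: b2 L0; clear -mono fT geod packing n0 C1; lra.
  have := metric_triangle p y (F l y); rewrite (metric_sym y (F l y)).
  have : r = eta * L by []. move: e1 e2 yr r_gt0; clear -mono fT geod packing n0 C1; lra.
move=> /(_ Zb); rewrite Zs natrM size_map => big.
have -> : C / eta = C / (e / 12) by rewrite /e; field; rewrite gt_eqF.
have m0 : 0 < m%:R :> R.
  by rewrite ltr0n lt0n; apply/eqP => m0; move: em; rewrite m0 mul0r; clear -mono fT geod packing n0 C1; lra.
have K0 : 0 <= (C / (e / 12)) ^+ n by rewrite exprn_ge0// divr_ge0 ?(ltW (andP al).1)// (le_trans ler01 C1).
have : (m%:R * e) * (size s)%:R <= e * (C / (e / 12)) ^+ n.
  by rewrite mulrC mulrA mulrC (mulrC _ m%:R) ler_pM2l.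
have : 1 / 2 * (size s)%:R <= (m%:R * e) * (size s)%:R by rewrite ler_wpM2r.
have -> : 24 * eta = 2 * e by rewrite /e; ring.
by clear -mono fT geod packing n0 C1; lra.
Qed.

(** Two scales: families with spacing [12 * eta * r] are counted by [slab_packing], finer ones
    inside each ball of that radius by [packing]. In the product the powers of [eta] cancel except
    for one factor. *)
Lemma volume_growth_le p0 (eta : R) : 0 < eta <= 1 / 24 -> (ob_infty M < eta%:E)%E ->
  volume_growth_rate n p0 <=
  unit_ball_volume R n / 2 ^+ n * (2 ^+ n * 2 ^+ n * (25 * (12 * C ^+ 2) ^+ n)) * eta.
Proof.
move=> eta01 ob; have /andP[eta0 eta1] := eta01.
have C0 : 0 < C by apply: lt_le_trans C1.
have [p [q [pq _ obpq]]] := ob_infty_lt ob ltr01.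
have [c [r0 hfar]] := ob_pair_lt fT pq obpq.
have [r1 hr1] := slab_packing pq eta01 hfar.
pose B1 := 25 * eta * (12 * C ^+ 2) ^+ n.
have CC0 : 0 < 12 * C ^+ 2 by rewrite mulr_gt0// exprn_gt0.
have B10 : 0 <= B1 by rewrite !mulr_ge0 ?exprn_ge0 ?(ltW eta0) ?(ltW CC0).
have main (r : R) : r1 < r -> 0 < r ->
    (unnormalized_hausdorff n%:R (ball p r) <= (2 ^+ n * (B1 * r ^+ n))%:E)%E.
  move=> r1r r_gt0; apply: hausdorff_le_packing => //.
    by rewrite mulr_ge0// exprn_ge0// ltW.
  pose b := 12 * eta * r; have b0 : 0 < b by rewrite !mulr_gt0.
  move=> e0 e00; pose e := Num.min e0 b.
  have e_gt0 : 0 < e by rewrite lt_min e00.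
  have eb : e <= b by rewrite ge_min lexx orbT.
  exists e; first by rewrite e_gt0 /= ge_min lexx.
  have ab : 0 < e / b <= 1 by rewrite divr_gt0//= ler_pdivrMr// mul1r.
  have abe : e / b * b = e by rewrite divfK// gt_eqF.
  move=> s sA sep.
  have a12 : 0 < 12 * eta <= 1 by rewrite mulr_gt0//=; lra.
  have [|T [Tsep TA Tmax]] := @maximal_spaced R M (ball p r) b (Num.truncn ((C / (12 * eta)) ^+ n)) b0.
    move=> s' s'A s'sep; rewrite truncn_ge_nat ?exprn_ge0 ?divr_ge0 ?(ltW C0) ?(ltW (andP a12).1)//.
    by apply: (packing (p := p) r_gt0 a12 _ s'sep) => x /s'A /ballP.
  have hK t : t \in T -> (size [seq x <- s | (d t x < b)%R] <= Num.truncn ((C / (e / b)) ^+ n))%N.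
    move=> tT; rewrite truncn_ge_nat ?exprn_ge0 ?divr_ge0 ?(ltW C0) ?(ltW e_gt0) ?(ltW b0)//.
    apply: (packing (p := t) b0 ab); first by move=> x; rewrite mem_filter => /andP[].
    by rewrite abe; exact: spaced_filter.
  have := @size_covered R M T s (fun t x => d t x < b) _ _ hK => /(_ _)/wrap[].
    by move=> x /sA /Tmax[t tT xt]; exists t; rewrite // metric_sym.
  rewrite -(ler_nat R) natrM => /le_trans; apply.
  have hT : (size T)%:R <= 25 * eta * (C / eta) ^+ n.
    rewrite -(count_predC (fun x => d p x < b) T) natrD -!size_filter.
    (* Points near [p] escape the slab argument, but as [0 < n] their number is at most
       [eta * (C / eta) ^+ n], which raises 24 to 25. *)
    have h1 : (size [seq x <- T | d p x < b])%:R <= C ^+ n.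
      rewrite -[C]divr1; apply: (packing (p := p) b0); first by rewrite ltr01 lexx.
        by move=> x; rewrite mem_filter => /andP[].
      by rewrite mul1r; exact: spaced_filter.
    have h2 : (size [seq x <- T | predC (fun x => d p x < b) x])%:R <= 24 * eta * (C / eta) ^+ n.
      apply: (hr1 r) => //.
      - by move=> x; rewrite mem_filter => /andP[_ /TA /ballP].
      - exact: spaced_filter.
      - by move=> x; rewrite mem_filter /= -leNgt => /andP[].
    have h3 : C ^+ n <= eta * (C / eta) ^+ n.
      rewrite expr_div_n mulrCA ler_peMr ?exprn_ge0 ?(ltW C0)// ler_pdivlMr ?exprn_gt0// mul1r.
      by rewrite -(prednK n0) exprS ler_piMr ?exprn_ile1 ?(ltW eta0)//; lra.
    by move: h1 h2 h3; lra.
  apply: le_trans (_ : 25 * eta * (C / eta) ^+ n * (C / (e / b)) ^+ n <= _).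
    apply: ler_pM => //.
    by rewrite truncn_le exprn_ge0// !divr_ge0 ?(ltW C0) ?(ltW e_gt0) ?(ltW b0).
  rewrite /B1 -!mulrA -expr_div_n -!exprMn.
  rewrite (_ : C / eta * (C / (e / b)) = 12 * C ^+ 2 * (r / e))// /b.
  by field; rewrite !gt_eqF.
have [_ _] := volume_growth_spec geod mono n0 C0 packing p0.
move=> /(_ (2 ^+ n * 2 ^+ n * B1) (`|r1| + d p p0)) h.
apply: le_trans (h _) _; last by rewrite /B1 le_eqVlt; apply/orP; left; apply/eqP; ring.
move=> r rr; have nr := normr_ge0 r1; have rl := ler_norm r1; have pp := mdist_ge0 p p0.
apply: le_trans (_ : unnormalized_hausdorff n%:R (ball p (2 * r)) <= _)%E.
  apply: unnormalized_hausdorffS => x /ballP xr; apply/ballP.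
  by have := metric_triangle p p0 x; lra.
apply: le_trans (main _ _ _) _; [lra|lra|].
by rewrite lee_fin exprMn le_eqVlt; apply/orP; left; apply/eqP; ring.
Qed.

End volume_upper_bound.

(** * Volume growth bounded below in terms of the obtuse constant *)

(** The last hypothesis forces [nu - e <= a * b], while the bounds on the squares multiply to
    [(1 + e) ^+ 2 - B ^+ 2]; so [B] cannot be close to 1. *)
Lemma obtuse_estimate (R : realFieldType) (a b B e nu : R) : 0 <= a -> 0 <= b -> 0 <= B ->
  0 < nu <= 1 -> e <= nu ^+ 2 / 8 -> a ^+ 2 <= 1 - B + e -> b ^+ 2 <= 1 + B + e ->
  2 + 2 * nu <= (a + b) ^+ 2 -> B <= 1 - nu ^+ 2 / 4.
Proof.
move=> a0 b0 B0 /andP[nu0 nu1] en ha hb hab.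
have nn : nu ^+ 2 <= nu by rewrite expr2 ler_piMl// ltW.
have n2 : 0 < nu ^+ 2 by rewrite exprn_gt0.
have h1 : nu - e <= a * b by move: ha hb hab; lra.
have h2 : (nu - e) ^+ 2 <= (a * b) ^+ 2.
  by rewrite lerXn2r ?nnegrE ?mulr_ge0//; lra.
have h3 : (a * b) ^+ 2 <= (1 - B + e) * (1 + B + e).
  by rewrite exprMn ler_pM ?sqr_ge0.
have h4 : B ^+ 2 <= (1 - nu ^+ 2 / 4) ^+ 2.
  have h5 : (1 + nu) * e <= (1 + nu) * (nu ^+ 2 / 8) by rewrite ler_wpM2l//; lra.
  have h6 : (1 + nu) * (nu ^+ 2 / 8) <= 2 * (nu ^+ 2 / 8) by rewrite ler_wpM2r//; lra.
  have h7 := sqr_ge0 (nu ^+ 2 / 4).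
  by move: h2 h3 h5 h6 h7; clear; lra.
by move: h4; rewrite ler_pXn2r ?nnegrE//; lra.
Qed.

Section obtuse_strainers.
Context {R : realType} {M : metricType R}.
Implicit Types x y z p q w o : M.
Implicit Types (g h : R -> M).
Local Notation d x y := (@mdist R M x y : R).

Hypothesis iM : intrinsic M.
Hypothesis fT : fourpt [set: M].
Hypothesis mono : forall x y z p, d x z + d z y = d x y -> d x y * ip x z p <= d x z * ip x y p.

Let VU x y z : [set: M] x -> [set: M] y -> d x z <= 2 * d x y -> [set: M] z.
Proof. by []. Qed.

Section at_strainer.
Variables (k : nat) (kap lam nu : R) (z : M) (S : nat -> bool -> M).
Hypothesis kap01 : 0 < kap <= 1.
Hypothesis st : strained [set: M] k kap lam z S.

Local Ltac lr := clear -iM fT mono kap01 st; lra.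

Lemma coordinate_slope q x g (s u : R) i : (i < k)%N -> shortest_path q x g ->
  0 < s <= u -> u <= d q x -> u <= kap * lam -> d z q + u < lam ->
  `|u * (d (g s) (S i true) - d q (S i true)) - s * (d (g u) (S i true) - d q (S i true))|
    <= 5 * kap * (s * u).
Proof.
move=> ik hg /andP[s0 su] uq ul zq; have /andP[k0 k1] := kap01.
have u0 : 0 < u by exact: lt_le_trans su.
have es := shortest_path_start hg (ltW s0) (le_trans su uq).
have eu := shortest_path_start hg (ltW u0) uq.
have esu := shortest_path_dist hg (ltW s0) su uq.
have zbq : ball z lam q by apply/ballP; move: zq u0; lr.
have [lam0 _ _ sw] := st; have [sl _ _] := sw q zbq.
pose X b t := d q (S i b) - d (g t) (S i b).
have E0 : 0 <= kap * (s * u) by rewrite !mulr_ge0// ltW.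
have claim b : u * X b s <= s * X b u + kap * (s * u) / 2.
  have A0 : 0 < d q (S i b) by apply: lt_le_trans (sl i b ik).
  have /andP[h1 _] := ip_drop (g s) A0; have /andP[_ h2] := ip_drop (g u) A0.
  have h3 : u * ip q (S i b) (g s) <= s * ip q (S i b) (g u).
    have := @mono q (g u) (g s) (S i b); rewrite es eu esu !(ipC q _ (S i b)); apply.
    by rewrite addrC subrK.
  have h4 : d q (g u) ^+ 2 / (2 * d q (S i b)) <= kap * u / 2.
    rewrite eu ler_pdivrMr ?mulr_gt0//.
    have h5 : kap * lam <= kap * d q (S i b) by rewrite ler_pM2l// sl.
    have := ler_wpM2r (ltW u0) (le_trans ul h5); lr.
  have h6 : u * (ip q (S i b) (g s) / d q (S i b)) <= s * (ip q (S i b) (g u) / d q (S i b)).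
    by rewrite (mulrA u) (mulrA s) ler_wpM2r// invr_ge0 ltW.
  have h7 := ler_wpM2l (ltW u0) h1; have h8 := ler_wpM2l (ltW s0) h2.
  have h9 := ler_wpM2l (ltW s0) h4.
  by rewrite /X; move: h6 h7 h8 h9; lr.
have sumX t : 0 < t -> t <= u -> - (2 * kap * t) <= X true t + X false t <= 2 * kap * t.
  move=> t0 tu; have et := shortest_path_start hg (ltW t0) (le_trans tu uq).
  have tl : d q (g t) <= kap * lam by rewrite et; exact: le_trans ul.
  have zt : ball z lam (g t).
    by apply/ballP; have := metric_triangle z q (g t); rewrite et; move: zq tu; lr.
  have := strainer_drop_ge fT VU kap01 st true zbq ik (I : setT (g t)) tl.
  have := strainer_drop_le fT VU kap01 st true zbq ik zt tl.
  by rewrite et /X /= => -> ->.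
have /andP[a1 a2] := sumX s s0 su; have /andP[b1 b2] := sumX u u0 (lexx u).
have := claim true; have := claim false.
have := ler_wpM2l (ltW u0) a1; have := ler_wpM2l (ltW s0) b2.
rewrite ler_norml /X; clear a1 a2 b1 b2 sumX claim; move=> c1 c2 c3 c4; apply/andP; split.
all: move: c1 c2 c3 c4 E0; lr.
Qed.

Hypothesis nu01 : 0 < nu <= 1.
Hypothesis small : 8 * 37 * kap * k.+1%:R ^+ 2 <= nu ^+ 2.

Let K : R := k.+1%:R.

Let kE : k%:R = K - 1.
Proof. by rewrite /K -natr1 addrK. Qed.

Let K1 : 1 <= K.
Proof. by rewrite ler1n. Qed.

Local Ltac lrn := clear -iM fT mono kap01 st nu01 small kE K1; lra.

(** The point [w] is [q] displaced to the coordinates of [p1]. With [B] the sum in question, the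
    squares of its distances to [p1] and to [p2], which has almost the coordinates of [q], are at
    most about [s ^+ 2 - B] and [s ^+ 2 + B], but [p1] and [p2] are far apart by obtuseness. *)
Lemma obtuse_slopes q p1 p2 (s : R) : 0 < s -> d q p1 = s -> d q p2 = s ->
  ip q p2 p1 <= - nu * s ^+ 2 ->
  (forall i, (i < k)%N -> `|d p2 (S i true) - d q (S i true)| <= 6 * kap * s) ->
  (2 * k%:R + 1) * s <= kap * lam -> d z q + (2 * k%:R + 1) * s < lam ->
  \sum_(i < k) (d p1 (S i true) - d q (S i true)) ^+ 2 <= (1 - nu ^+ 2 / 4) * s ^+ 2.
Proof.
move=> s0 e1 e2 hip h6 skl zq; have /andP[k0 k1] := kap01.
pose D i := d p1 (S i true) - d q (S i true).
have Ds i : `|D i| <= s by rewrite -e1 metric_sym; exact: mdist_diff.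
have Tk : \sum_(i < k) `|D i| <= k%:R * s.
  by rewrite mulr_natl -[X in _ *+ X]card_ord -sumr_const; apply: ler_sum => i _; exact: Ds.
have T0 : 0 <= \sum_(i < k) `|D i| by apply: sumr_ge0 => i _; exact: normr_ge0.
have kK := kE; have KK := K1; have k0R : 0 <= k%:R :> R by [].
have [||w [_ _ w3]] := strainer_displace iM fT VU kap01 st (w0 := q) (D := D) (leqnn k) (ltW s0).
- by move: zq Tk s0; lrn.
- by move: skl Tk s0; lrn.
have zp p : d q p = s -> ball z lam p.
  move=> ep; apply/ballP; have := metric_triangle z q p; rewrite ep.
  have : 0 <= k%:R * s by rewrite mulr_ge0// ltW.
  by move: zq; lrn.
have := w3 p1 (zp _ e1); have := w3 p2 (zp _ e2).
rewrite !(metric_sym _ q) e1 e2 => /(_ (lexx s)) H2 /(_ (lexx s)) H1.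
set T := \sum_(i < k) `|D i| in Tk T0 H1 H2.
set B := \sum_(i < k) (d p1 (S i true) - d q (S i true)) ^+ 2.
have B0 : 0 <= B by apply: sumr_ge0 => i _; exact: sqr_ge0.
have E1 : \sum_(i < k) (D i ^+ 2 - 2 * D i * (d p1 (S i true) - d q (S i true))) = - B.
  by rewrite /B -sumrN; apply: eq_bigr => i _; rewrite /D; ring.
have E2 : \sum_(i < k) (D i ^+ 2 - 2 * D i * (d p2 (S i true) - d q (S i true)))
    <= B + k%:R * (12 * kap * s ^+ 2).
  have -> : k%:R * (12 * kap * s ^+ 2) = \sum_(i < k) (12 * kap * s ^+ 2).
    by rewrite sumr_const card_ord mulr_natl.
  rewrite -big_split/=.
  apply: ler_sum => i _; rewrite lerD2l.
  have : `|D i * (d p2 (S i true) - d q (S i true))| <= s * (6 * kap * s).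
    by rewrite normrM ler_pM// h6.
  by rewrite ler_norml => /andP[h _]; move: h; lrn.
have TT : kap * T * (T + s) <= kap * (K ^+ 2 * s ^+ 2).
  rewrite -mulrA ler_pM2l//.
  have h1 : T <= K * s by move: Tk; rewrite kE; move: s0; lrn.
  have h2 : T + s <= K * s by move: Tk; rewrite kE; lrn.
  have := ler_pM T0 (addr_ge0 T0 (ltW s0)) h1 h2; lrn.
have kK2 : kap * k%:R <= kap * K ^+ 2.
  by rewrite ler_pM2l// kE expr2; have := ler_wpM2l (le_trans ler01 K1) K1; lrn.
have s20 : 0 < s ^+ 2 by rewrite exprn_gt0.
pose e := 30 * kap * K ^+ 2.
have en : e <= nu ^+ 2 / 8.
  have : 0 <= kap * K ^+ 2 by rewrite mulr_ge0 ?sqr_ge0// ltW.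
  by have := small; rewrite /e -/K; lrn.
have kKs : kap * k%:R * s ^+ 2 <= kap * K ^+ 2 * s ^+ 2 by rewrite ler_pM2r.
have kKs0 : 0 <= kap * K ^+ 2 * s ^+ 2 by rewrite !mulr_ge0 ?sqr_ge0// ltW.
rewrite -ler_pdivrMr//.
apply: (@obtuse_estimate _ (d p1 w / s) (d p2 w / s) _ e) => //.
- by rewrite divr_ge0 ?mdist_ge0// ltW.
- by rewrite divr_ge0 ?mdist_ge0// ltW.
- by rewrite divr_ge0// ltW.
- rewrite expr_div_n ler_pdivrMr//.
  have -> : (1 - B / s ^+ 2 + e) * s ^+ 2 = s ^+ 2 - B + e * s ^+ 2 by field; rewrite gt_eqF.
  by move: H1 E1 TT kKs0; rewrite /e; lrn.
- rewrite expr_div_n ler_pdivrMr//.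
  have -> : (1 + B / s ^+ 2 + e) * s ^+ 2 = s ^+ 2 + B + e * s ^+ 2 by field; rewrite gt_eqF.
  by move: H2 E2 TT kKs kKs0; rewrite /e; lrn.
- rewrite -mulrDl expr_div_n ler_pdivlMr//.
  have : d p2 p1 ^+ 2 <= (d p1 w + d p2 w) ^+ 2.
    rewrite lerXn2r ?nnegrE ?addr_ge0 ?mdist_ge0// addrC (metric_sym p1).
    exact: metric_triangle.
  by rewrite (sqr_mdist_ip q) e1 e2; move: hip; lrn.
Qed.

(** The point [w] is [g u] moved back to the coordinates of [q]. Displacements bound distances from
    above only; so [w] is compared with [g (2 * u)], from which it has distance at most
    [(2 - nu ^+ 2 / 8) * u], whereas [q] has distance [2 * u]. *)
Lemma macroscopic_pair q x g (s u : R) : shortest_path q x g -> 0 < s <= u ->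
  2 * u <= d q x -> (2 * k%:R + 2) * u <= kap * lam -> d z q + (2 * k%:R + 2) * u < lam ->
  \sum_(i < k) (d (g s) (S i true) - d q (S i true)) ^+ 2 <= (1 - nu ^+ 2 / 4) * s ^+ 2 ->
  exists w, [/\ nu ^+ 2 / 8 * u <= d q w, d q w <= (2 * k%:R + 1) * u &
    forall i, (i < k)%N -> `|d q (S i true) - d w (S i true)| <= 6 * kap * (k%:R * u)].
Proof.
move=> hg /andP[s0 su] uq ukl zq hs; have /andP[k0 k1] := kap01.
have u0 : 0 < u by exact: lt_le_trans su.
have kK := kE; have KK := K1; have k0R : 0 <= k%:R :> R by [].
have ku0 : 0 <= k%:R * u by rewrite mulr_ge0// ltW.
have uq1 : u <= d q x by move: uq u0; lrn.
have u2l : 2 * u <= kap * lam by move: ukl ku0; lrn.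
have ul : u <= kap * lam by move: u2l u0; lrn.
have zu2 : d z q + 2 * u < lam by move: zq ku0; lrn.
have zu : d z q + u < lam by move: zu2 u0; lrn.
have eu := shortest_path_start hg (ltW u0) uq1.
have e2u : d q (g (2 * u)) = 2 * u by rewrite (shortest_path_start hg)//; move: u0; lrn.
have eu2 : d (g u) (g (2 * u)) = u.
  by rewrite (shortest_path_dist hg (ltW u0) _ uq); move: u0; lrn.
pose f i p := d p (S i true).
pose D i := f i q - f i (g u).
have Du i : `|D i| <= u by rewrite -eu; exact: mdist_diff.
have sl1 i : (i < k)%N -> `|u * (f i (g s) - f i q) + s * D i| <= 5 * kap * (s * u).
  move=> ik; have := coordinate_slope ik hg (ltac:(by rewrite s0) : 0 < s <= u) uq1 ul zu.
  by rewrite /D /f; congr (`|_| <= _); ring.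
have sl2 i : (i < k)%N -> `|f i (g (2 * u)) - f i (g u) + D i| <= 10 * kap * u.
  move=> ik; have := coordinate_slope ik hg (ltac:(rewrite u0/=; move: u0; lrn) : 0 < u <= 2 * u) uq u2l zu2.
  have -> : 2 * u * (d (g u) (S i true) - d q (S i true)) - u * (d (g (2 * u)) (S i true) - d q (S i true)) =
    - u * (f i (g (2 * u)) - f i (g u) + D i) by rewrite /D /f; ring.
  rewrite normrM normrN (gtr0_norm u0) => h; rewrite -(ler_pM2l u0).
  by apply: le_trans h _; rewrite le_eqVlt; apply/orP; left; apply/eqP; ring.
have DB : \sum_(i < k) D i ^+ 2 <= (1 - nu ^+ 2 / 4 + 10 * kap * k%:R) * u ^+ 2.
  have s20 : 0 < s ^+ 2 by rewrite exprn_gt0.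
  rewrite -(ler_pM2l s20).
  apply: le_trans (_ : \sum_(i < k) (u ^+ 2 * (f i (g s) - f i q) ^+ 2 + 10 * kap * (s * u) ^+ 2) <= _).
    rewrite mulr_sumr; apply: ler_sum => i _.
    have := sl1 i (ltn_ord i); set r := _ + _ => hr.
    have fs : `|f i (g s) - f i q| <= s.
      rewrite -[leRHS](shortest_path_start hg (ltW s0) (le_trans su uq1)) (metric_sym q (g s)).
      exact: mdist_diff.
    have h1 : `|s * D i| <= s * u by rewrite normrM (gtr0_norm s0) ler_pM2l.
    have h2 : `|u * (f i (g s) - f i q)| <= s * u.
      by rewrite normrM (gtr0_norm u0) mulrC ler_pM2r.
    have h3 : `|s * D i - u * (f i (g s) - f i q)| <= 2 * (s * u).
      by apply: le_trans (ler_normB _ _) _; move: h1 h2; lrn.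
    have h4 : `|r * (s * D i - u * (f i (g s) - f i q))| <= 5 * kap * (s * u) * (2 * (s * u)).
      by rewrite normrM ler_pM.
    move: h4; rewrite ler_norml => /andP[_]; rewrite /r.
    by lrn.
  rewrite big_split/= -mulr_sumr sumr_const card_ord -mulr_natl.
  have := ler_wpM2l (sqr_ge0 u) hs; rewrite -/(f _ _).
  by lrn.
have Tk : \sum_(i < k) `|D i| <= k%:R * u.
  by rewrite mulr_natl -[X in _ *+ X]card_ord -sumr_const; apply: ler_sum => i _; exact: Du.
have T0 : 0 <= \sum_(i < k) `|D i| by apply: sumr_ge0 => i _; exact: normr_ge0.
have zgu : d z (g u) <= d z q + u by have := metric_triangle z q (g u); rewrite eu.
have [||w [w1 w2 w3]] := strainer_displace iM fT VU kap01 st (w0 := g u) (D := D) (leqnn k) (ltW u0).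
- by move: zq Tk zgu u0; lrn.
- by move: ukl Tk u0; lrn.
have zp : ball z lam (g (2 * u)).
  by apply/ballP; have := metric_triangle z q (g (2 * u)); rewrite e2u; move: zu2; lrn.
have := w3 _ zp; rewrite metric_sym eu2 => /(_ (lexx u)).
set T := \sum_(i < k) `|D i| in Tk T0 w1 w2 * => H.
have TT : kap * T * (T + u) <= kap * (K ^+ 2 * u ^+ 2).
  rewrite -mulrA ler_pM2l//.
  have h1 : T <= K * u by move: Tk; rewrite kE; move: u0; lrn.
  have h2 : T + u <= K * u by move: Tk; rewrite kE; lrn.
  have := ler_pM T0 (addr_ge0 T0 (ltW u0)) h1 h2; lrn.
have kK2 : kap * k%:R <= kap * K ^+ 2.
  by rewrite ler_pM2l// kE expr2; have := ler_wpM2l (le_trans ler01 K1) K1; lrn.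
have u20 : 0 < u ^+ 2 by rewrite exprn_gt0.
have kKu : kap * k%:R * u ^+ 2 <= kap * K ^+ 2 * u ^+ 2 by rewrite ler_pM2r.
(* From [g u] to [g (2 * u)] the coordinates change by about [- D i] again, so the cross term adds
   twice the square. *)
have E : \sum_(i < k) (D i ^+ 2 - 2 * D i * (f i (g (2 * u)) - f i (g u))) <=
    3 * \sum_(i < k) D i ^+ 2 + 20 * (kap * k%:R * u ^+ 2).
  have -> : 20 * (kap * k%:R * u ^+ 2) = \sum_(i < k) (20 * kap * u ^+ 2).
    by rewrite sumr_const card_ord -mulr_natl; ring.
  rewrite mulr_sumr -big_split/=; apply: ler_sum => i _.
  have : `|D i * (f i (g (2 * u)) - f i (g u) + D i)| <= u * (10 * kap * u).
    by rewrite normrM ler_pM// sl2.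
  by rewrite ler_norml => /andP[h _]; move: h; lrn.
have far : d (g (2 * u)) w <= (2 - nu ^+ 2 / 8) * u.
  have /andP[nu0 nu1] := nu01; have nn : nu ^+ 2 <= 1 by rewrite exprn_ile1// ltW.
  have n8 : 0 <= 2 - nu ^+ 2 / 8 by move: nn; lrn.
  rewrite -(@ler_pXn2r _ 2) ?nnegrE ?mdist_ge0 ?mulr_ge0 ?(ltW u0)//.
  apply: (le_trans H); have := ler_wpM2r (ltW u20) small; rewrite -/K.
  have := sqr_ge0 (nu ^+ 2 / 8 * u); have := mulr_ge0 (sqr_ge0 nu) (ltW u20).
  have kKu0 : 0 <= kap * K ^+ 2 * u ^+ 2 by rewrite !mulr_ge0 ?sqr_ge0// ltW.
  by rewrite exprMn; move: E TT kKu DB kKu0; rewrite /f; lrn.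
exists w; split.
- by have := metric_triangle q w (g (2 * u)); rewrite e2u (metric_sym w); move: far; lrn.
- by have := metric_triangle q (g u) w; rewrite eu; move: w1 Tk; lrn.
- move=> i ik; have := w2 i ik; rewrite ik -/(f i _) -/(f i _) /D.
  have -> : f i w - f i (g u) - (f i q - f i (g u)) = - (f i q - f i w) by ring.
  rewrite normrN => /le_trans; apply; by rewrite ler_wpM2l// mulr_ge0// ltW.
Qed.

End at_strainer.
End obtuse_strainers.

(* Each of n strainer extensions multiplies the error of the strainer, initially
   kap0, by A, and its scale by at least kap0 ^ 3 nu ^ 2 / (8 n). *)
Definition growth_const (R : realFieldType) (n : nat) (nu : R) : R :=
  let A := 40 * 48 * n%:R / nu ^+ 2 in
  let kap0 := nu ^+ 2 / (8 * 37 * n%:R ^+ 2) / A ^+ n in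
  (kap0 * A ^+ n * (kap0 ^+ 3 * nu ^+ 2 / (8 * n%:R)) ^+ n / (16 * n%:R)) ^+ n.

Lemma growth_const_gt0 (R : realFieldType) (n : nat) (nu : R) : (0 < n)%N -> 0 < nu ->
  0 < growth_const n nu.
Proof.
move=> n0 nu0; have nR : 0 < n%:R :> R by rewrite ltr0n.
have n2 : 0 < nu ^+ 2 by rewrite exprn_gt0.
have A0 : 0 < 40 * 48 * n%:R / nu ^+ 2 by rewrite divr_gt0// !mulr_gt0.
have k0 : 0 < nu ^+ 2 / (8 * 37 * n%:R ^+ 2) / (40 * 48 * n%:R / nu ^+ 2) ^+ n.
  by rewrite !divr_gt0 ?exprn_gt0// !mulr_gt0 ?exprn_gt0.
rewrite /growth_const; move: A0 k0; set A := _ / nu ^+ 2; set kap0 := _ / A ^+ n => A0 k0.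
have a0 : 0 < kap0 ^+ 3 * nu ^+ 2 / (8 * n%:R).
  by rewrite divr_gt0//; [apply: mulr_gt0 => //; exact: exprn_gt0|exact: mulr_gt0].
apply: exprn_gt0; apply: divr_gt0; last exact: mulr_gt0.
by apply: mulr_gt0; [apply: mulr_gt0 => //; exact: exprn_gt0|exact: exprn_gt0].
Qed.

Section volume_lower_bound.
Context {R : realType} {M : metricType R}.
Implicit Types x y z p q w o : M.
Implicit Types (g h : R -> M).
Local Notation d x y := (@mdist R M x y : R).

Variable n : nat.
Hypothesis iM : intrinsic M.
Hypothesis dimM : hausdorff_dim [set: M] = n%:R%:E.
Hypothesis fT : fourpt [set: M].
Hypothesis geod : forall p q, exists g, shortest_path p q g.
Hypothesis mono : forall x y z p, d x z + d z y = d x y -> d x y * ip x z p <= d x z * ip x y p.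

(** Contractions carry every larger ball into this one; if it were null, so would be the whole
    space. *)
Lemma ball_hausdorff_neq0 z (e a : R) : 0 < e -> 0 <= a < n%:R ->
  unnormalized_hausdorff a (ball z e) != 0%E.
Proof.
move=> e0 an; have /andP[a0 _] := an; apply/negP => /eqP h.
have := hausdorff_dim_lt dimM an; rewrite (_ : [set: M] = \bigcup_m ball z m.+1%:R).
  move/eqP; apply; apply: hausdorff_null_bigcup => m.
  pose c := e / (e + m.+1%:R); have m0 : 0 < m.+1%:R :> R by [].
  have em : 0 < e + m.+1%:R by rewrite addr_gt0.
  have c0 : 0 < c by rewrite divr_gt0.
  have c1 : 0 <= c <= 1 by rewrite (ltW c0) /c ler_pdivrMr// mul1r lerDl ltW.
  have [f [f1 f2]] := homothety_exists geod mono z c1.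
  have fB x : ball z m.+1%:R x -> ball z e (f x).
    move=> /ballP zx; apply/ballP; have [-> _ _ _] := f1 x.
    rewrite /c mulrAC ltr_pdivrMr// ltr_pM2l//; lra.
  have := hausdorff_expanding a0 c0 fB (fun x y _ _ => f2 x y).
  rewrite h mule0 => h0; apply/eqP; rewrite eq_le h0; exact: unnormalized_hausdorff_ge0.
apply/seteqP; split => // x _; exists (Num.truncn (d z x)) => //=.
by apply/ballP; exact: truncnS_gt.
Qed.

(* Otherwise f would embed a ball into k-space with a Lipschitz inverse. *)
Lemma vertical_pair (k : nat) z (e kap : R) (f : nat -> M -> R) : (k < n)%N -> 0 < e -> 0 < kap ->
  (forall i x y, `|f i x - f i y| <= d x y) ->
  exists q y, [/\ q != y, ball z e q, ball z e y &
    forall i, (i < k)%N -> `|f i q - f i y| <= kap * d q y].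
Proof.
move=> kn e0 k0 fL; apply: contrapT => noP.
(* An exponent strictly between [k] and [n]: the number of points grows at most like the power [- k]
   of the spacing [r], which leaves a factor [Num.sqrt r] tending to 0. *)
pose a : R := k%:R + 2^-1.
have an : 0 <= a < n%:R.
  rewrite addr_ge0//=; apply: lt_le_trans (_ : k.+1%:R <= _); last by rewrite ler_nat.
  by rewrite -natr1 ltrD2l invf_lt1// ltr1n.
have a0 : 0 < a by rewrite ltr_wpDl.
have := ball_hausdorff_neq0 z e0 an => /eqP; apply.
apply/eqP; rewrite eq_le unnormalized_hausdorff_ge0 andbT.
apply/lee_addgt0Pr => b b0; rewrite add0e.
have t0 : 0 < 2 `^ a by rewrite powR_gt0.
have -> : b = 2 `^ a * (b / 2 `^ a) by rewrite mulrC divfK// gt_eqF.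
set B := b / _; have B0 : 0 < B by rewrite divr_gt0.
apply: hausdorff_le_packingR => //; first exact: ltW.
move=> e1 e10; pose A := (2 * e / kap + e) ^+ k.
have A0 : 0 < A by rewrite exprn_gt0// addr_gt0// divr_gt0// mulr_gt0.
pose r := Num.min e1 (Num.min e ((B / A) ^+ 2)).
have r0 : 0 < r by rewrite !lt_min e10 e0 exprn_gt0// divr_gt0.
have r1 : r <= e1 by rewrite ge_min lexx.
have r2 : r <= e by rewrite !ge_min lexx orbT.
have r3 : r <= (B / A) ^+ 2 by rewrite !ge_min lexx !orbT.
clearbody r; exists r; first by rewrite r0.
move=> s sA sep.
have sz : (size s <= (Num.truncn (2 * e / (kap * r))).+1 ^ k)%N.
  rewrite leqNgt; apply/negP => big; apply: noP.
  have sz x : x \in s -> d z x < e by move=> /sA /ballP.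
  have [q [y [qs ys rqy hv]]] := spaced_pigeonhole k0 r0 fL sz sep big.
  exists q, y; split => //; [|exact: sA|exact: sA].
  by rewrite -mdist_gt0; exact: lt_le_trans rqy.
have aE : r `^ a = r ^+ k * Num.sqrt r.
  by rewrite /a powRD ?(gt_eqF r0) ?implybT// powR_mulrn ?(ltW r0)// powR12_sqrt// ltW.
have sr0 : 0 < Num.sqrt r by rewrite sqrtr_gt0.
rewrite ler_pdivlMr ?powR_gt0// aE.
apply: le_trans (_ : A / r ^+ k * (r ^+ k * Num.sqrt r) <= _).
  rewrite ler_wpM2r ?mulr_ge0 ?exprn_ge0 ?(ltW r0) ?(ltW sr0)//.
  apply: le_trans (_ : ((Num.truncn (2 * e / (kap * r))).+1 ^ k)%:R <= _).
    by rewrite ler_nat.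
  rewrite natrX /A -expr_div_n lerXn2r ?nnegrE//.
    by rewrite divr_ge0 ?(ltW r0)// addr_ge0 ?(ltW e0)// divr_ge0 ?mulr_ge0 ?(ltW e0) ?(ltW k0).
  rewrite -(natr1 (Num.truncn _)) (mulrDl _ e); apply: lerD; last by rewrite ler_pdivlMr// mul1r.
  have -> : 2 * e / kap / r = 2 * e / (kap * r) by field; rewrite !gt_eqF.
  by rewrite truncn_le// divr_ge0 ?mulr_ge0 ?(ltW e0) ?(ltW k0) ?(ltW r0).
have -> : A / r ^+ k * (r ^+ k * Num.sqrt r) = A * Num.sqrt r.
  by field; rewrite expf_neq0// gt_eqF.
rewrite mulrC -ler_pdivlMr//.
rewrite -[leRHS]ger0_norm; last by rewrite divr_ge0 ?(ltW B0) ?(ltW A0).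
by rewrite -sqrtr_sqr; exact: ler_wsqrtr.
Qed.

Lemma obtuse_ip q x y g h (eta : R) : q != x -> q != y -> shortest_path q x g ->
  shortest_path q y h -> 0 <= eta -> pi / 2 + eta < path_angle q h g ->
  exists2 rho : R, 0 < rho & forall s, 0 < s < rho -> ip q (h s) (g s) <= - sin eta * s ^+ 2.
Proof.
move=> qx qy hg hh eta0 big; have [/andP[_ api] _ cl] := path_angle_spec fT qy qx hh hg.
have pi0 := pi_gt0 R.
have [|rho rho0 hr] := cl (path_angle q h g - (pi / 2 + eta)); first by rewrite subr_gt0.
have x0 : 0 < d q x by rewrite mdist_gt0.
have y0 : 0 < d q y by rewrite mdist_gt0.
exists (Num.min rho (Num.min (d q x) (d q y))); first by rewrite !lt_min rho0 x0.
move=> s /andP[s0]; rewrite !lt_min => /and3P[s1 /ltW s2 /ltW s3].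
have sr : 0 < s < rho by rewrite s0.
have := hr s s sr sr; rewrite subKr.
have sx : 0 < s <= d q x by rewrite s0.
have sy : 0 < s <= d q y by rewrite s0.
have [-> cb] := comparison_path hh hg sy sx.
have i : pi / 2 + eta \in `[0, pi] by rewrite in_itv/=; apply/andP; split; lra.
rewrite -{1}(cosK i) acos_lt ?cos_geN1 ?cos_le1// cos_pihalfD => /ltW.
by rewrite ler_pdivrMr ?mulr_gt0// expr2.
Qed.

Variable eta : R.
Hypothesis eta0 : 0 < eta.
Hypothesis obM : (eta%:E < ob_infty M)%E.

(** The obtuse angle may occur at either end of the vertical pair; in the second case the roles of
    [q] and [y] are exchanged. *)
Lemma obtuse_vertical_path (k : nat) z (e kap L : R) (f : nat -> M -> R) :
  (k < n)%N -> 0 < e -> 0 < kap -> (forall i x y, `|f i x - f i y| <= d x y) ->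
  exists q y x g h, [/\ q != y, ball z e q, ball z e y &
    forall i, (i < k)%N -> `|f i q - f i y| <= kap * d q y] /\
    [/\ shortest_path q x g, shortest_path q y h, L <= d q x &
      exists2 rho : R, 0 < rho & forall s, 0 < s < rho -> ip q (h s) (g s) <= - sin eta * s ^+ 2].
Proof.
move=> kn e0 k0 fL; have [e1 e10 he1] := ob_infty_gt obM.
have e'0 : 0 < Num.min e (e1 / 2) by rewrite lt_min e0 divr_gt0.
have [q [y [qy /ballP zq /ballP zy hv]]] := vertical_pair z kn e'0 k0 fL.
move: zq zy; rewrite !lt_min => /andP[zq zq1] /andP[zy zy1].
have qye : d q y < e1 by have := metric_triangle q z y; rewrite (metric_sym q z); lra.
have L0 := normr_ge0 L; have LL := ler_norm L; have qy0 := mdist_ge0 q y.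
pose r := `|L| + d q y + 1.
have r0 : 0 <= r by rewrite /r; lra.
have qqr : d q q < r by rewrite mdistxx /r; lra.
have qyr : d q y < r by rewrite /r; lra.
have [x [qxr]] := ob_pair_gt fT qy (he1 q y qy qye) r0 qqr qyr.
have yq : y != q by rewrite eq_sym.
have qxL : `|L| + 1 <= d q x by move: qxr; rewrite /r; lra.
have yxL : `|L| + 1 <= d y x by have := metric_triangle q y x; move: qxr; rewrite /r; lra.
have qx : q != x by rewrite -mdist_gt0; lra.
have yx : y != x by rewrite -mdist_gt0; lra.
case=> [[g hg H]|[g hg H]].
  have [h hh] := geod q y; exists q, y, x, g, h; split; first by split => //; exact/ballP.
  split => //; first lra.
  exact: (obtuse_ip qx qy hg hh (ltW eta0) (H h hh)).
have [h hh] := geod y q; exists y, q, x, g, h; split.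
  split => //; [exact/ballP|exact/ballP|].
  by move=> i ik; rewrite distrC metric_sym; exact: hv.
split => //; first lra.
exact: (obtuse_ip yx yq hg hh (ltW eta0) (H h hh)).
Qed.

Local Ltac lr := clear -iM dimM fT geod mono eta0 obM; lra.

Lemma strainer_step (k : nat) (kap lam A : R) z S : (k < n)%N -> 0 < kap ->
  0 < sin eta -> 8 * 37 * kap * k.+1%:R ^+ 2 <= sin eta ^+ 2 ->
  40 * 48 * k.+1%:R / sin eta ^+ 2 <= A -> A * kap <= 1 ->
  strained [set: M] k kap lam z S ->
  exists z' lam' S', [/\ strained [set: M] k.+1 (A * kap) lam' z' S',
    kap ^+ 3 * sin eta ^+ 2 / (8 * k.+1%:R) * lam <= lam' & d z z' + lam' <= lam].
Proof.
move=> kn k0 nu0; set nu := sin eta in nu0 *; set K : R := k.+1%:R => small hA Ak st.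
have nu1 : nu <= 1 by exact: sin_le1.
have nn : nu ^+ 2 <= 1 by rewrite exprn_ile1// ltW.
have n20 : 0 < nu ^+ 2 by rewrite exprn_gt0.
have K1 : 1 <= K by rewrite ler1n.
have K0 : 0 < K by apply: lt_le_trans K1.
have kE : k%:R = K - 1 by rewrite /K -natr1 addrK.
have lam0 : 0 < lam by case: st.
have A1 : 40 * 48 * K <= A * nu ^+ 2 by rewrite -ler_pdivrMr.
have A2 : 40 * 48 <= A.
  have A0 : 0 <= A by apply: le_trans hA; rewrite divr_ge0 ?(ltW n20)// mulr_ge0 ?(ltW K0)// mulr_ge0.
  have : A * nu ^+ 2 <= A by rewrite ler_piMr.
  by move: A1 K1; lr.
have kap1 : 40 * 48 * kap <= 1 by have := ler_wpM2r (ltW k0) A2; move: Ak; lr.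
have kap01 : 0 < kap <= 1 by rewrite k0 /=; move: kap1 k0; lr.
have nu01 : 0 < nu <= 1 by rewrite nu0.
pose f i p := d p (S i true).
have fL i x y : `|f i x - f i y| <= d x y by exact: mdist_diff.
have kl0 : 0 < kap * lam by rewrite mulr_gt0.
have kll : kap * lam <= lam / (40 * 48).
  by have := ler_wpM2r (ltW lam0) kap1; lr.
have e0 : 0 < kap * lam / 8 by rewrite divr_gt0.
pose u := kap * lam / (8 * K).
have u0 : 0 < u by rewrite divr_gt0// mulr_gt0.
have uK : K * u = kap * lam / 8 by rewrite /u; field; rewrite gt_eqF.
have VU x y w : [set: M] x -> [set: M] y -> d x w <= 2 * d x y -> [set: M] w by [].
have [q [y [x [g [h [[qy /ballP zq /ballP zy hv] [hg hh Lx [rho rho0 hip]]]]]]]] :=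
  obtuse_vertical_path z (2 * u) kn e0 k0 fL.
have qy0 : 0 < d q y by rewrite mdist_gt0.
have qyl : d q y <= kap * lam / 4.
  by have := metric_triangle q z y; rewrite (metric_sym q z); move: zq zy; lr.
(* The scale at which the angle at [q] is measured. It may be arbitrarily small against [u];
   [macroscopic_pair] carries the conclusion over to [u]. *)
pose m := Num.min (rho / 2) (Num.min u (d q y)).
have m0 : 0 < m by rewrite !lt_min divr_gt0// u0.
have m1 : m <= rho / 2 by rewrite ge_min lexx.
have m2 : m <= u by rewrite !ge_min lexx orbT.
have m3 : m <= d q y by rewrite !ge_min lexx !orbT.
clearbody m.
have mr : 0 < m < rho by rewrite m0 /=; move: m1 rho0; lr.
have ukl : (2 * k%:R + 2) * u <= kap * lam by rewrite kE; move: uK kl0; lr.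
have zqu : d z q + (2 * k%:R + 2) * u < lam.
  by rewrite kE; move: uK zq kll lam0; lr.
have mku : (2 * k%:R + 1) * m <= (2 * k%:R + 2) * u.
  rewrite kE; have : K * m <= K * u by rewrite ler_pM2l.
  by move: m2 m0; lr.
have em1 : d q (g m) = m.
  by apply: (shortest_path_start hg (ltW m0)); move: Lx m2 u0; lr.
have em2 : d q (h m) = m by apply: (shortest_path_start hh (ltW m0)).
have slope i : (i < k)%N -> `|d (h m) (S i true) - d q (S i true)| <= 6 * kap * m.
  move=> ik.
  have c1 : 0 < m <= d q y by rewrite m0.
  have c2 : d q y <= kap * lam by move: qyl kl0; lr.
  have c3 : d z q + d q y < lam by move: zq qyl kll lam0; lr.
  have := coordinate_slope fT mono kap01 st ik hh c1 (lexx _) c2 c3.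
  have -> : h (d q y) = y by case: hh.
  have := hv i ik; rewrite /f distrC => h1 h2.
  rewrite -(ler_pM2l qy0) -{1}(gtr0_norm qy0) -normrM.
  set a := _ - _ in h1 h2 *; set b := d (h m) (S i true) - _ in h2 *.
  have h3 : `|m * a| <= m * (kap * d q y) by rewrite normrM (gtr0_norm m0) ler_pM2l.
  move: h2 h3; rewrite !ler_norml => /andP[h2 h3] /andP[h4 h5].
  by apply/andP; split; move: h2 h3 h4 h5; lr.
have sl := obtuse_slopes iM fT kap01 st nu01 small m0 em1 em2 (hip m mr) slope.
have {}sl := sl (le_trans mku ukl) (le_lt_trans (lerD (lexx _) mku) zqu).
have c1 : 0 < m <= u by rewrite m0.
have [w [w1 w2 w3]] := macroscopic_pair iM fT mono kap01 st nu01 small hg c1 Lx ukl zqu sl.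
(* The coordinates of [w] and [q] differ by at most [6 * kap * (k%:R * u)], at a distance of at
   least [nu ^+ 2 / 8 * u]. The hypothesis on [A] makes [kap'] exceed the ratio, and the extension
   multiplies it by 20. *)
pose kap' := A * kap / 20.
have kap'0 : 0 < kap' by rewrite /kap' divr_gt0// mulr_gt0//; move: A2; lr.
have kk' : kap <= kap'.
  by have := ler_wpM2r (ltW k0) A2; rewrite /kap'; move: k0; lr.
have kap'20 : 20 * kap' <= 1 by rewrite /kap'; move: Ak; lr.
have st' : strained [set: M] k kap' lam z S.
  by apply: (strained_weaken _ lam0 (lexx _) _ st); rewrite ?(ltW k0)// mdistxx add0r.
have w0 : 0 < d q w by apply: lt_le_trans w1; rewrite mulr_gt0// divr_gt0.
have w2' : d q w <= kap * lam / 4.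
  by apply: (le_trans w2); rewrite kE; move: uK u0; lr.
have qw : q != w by rewrite -mdist_gt0.
have zq2 : ball z (lam / 2) q by apply/ballP; move: zq kll lam0; lr.
have zw2 : ball z (lam / 2) w.
  by apply/ballP; have := metric_triangle z q w; move: zq w2' kll lam0; lr.
have qwl : d q w <= kap' * lam.
  by have := ler_wpM2r (ltW lam0) kk'; move: w2' kl0; lr.
have vert i : (i < k)%N -> `|d q (S i true) - d w (S i true)| <= kap' * d q w.
  move=> ik; apply: (le_trans (w3 i ik)).
  apply: le_trans (ler_wpM2l (ltW kap'0) w1).
  have h1 := ler_wpM2r (ltW (mulr_gt0 k0 u0)) A1.
  have h2 : 0 <= kap * u by rewrite mulr_ge0 ?(ltW k0) ?(ltW u0).
  have h3 : 0 <= K * (kap * u) by rewrite mulr_ge0// ltW.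
  by rewrite /kap' kE; move: h1 h2 h3; lr.
have [z' [S' [st2 qz']]] := strained_extend iM fT VU kap'0 kap'20 st' zq2 zw2 qw qwl vert.
exists z', (8 * kap' ^+ 2 * d q w), S'; split.
- by have <- : 20 * kap' = A * kap by rewrite /kap'; field.
- have k2 : kap ^+ 2 <= kap' ^+ 2 by rewrite lerXn2r ?nnegrE ?(ltW k0) ?(ltW kap'0).
  have -> : kap ^+ 3 * nu ^+ 2 / (8 * K) * lam = 8 * kap ^+ 2 * (nu ^+ 2 / 8 * u).
    by rewrite /u; field; rewrite gt_eqF.
  apply: ler_pM => //; first by rewrite mulr_ge0 ?sqr_ge0.
    by rewrite mulr_ge0 ?(ltW u0)// divr_ge0 ?sqr_ge0.
  by rewrite ler_pM2l.
- have h1 : kap' ^+ 2 * d q w <= 1 * d q w.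
    by rewrite ler_pM2r// exprn_ile1 ?(ltW kap'0)//; move: kap'20 kap'0; lr.
  have := metric_triangle z q z'.
  by move: zq qz' w2' kll lam0 h1; lr.
Qed.

Hypothesis complete : complete_metric M.

Lemma ball_hausdorff_ge p (r : R) : (0 < n)%N -> 0 < sin eta -> 0 < r ->
  ((growth_const n (sin eta) * r ^+ n)%:E <= unnormalized_hausdorff n%:R (ball p r))%E.
Proof.
move=> n0 nu0 r0; rewrite /growth_const; set nu := sin eta in nu0 *.
have nR : 0 < n%:R :> R by rewrite ltr0n.
have n1 : 1 <= n%:R :> R by rewrite ler1n.
have nu1 : nu <= 1 by exact: sin_le1.
have n20 : 0 < nu ^+ 2 by rewrite exprn_gt0.
have nn : nu ^+ 2 <= 1 by rewrite exprn_ile1// ltW.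
set A := _ * _ / nu ^+ 2; set kap0 := _ / A ^+ n; set a := kap0 ^+ 3 * _ / _ => /=.
have c0 : 0 < 40 * 48 :> R by rewrite mulr_gt0.
have A0 : 0 < A by rewrite divr_gt0// mulr_gt0.
have A1 : 1 <= A.
  rewrite ler_pdivlMr// mul1r (le_trans nn)//.
  by move: n1; lr.
have k0E : kap0 * A ^+ n = nu ^+ 2 / (8 * 37 * n%:R ^+ 2) by rewrite divfK// expf_neq0// gt_eqF.
have nn0 : 0 < n%:R ^+ 2 :> R by rewrite exprn_gt0.
have k00 : 0 < kap0 by rewrite divr_gt0 ?exprn_gt0// divr_gt0// !mulr_gt0.
have kn : 8 * 37 * (kap0 * A ^+ n) * n%:R ^+ 2 = nu ^+ 2.
  by rewrite k0E; field; rewrite gt_eqF.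
pose kap k := kap0 * A ^+ k.
have kap_gt0 k : 0 < kap k by rewrite mulr_gt0// exprn_gt0.
have kapn k : (k <= n)%N -> kap k <= kap n by move=> kn'; rewrite ler_pM2l// ler_weXn2l.
have kapn1 : 8 * 37 * kap n * n%:R <= 1.
  have h : 8 * 37 * kap n * n%:R <= 8 * 37 * kap n * n%:R * n%:R.
    by rewrite ler_peMr// mulr_ge0 ?(ltW nR)// mulr_ge0 ?(ltW (kap_gt0 n))// mulr_ge0.
  by move: kn nn h; rewrite -/(kap n) expr2 mulrA => -> ; lr.
have kapn2 : 8 * 37 * kap n <= 1.
  apply: le_trans kapn1; by rewrite ler_peMr// mulr_ge0 ?(ltW (kap_gt0 n))// mulr_ge0.
have a0 : 0 < a.
  by rewrite divr_gt0//; [apply: mulr_gt0 => //; exact: exprn_gt0|exact: mulr_gt0].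
have main k : (k <= n)%N -> exists z lam S, [/\ strained [set: M] k (kap k) lam z S,
    a ^+ k * r <= lam & d p z + lam <= r].
  elim: k => [_|k IH kn'].
    exists p, r, (fun _ _ => p); split; first by split.
      by rewrite expr0 mul1r.
    by rewrite mdistxx add0r.
  have [z [lam [S [st l1 l2]]]] := IH (ltnW kn').
  have lam0 : 0 < lam by case: st.
  have Kn : k.+1%:R <= n%:R :> R by rewrite ler_nat.
  have K0 : 0 < k.+1%:R :> R by rewrite ltr0n.
  have [|||z' [lam' [S' [st' l1' l2']]]] := strainer_step (A := A) kn' (kap_gt0 k) nu0 _ _ _ st.
  - rewrite -kn -/(kap n) -!(mulrA (8 * 37)) ler_pM2l; last exact: mulr_gt0.
    apply: ler_pM; [exact: ltW|exact: sqr_ge0|exact/kapn/ltnW|].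
    by rewrite lerXn2r ?nnegrE ?ler0n.
  - by rewrite /A ler_pM2r ?invr_gt0// ler_pM2l.
  - have -> : A * kap k = kap k.+1 by rewrite /kap exprS; ring.
    by have := kapn _ kn'; move: kapn2 (kap_gt0 n); lr.
  exists z', lam', S'; split.
  - by have -> : kap k.+1 = A * kap k by rewrite /kap exprS; ring.
  - apply: le_trans l1'; rewrite exprS -mulrA.
    apply: ler_pM => //; rewrite ?(ltW a0) ?mulr_ge0 ?exprn_ge0 ?(ltW a0) ?(ltW r0)//.
    rewrite /a; apply: ler_pM.
    + by rewrite mulr_ge0 ?exprn_ge0 ?(ltW k00) ?(ltW nu0).
    + by rewrite invr_ge0 mulr_ge0 ?ler0n.
    + rewrite ler_pM2r// lerXn2r ?nnegrE ?(ltW k00) ?(ltW (kap_gt0 k))//.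
      by rewrite ler_peMr ?(ltW k00)// exprn_ege1.
    + by rewrite lef_pV2 ?posrE ?mulr_gt0 ?ltr0n// ler_pM2l ?ltr0n.
  - by have := metric_triangle p z z'; move: l2 l2'; lr.
have [z [lam [S [st l1 l2]]]] := main n (leqnn n).
have VU x y w : [set: M] x -> [set: M] y -> d x w <= 2 * d x y -> [set: M] w by [].
have k1 : 0 < kap n <= 1 by rewrite kap_gt0 /=; move: kapn2 (kap_gt0 n); lr.
have k12 : 12 * kap n * n%:R <= 1.
  have : 0 < kap n * n%:R by rewrite mulr_gt0.
  by move: kapn1; lr.
have := strained_hausdorff_ge iM fT VU complete n0 k1 k12 st.
move=> /(le_trans _)/le_trans; apply; last first.
  apply: unnormalized_hausdorffS => x /ballP zx; apply/ballP.
  by have := metric_triangle p z x; move: zx l2; lr.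
have lam0 : 0 < lam by case: st.
have n16 : 0 < 16 * n%:R :> R by exact: mulr_gt0.
rewrite lee_fin -exprMn -/(kap n).
have e1 : 0 < kap n * a ^+ n / (16 * n%:R).
  by apply: divr_gt0 => //; apply: mulr_gt0 => //; exact: exprn_gt0.
apply: lerXn2r.
- by rewrite nnegrE; apply: mulr_ge0; exact: ltW.
- by rewrite nnegrE; apply: divr_ge0; [apply: mulr_ge0|]; exact: ltW.
- rewrite mulrAC ler_pM2r ?invr_gt0// -mulrA.
  by rewrite ler_pM2l.
Qed.

End volume_lower_bound.

(** * Comparison functions *)

(* The infimum over eta of eta + (a / c eta) v is monotone in v and at most
   proportional to v away from 0, hence continuous; adding v makes it strictly
   increasing. *)
Lemma modulus_exists (R : realType) (c : R -> R) (a : R) : 0 < a ->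
  (forall eta, 0 < eta <= a -> 0 < c eta) ->
  exists C, continuous_increasing_from0 C /\
    forall v b : R, 0 <= v -> b <= a -> (forall eta, 0 < eta <= a -> eta < b -> c eta <= v) -> b <= C v.
Proof.
move=> a0 c0; pose E v := [set w | exists2 eta : R, 0 < eta <= a & w = eta + a * v / c eta].
have aa : 0 < a <= a by rewrite a0 lexx.
have E0 v : 0 <= v -> has_inf (E v).
  move=> v0; split; first by exists (a + a * v / c a), a.
  exists 0 => _ [eta ea ->]; have /andP[e0 _] := ea.
  by rewrite addr_ge0 ?(ltW e0)// divr_ge0 ?mulr_ge0 ?(ltW a0) ?(ltW (c0 _ ea)).
pose G v := inf (E v).
have Gle v eta : 0 <= v -> 0 < eta <= a -> G v <= eta + a * v / c eta.
  by move=> v0 ea; apply: (ge_inf (E0 v v0).2); exists eta.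
have Gge v b : 0 <= v -> (forall eta, 0 < eta <= a -> b <= eta + a * v / c eta) -> b <= G v.
  by move=> v0 h; apply: lb_le_inf; [exact: (E0 v v0).1|move=> _ [eta ea ->]; exact: h].
have G0 v : 0 <= v -> 0 <= G v.
  move=> v0; apply: Gge => // eta ea; have /andP[e0 _] := ea.
  by rewrite addr_ge0 ?(ltW e0)// divr_ge0 ?mulr_ge0 ?(ltW a0) ?(ltW (c0 _ ea)).
have Gmono v w : 0 <= v -> v <= w -> G v <= G w.
  move=> v0 vw; apply: Gge; first exact: le_trans vw.
  move=> eta ea; apply: le_trans (Gle _ _ v0 ea) _.
  by rewrite lerD2l ler_pM2r ?invr_gt0 ?c0// ler_pM2l.
have Gdil v w : 0 < v -> v <= w -> G w <= w / v * G v.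
  move=> v0 vw; have wv : 1 <= w / v by rewrite ler_pdivlMr// mul1r.
  have wv0 : 0 < w / v by apply: lt_le_trans wv.
  rewrite mulrC -ler_pdivrMr//; apply: Gge; first exact: ltW.
  move=> eta ea; have /andP[e0 _] := ea.
  rewrite ler_pdivrMr//; apply: le_trans (Gle w eta (le_trans (ltW v0) vw) ea) _.
  have -> : (eta + a * v / c eta) * (w / v) = eta * (w / v) + a * w / c eta.
    by field; rewrite !gt_eqF// c0.
  by rewrite lerD2r ler_peMr// ltW.
have Gzero : G 0 = 0.
  apply/eqP; rewrite eq_le G0// andbT; apply/ler_addgt0Pl => e e0; rewrite addr0.
  pose eta := Num.min a e.
  have ea : 0 < eta <= a by rewrite lt_min a0 e0 ge_min lexx.
  apply: le_trans (Gle 0 _ (lexx 0) ea) _.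
  by rewrite mulr0 mul0r addr0 ge_min lexx orbT.
exists (fun v => v + G v); split; last first.
  (* If [eta < b], then [c eta <= v], and already the second summand [a * v / c eta] is at least
     [a], hence at least [b]. *)
  move=> v b v0 ba h; apply: le_trans (_ : G v <= _); last by rewrite lerDr.
  apply: Gge => // eta ea; have /andP[e0 _] := ea; have c_gt0 := c0 _ ea.
  have [bq|qb] := leP b eta.
    by rewrite (le_trans bq)// lerDl divr_ge0 ?mulr_ge0 ?(ltW a0) ?(ltW c_gt0).
  apply: (le_trans ba); apply: le_trans (_ : a * v / c eta <= _); last by rewrite lerDr ltW.
  by rewrite ler_pdivlMr// ler_pM2l// h.
split; last by rewrite Gzero addr0.
- apply/continuous_within_itvcyP; split.
  + move=> v; rewrite in_itv/= andbT => v0.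
    apply: cvgD; first exact: cvg_id.
    apply/cvgrPdist_le => /= e e0.
    have G1 : 0 < G v + 1 by rewrite ltr_wpDl// G0// ltW.
    pose t := Num.min (v / 4) (e * v / (4 * (G v + 1))).
    have t0 : 0 < t by rewrite lt_min !divr_gt0 ?mulr_gt0.
    near=> w.
    have wt : `|v - w| <= t.
      by near: w; apply/nbhs_normP; exists t => //= w /=; exact: ltW.
    have w2 : v / 2 < w.
      have : t <= v / 4 by rewrite ge_min lexx.
      by move: wt; rewrite ler_norml => /andP[_]; lra.
    have w0 : 0 < w by apply: lt_trans w2; rewrite divr_gt0.
    have vw : `|v - w| * (4 * (G v + 1)) <= e * v.
      by rewrite -ler_pdivlMr ?mulr_gt0//; apply: (le_trans wt); rewrite ge_min lexx orbT.
    have Gv := G0 v (ltW v0).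
    have [le_vw|lt_wv] := leP v w.
      rewrite distrC ger0_norm ?subr_ge0 ?Gmono ?(ltW v0)//.
      have := Gdil v w v0 le_vw; rewrite distrC ger0_norm ?subr_ge0// in vw.
      have wv0 : 0 <= w - v by rewrite subr_ge0.
      rewrite mulrAC ler_pdivlMr// => h; rewrite -(ler_pM2r v0).
      have : 0 <= (w - v) * G v by rewrite mulr_ge0.
      by move: vw h wv0; clear; lra.
    rewrite ger0_norm ?subr_ge0 ?Gmono ?(ltW w0) ?(ltW lt_wv)//.
    have := Gdil w v w0 (ltW lt_wv); rewrite ger0_norm ?subr_ge0 ?(ltW lt_wv)// in vw.
    have wv0 : 0 <= v - w by rewrite subr_ge0 ltW.
    rewrite mulrAC ler_pdivlMr// => h; rewrite -(ler_pM2r w0).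
    have Gw : G w <= G v by rewrite Gmono ?(ltW w0) ?(ltW lt_wv).
    have h1 : (v - w) * G w <= (v - w) * G v by rewrite ler_wpM2l.
    have h2 : 0 <= (v - w) * G v by rewrite mulr_ge0.
    have h3 : e * (v / 2) <= e * w by rewrite ler_pM2l// ltW.
    by move: vw h h1 h2 h3 wv0; clear; lra.
  + rewrite Gzero addr0.
    apply/cvgrPdist_le => /= e e0.
    pose eta := Num.min a (e / 3).
    have ea : 0 < eta <= a by rewrite lt_min a0 divr_gt0//= ge_min lexx.
    have ee : eta <= e / 3 by rewrite ge_min lexx orbT.
    have ce := c0 _ ea.
    near=> w.
    have w0 : 0 < w by near: w; exact: nbhs_right_gt.
    have w1 : w <= e / 3 by near: w; apply: nbhs_right_le; rewrite divr_gt0.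
    have w2 : w <= e / 3 * c eta / a by near: w; apply: nbhs_right_le; rewrite divr_gt0 ?mulr_gt0 ?divr_gt0.
    have h : a * w / c eta <= e / 3.
      by rewrite ler_pdivrMr// mulrC -ler_pdivlMr.
    have := Gle w eta (ltW w0) ea; have := G0 w (ltW w0) => h1 h2.
    rewrite sub0r normrN ger0_norm ?addr_ge0 ?(ltW w0)//; lra.
- move=> v w; rewrite !in_itv/= !andbT => v0 w0 vw.
  by apply: ltr_leD => //; apply: Gmono => //; exact: ltW.
Unshelve. all: by end_near. Qed.

(** * The two estimates for noncompact Alexandrov spaces *)

Section alexandrov_spaces.
Context {R : realType} {M : metricType R}.
Implicit Types x y z p q o : M.
Local Notation d x y := (@mdist R M x y : R).

Variable n : nat.
Hypothesis n0 : (0 < n)%N.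
Hypothesis complete : complete_metric M.
Hypothesis iM : intrinsic M.
Hypothesis cM : curvature_ge0 M.
Hypothesis dimM : hausdorff_dim [set: M] = n%:R%:E.
Hypothesis ncM : ~ compact [set: M].

Lemma unbounded o (r : R) : exists x, r <= d o x.
Proof.
apply: contrapT => h; apply: ncM; apply: tb_compact => //.
apply: tb_sub (ball_totally_bounded complete iM dimM cM o r) => x _.
by apply/ballP; rewrite ltNge; apply/negP => rx; apply: h; exists x.
Qed.

Let geod p q : exists g, shortest_path p q g.
Proof. exact: (shortest_path_exists complete iM dimM cM). Qed.

(** Without close pairs the lower limit defining [ob_infty] would be infinite; its upper bound by pi
    / 2 needs them. *)
Lemma close_pair (e : R) : 0 < e -> exists p q, p != q /\ d p q < e.
Proof.
move=> e0; have [c _] : exists c : M, True.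
  apply: contrapT => h; apply: ncM.
  have -> : [set: M] = set0 by apply/seteqP; split => // x _; apply: h; exists x.
  exact: compact0.
have [x ex] := unbounded c e; have [g hg] := geod c x.
have e2 : 0 < e / 2 by rewrite divr_gt0.
have eo : d c (g (e / 2)) = e / 2 by apply: (shortest_path_start hg); lra.
by exists c, (g (e / 2)); rewrite -mdist_gt0 eo; split => //; lra.
Qed.

Let radius o (r : R) : exists2 r0 : R, 0 < r0 & forall x, ball o r x -> fourpt (ball x r0).
Proof. exact: (ball_fourpt_radius complete iM dimM cM). Qed.

Let fT : fourpt [set: M].
Proof. exact: (global_fourpt geod radius). Qed.

Let mono x y z p : d x z + d z y = d x y -> d x y * ip x z p <= d x z * ip x y p.
Proof. exact: (global_mono geod radius). Qed.

Let C : R := packing_const n.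

Let C1 : 1 <= C.
Proof.
rewrite /C /packing_const -[leLHS]mulr1; apply: ler_pM => //; last by rewrite ler1n.
by rewrite -[leLHS]mulr1; apply: ler_pM => //; rewrite ?exprn_ege1 ?ler1n.
Qed.

Let packing p (rho alpha : R) (s : seq M) : 0 < rho -> 0 < alpha <= 1 ->
  (forall x, x \in s -> d p x < rho) -> spaced (alpha * rho) s ->
  (size s)%:R <= (C / alpha) ^+ n.
Proof.
move=> rho0 al sp sep.
by apply: (packing_bound (V := setT) (U := setT) iM fT _ complete dimM rho0 al _ sp sep).
Qed.

Let om : R := unit_ball_volume R n / 2 ^+ n.

Lemma volume_growth_ob_bounds p :
  [/\ 0 <= volume_growth_rate n p,
      volume_growth_rate n p <= om * (2 * C) ^+ n,
      (0 <= ob_infty M)%E & (ob_infty M <= (pi / 2)%:E)%E] /\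
  (forall eta : R, 0 < eta <= 1 / 24 -> (ob_infty M < eta%:E)%E ->
     volume_growth_rate n p <= om * (2 ^+ n * 2 ^+ n * (25 * (12 * C ^+ 2) ^+ n)) * eta) /\
  forall eta : R, 0 < eta <= pi / 2 -> (eta%:E < ob_infty M)%E ->
     om * growth_const n (sin eta) <= volume_growth_rate n p.
Proof.
have C0 : 0 < C by apply: lt_le_trans C1.
have [v0 vge vle] := volume_growth_spec geod mono n0 C0 packing p.
split; [split => //|split].
- by apply: (vle _ 0) => r r0; apply: ball_hausdorff_le.
- exact: (ob_infty_ge0 fT geod unbounded).
- rewrite leNgt; apply/negP => /ob_infty_gt[e e0 he].
  have [x [y [xy xye]]] := close_pair e0.
  by have := he x y xy xye; rewrite ltNge (ob_pair_le fT geod xy).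
- by move=> eta ? ?; apply: volume_growth_le.
- move=> eta /andP[eta0 eta1] ob; apply: vge => r r0.
  apply: ball_hausdorff_ge => //; apply: sin_gt0_pi.
  by have := pi_gt0 R; rewrite eta0 /= => ?; lra.
Qed.

End alexandrov_spaces.

Theorem theorem1p4 (R : realType) (n : nat) (n_gt0 : (0 < n)%N) :
  exists eps C : R -> R,
    [/\ continuous_increasing_from0 eps,
        continuous_increasing_from0 C &
        forall M : metricType R,
          complete_alexandrov_ge0 M n -> ~ compact [set: M] ->
          forall p : M,
            ((eps (volume_growth_rate n p))%:E <= ob_infty M)%E /\
            (ob_infty M <= (C (volume_growth_rate n p))%:E)%E /\
            (volume_growth_rate n p = 0 <-> ob_infty M = 0%E)].
Proof.
pose om : R := unit_ball_volume R n / 2 ^+ n; pose Cp : R := packing_const n.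
have om0 : 0 < om by rewrite divr_gt0 ?unit_ball_volume_gt0// exprn_gt0.
have Cp0 : 0 < Cp by exact: packing_const_gt0.
pose K1 := om * (2 ^+ n * 2 ^+ n * (25 * (12 * Cp ^+ 2) ^+ n)).
pose V0 := om * (2 * Cp) ^+ n.
have V00 : 0 < V0 by rewrite mulr_gt0// exprn_gt0// mulr_gt0.
(* The slab argument gives [K1] when the obtuse constant is below 1 / 24. Otherwise the bound [V0]
   on the volume growth rate is at most [24 * V0] times that constant. *)
pose K := Num.max K1 (24 * V0).
have K0 : 0 < K by rewrite lt_max; apply/orP; right; exact: mulr_gt0.
have pi0 : 0 < pi / 2 :> R by rewrite divr_gt0// pi_gt0.
have c0 (eta : R) : 0 < eta <= pi / 2 -> 0 < om * growth_const n (sin eta).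
  move=> /andP[e0 e1]; apply: mulr_gt0 => //; apply: growth_const_gt0 => //.
  by apply: sin_gt0_pi; rewrite e0 /=; move: pi0 e1; lra.
have [C [C1 C2]] := modulus_exists pi0 c0.
exists (fun v => v / K), C; split => //.
  split; last by rewrite mul0r.
    by apply: continuous_subspaceT => x; apply: cvgMr_tmp; exact: cvg_id.
  by move=> x y _ _ xy; rewrite ltr_pM2r ?invr_gt0.
move=> M [complete iM cM dimM] nc p.
have [[v0 vV ob0 obpi] [hA hB]] := volume_growth_ob_bounds n_gt0 complete iM cM dimM nc p.
rewrite -/om -/Cp -/K1 in vV hA hB.
set v := volume_growth_rate n p in v0 vV hA hB *.
have [b ob] : exists b, ob_infty M = b%:E.
  by case: (ob_infty M) ob0 obpi => [b| |]// _ _; exists b.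
rewrite ob !lee_fin in ob0 obpi hA hB *.
have lower : v / K <= b.
  rewrite ler_pdivrMr//; have [b24|b24] := leP (1 / 24) b.
    apply: le_trans vV _; apply: le_trans (_ : b * (24 * V0) <= _).
      have := ler_wpM2r (ltW V00) b24; rewrite -/V0; lra.
    by rewrite ler_wpM2l// le_max lexx orbT.
  apply: le_trans (_ : b * K1 <= _); last by rewrite ler_wpM2l// le_max lexx.
  have K10 : 0 < K1.
    apply: mulr_gt0 => //; apply: mulr_gt0; first by apply: mulr_gt0; exact: exprn_gt0.
    apply: mulr_gt0 => //; apply: exprn_gt0; apply: mulr_gt0 => //; exact: exprn_gt0.
  rewrite -ler_pdivrMr//; apply/ler_addgt0Pl => e e0.
  (* The estimate needs [eta] strictly above the obtuse constant, hence the slack [e]. *)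
  pose eta := Num.min (e + b) (1 / 24).
  have be : b < eta by rewrite lt_min b24 andbT ltrDr.
  have ee : eta <= e + b by rewrite ge_min lexx.
  apply: le_trans ee; rewrite ler_pdivrMr// mulrC; apply: hA; last by rewrite lte_fin.
  by rewrite (le_lt_trans ob0 be) /eta ge_min lexx orbT.
have upper : b <= C v.
  by apply: C2 => // eta h1 h2; apply: hB.
split => //; split => //; split => [v00|[b00]].
  have [_ _ C00] := C1; congr (_%:E); apply/eqP; rewrite eq_le ob0 andbT.
  by rewrite v00 C00 in upper.
apply/eqP; rewrite eq_le v0 andbT.
by move: lower; rewrite b00 ler_pdivrMr// mul0r.
Qed.
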